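(* Let $W$ be a vector space over $\mathbb{F}$ and let $U$ be any compatible (resp. quasi compatible) subset of $\mathcal{E}(W)$. Let $\langle U\rangle$ be the smallest $Y_{\mathcal{E}}$-closed compatible (resp. quasi compatible) $\mathbb{F}$-subspace of $\mathcal{E}(W)$ that contains $U$ and $1_W$. Then the $\mathbb{F}((x))$-span $\mathbb{F}((x))\langle U\rangle$ is a $Y_{\mathcal{E}}$-closed compatible (resp. quasi compatible) $\mathbb{F}((x))$-submodule of $\mathcal{E}(W)$. Furthermore, $(\mathbb{F}((x))\langle U\rangle, Y_{\mathcal{E}},1_W)$ carries the structure of a nonlocal vertex $\mathbb{F}((t))$-algebra, where $f(t)a(x)=f(x)a(x)$ for $f(t)\in\mathbb{F}((t))$, $a(x)\in\mathbb{F}((x))\langle U\rangle$, and $(W,Y_W)$ carries the structure of a module (resp. quasi module) of type zero for $\mathbb{F}((x))\langle U\rangle$ with $Y_W(a(x),x_0)=a(x_0)$ for $a(x)\in\mathbb{F}((x))\langle U\rangle$.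
   Context: $\mathbb{F}$ is a field of characteristic $0$; $t,x,y,x_0,x_1,\dots$ are commuting formal variables. $W((x))$ is the space of lower truncated Laurent series; $W((x_1,\dots,x_r))$ consists of series globally truncated from below in all variables. $\mathbb{F}_*(x_1,\dots,x_r)$ is the localization of $\mathbb{F}[[x_1,\dots,x_r]]$ at the nonzero polynomials, and $\iota_{x_{i_1},\dots,x_{i_r}}:\mathbb{F}_*(x_1,\dots,x_r)\to\mathbb{F}((x_{i_1}))\cdots((x_{i_r}))$ is the unique algebra embedding extending the identity of $\mathbb{F}[[x_1,\dots,x_r]]$. Powers $(x_0+x_2)^n$ are expanded in nonnegative powers of the second variable; $f(t+x)=e^{x\,d/dt}f(t)\in\mathbb{F}((t))[[x]]$. Nonlocal vertex algebra over $\mathbb{F}$: a vector space $V$ with a linear map $Y(\cdot,x):V\to\mathrm{Hom}(V,V((x)))$, $v\mapsto Y(v,x)=\sum_{n\in\mathbb{Z}}v_nx^{-n-1}$, and a vector $\mathbf{1}\in V$ such that $Y(\mathbf{1},x)v=v$, $Y(v,x)\mathbf{1}\in V[[x]]$, $\lim_{x\to0}Y(v,x)\mathbf{1}=v$ for $v\in V$, and for all $u,v,w\in V$ there is $l\in\mathbb{N}=\{0,1,\dots\}$ with $(x_0+x_2)^lY(u,x_0+x_2)Y(v,x_2)w=(x_0+x_2)^lY(Y(u,x_0)v,x_2)w$. A module for such $V$ is a vector space $W$ with a linear map $Y_W(\cdot,x):V\to\mathrm{Hom}(W,W((x)))$ such that $Y_W(\mathbf{1},x)=1_W$ and for $u,v\in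 V,w\in W$ there is $l\in\mathbb{N}$ with $(x_0+x_2)^lY_W(u,x_0+x_2)Y_W(v,x_2)w=(x_0+x_2)^lY_W(Y(u,x_0)v,x_2)w$. A quasi module is defined in the same way with the last condition replaced by: for $u,v,w$ there is a nonzero polynomial $p(x_1,x_2)\in\mathbb{F}[x_1,x_2]$ with $p(x_0+x_2,x_2)Y_W(u,x_0+x_2)Y_W(v,x_2)w=p(x_0+x_2,x_2)Y_W(Y(u,x_0)v,x_2)w$. Nonlocal vertex $\mathbb{F}((t))$-algebra: a nonlocal vertex algebra $V$ over $\mathbb{F}$ which is also an $\mathbb{F}((t))$-module with $Y(f(t)u,x)(g(t)v)=f(t+x)g(t)Y(u,x)v$ for $f(t),g(t)\in\mathbb{F}((t))$, $u,v\in V$. A (quasi) $V$-module of type zero is a (quasi) module $(W,Y_W)$ for $V$ as a nonlocal vertex algebra over $\mathbb{F}$ such that $Y_W(f(t)v,x)w=f(x)Y_W(v,x)w$ for $f(t)\in\mathbb{F}((t)),v\in V,w\in W$. $\mathcal{E}(W)=\mathrm{Hom}(W,W((x)))$, an $\mathbb{F}((x))$-module; $1_W\in\mathcal{E}(W)$ is the identity operator. A finite sequence $a_1(x),\dots,a_r(x)$ in $\mathcal{E}(W)$ is quasi compatible if there is a nonzero $p(x,y)\in\mathbb{F}[x,y]$ with $\left(\prod_{1\le i<j\le r}p(x_i,x_j)\right)a_1(x_1)\cdots a_r(x_r)\in\mathrm{Hom}(W,W((x_1,\dots,x_r)))$; compatible if this holds with $p(x,y)=(x-y)^k$ for some $k\in\mathbb{N}$.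 A subset (or subspace) is (quasi) compatible if every finite sequence in it is. For a quasi compatible pair $(a(x),b(x))$, choose a nonzero polynomial $p$ with $p(x_1,x_2)a(x_1)b(x_2)\in\mathrm{Hom}(W,W((x_1,x_2)))$ and define $a(x)_nb(x)\in\mathcal{E}(W)$ by $$Y_{\mathcal{E}}(a(x),x_0)b(x)=\sum_{n\in\mathbb{Z}}a(x)_nb(x)x_0^{-n-1}=\iota_{x,x_0}\left(\frac{1}{p(x+x_0,x)}\right)\left(p(x_1,x)a(x_1)b(x)\right)|_{x_1=x+x_0}$$ (independent of $p$). A quasi compatible subspace $K$ is $Y_{\mathcal{E}}$-closed if $a(x)_nb(x)\in K$ for all $a(x),b(x)\in K$, $n\in\mathbb{Z}$. It is known that the smallest subspace $\langle U\rangle$ in the claim exists. *)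

(* Defs.v *)
From HB Require Import structures.
From mathcomp Require Import all_boot all_order all_algebra.
From mathcomp Require Import polyXY zify.
From mathcomp Require Import boolp classical_sets functions fsbigop.

Set Implicit Arguments.
Unset Strict Implicit.
Unset Printing Implicit Defensive.
Import Order.TTheory GRing.Theory Num.Theory.
Local Open Scope classical_set_scope.
Local Open Scope ring_scope.

(* A doubly infinite formal series is the function of its coefficients: the
   value at [n] is the coefficient of [x^n]. *)
Definition truncated (V : zmodType) (f : int -> V) : Prop :=
  exists N : int, forall n, n < N -> f n = 0.

Definition truncatedb (V : zmodType) : pred (int -> V) :=
  fun f => `[< truncated f >].

Record laurent (V : zmodType) := Laurent {
  lcoef :> int -> V;
  _ : truncatedb lcoef }.

HB.instance Definition _ (V : zmodType) := [isSub for @lcoef V].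
HB.instance Definition _ (V : zmodType) := [Choice of laurent V by <:].

Lemma truncated_zmod (V : zmodType) : zmod_closed (@truncatedb V).
Proof.
split=> [|f g /asboolP[M fM] /asboolP[N gN]]; first by apply/asboolP; exists 0.
apply/asboolP; exists (Num.min M N) => n; rewrite lt_min => /andP[nM nN].
by change (f n - g n = 0); rewrite fM // gN // subrr.
Qed.

HB.instance Definition _ (V : zmodType) :=
  GRing.SubChoice_isSubZmodule.Build (int -> V) (@truncatedb V) (laurent V)
    (@truncated_zmod V).

Lemma truncated_lmod (R : pzRingType) (V : lmodType R) :
  subsemimod_closed (@truncatedb V).
Proof.
split.
  by have [h0 hB] := truncated_zmod V; split=> // f g Hf Hg;
    rewrite -[g]opprK; apply: (hB) => //; rewrite -[- g]add0r; apply: hB.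
move=> c f /asboolP[M fM]; apply/asboolP; exists M => n nM.
by change (c *: f n = 0); rewrite fM // scaler0.
Qed.

HB.instance Definition _ (R : pzRingType) (V : lmodType R) :=
  GRing.SubZmodule_isSubLmodule.Build R (int -> V) (@truncatedb V) (laurent V)
    (@truncated_lmod R V).

Lemma laurentP (V : zmodType) (f g : laurent V) : (forall n, f n = g n) -> f = g.
Proof. by move=> fg; apply: val_inj; apply: funext. Qed.

Lemma laurent_trunc (V : zmodType) (f : laurent V) : truncated f.
Proof. by case: f => f hf; exact: asboolW. Qed.

Definition mkLaurent (V : zmodType) (f : int -> V) (h : truncated f) : laurent V :=
  Laurent (asboolT h).

Lemma lcoef0 (V : zmodType) n : (0 : laurent V) n = 0.
Proof. by []. Qed.

Lemma lcoefD (V : zmodType) (f g : laurent V) n : (f + g) n = f n + g n.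
Proof. by []. Qed.

Lemma lcoefZ (R : pzRingType) (V : lmodType R) c (f : laurent V) n :
  (c *: f) n = c *: f n.
Proof. by []. Qed.

Definition lconst (V : zmodType) (v : V) : laurent V.
Proof.
apply: (@mkLaurent V (fun n => if n == 0 then v else 0)).
by exists 0 => n; case: ltgtP.
Defined.

(* The coefficients of the product of two series; the sum over [i] has finite
   support as soon as both series are lower truncated. *)
Definition conv (A B C : zmodType) (op : A -> B -> C) (f : int -> A)
    (g : int -> B) : int -> C :=
  fun n => \sum_(i \in [set: int]) op (f i) (g (n - i)).

Lemma fsum_int (V : zmodType) (h : int -> V) (N : int) (B : nat) :
    (forall i, i < N \/ N + B%:Z <= i -> h i = 0) ->
  \sum_(i \in [set: int]) h i = \sum_(j < B) h (N + j%:Z).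
Proof.
move=> h0; rewrite (@fsbigE _ _ _ _ setT [seq N + j%:Z | j <- iota 0 B]) //;
  last first.
- move=> i _ iN; apply: h0; case: (ltP i N) => [|Ni]; [by left|right].
  rewrite leNgt; apply: contra iN => iB; apply/mapP; exists `|i - N|%N; last lia.
  by rewrite mem_iota; lia.
- by rewrite map_inj_uniq ?iota_uniq // => i j /addrI [].
rewrite big_map -[B in iota 0 B]subn0 -/(index_iota 0 B) big_mkord.
by apply: eq_bigl => j; rewrite mem_set.
Qed.

Lemma convE (A B C : zmodType) (op : A -> B -> C) (f : int -> A) (g : int -> B)
    (M N n : int) (D : nat) :
    (forall b, op 0 b = 0) -> (forall a, op a 0 = 0) ->
    (forall i, i < M -> f i = 0) -> (forall i, i < N -> g i = 0) ->
    n - N < M + D%:Z ->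
  conv op f g n = \sum_(j < D) op (f (M + j%:Z)) (g (n - (M + j%:Z))).
Proof.
move=> op0 opr0 f0 g0 nD; rewrite /conv (@fsum_int _ _ M D) // => i [iM|iD].
  by rewrite f0.
by rewrite g0 //; lia.
Qed.

Lemma conv_trunc (A B C : zmodType) (op : A -> B -> C) (f : laurent A)
    (g : laurent B) :
  (forall b, op 0 b = 0) -> (forall a, op a 0 = 0) -> truncated (conv op f g).
Proof.
move=> op0 opr0; have [M f0] := laurent_trunc f; have [N g0] := laurent_trunc g.
exists (M + N) => n nMN; rewrite (@convE _ _ _ op f g M N n 0) ?big_ord0 //; lia.
Qed.

Lemma conv_linearr (A : zmodType) (R : pzRingType) (B C : lmodType R)
    (op : A -> B -> C) (f : laurent A) (c : R) (g h : laurent B) n :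
    (forall b, op 0 b = 0) -> (forall a, linear (op a)) ->
  conv op f (c *: g + h) n = c *: conv op f g n + conv op f h n.
Proof.
move=> op0 opl; have [M f0] := laurent_trunc f; have [N g0] := laurent_trunc g.
have opr0 a : op a 0 = 0.
  by have := opl a (-1) 0 0; rewrite scaler0 addr0 scaleN1r addNr.
have [P h0] := laurent_trunc h; pose Q := Num.min N P.
have gQ i : i < Q -> g i = 0 by rewrite lt_min => /andP[iN _]; exact: g0.
have hQ i : i < Q -> h i = 0 by rewrite lt_min => /andP[_ iP]; exact: h0.
have ghQ i : i < Q -> (c *: g + h) i = 0.
  by move=> iQ; rewrite lcoefD lcoefZ gQ // hQ // scaler0 addr0.
have nD : n - Q < M + (absz (n - Q - M)%R).+1%:Z by lia.
rewrite !(@convE _ _ _ _ _ _ M Q n _ op0 opr0 f0 _ nD) //.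
rewrite scaler_sumr -big_split; apply: eq_bigr => j _ /=.
exact: opl.
Qed.

Section LaurentRing.
Variable R : comNzRingType.
Implicit Types f g h : laurent R.

Definition lmul f g : laurent R :=
  mkLaurent (@conv_trunc _ _ _ *%R f g (@mul0r R) (@mulr0 R)).

Let pt (f : int -> R) (M : int) (T : nat) : {poly R} := \poly_(i < T) f (M + i%:Z).

Let lmulE f g (M N : int) (t T : nat) :
    (forall i, i < M -> f i = 0) -> (forall i, i < N -> g i = 0) -> (t < T)%N ->
  lmul f g (M + N + t%:Z) = (pt f M T * pt g N T)`_t.
Proof.
move=> f0 g0 tT; rewrite /= (@convE _ _ _ _ _ _ M N _ t.+1) ?mul0r ?mulr0 //;
  try by [exact: mul0r|exact: mulr0|lia].
rewrite coefM; apply: eq_bigr => j _; rewrite !coef_poly.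
have -> : (j < T)%N by have := ltn_ord j; lia.
have -> : (t - j < T)%N by have := ltn_ord j; lia.
congr (_ * g _); have := ltn_ord j; lia.
Qed.

Let lmul_lt f g (M N : int) :
    (forall i, i < M -> f i = 0) -> (forall i, i < N -> g i = 0) ->
  forall i, i < M + N -> lmul f g i = 0.
Proof.
move=> f0 g0 i iMN; rewrite /= (@convE _ _ _ _ _ _ M N _ 0) ?big_ord0 //;
  by [exact: mul0r|exact: mulr0|lia].
Qed.

Let coefM_eq (p p' q q' : {poly R}) t :
  (forall i, (i <= t)%N -> p`_i = p'`_i) -> (forall i, (i <= t)%N -> q`_i = q'`_i) ->
  (p * q)`_t = (p' * q')`_t.
Proof.
move=> pp qq; rewrite !coefM; apply: eq_bigr => j _.
by rewrite pp ?qq ?leq_subr // -ltnS.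
Qed.

Lemma lmulC : commutative lmul.
Proof.
move=> f g; apply: laurentP => n.
have [M f0] := laurent_trunc f; have [N g0] := laurent_trunc g.
have [nl|nge] := ltP n (M + N); first by rewrite (lmul_lt f0 g0) // (lmul_lt g0 f0) // addrC.
have -> : n = M + N + (absz (n - (M + N))%R)%:Z by lia.
rewrite (lmulE f0 g0 (ltnSn _)) [M + N]addrC (lmulE g0 f0 (ltnSn _)).
by rewrite mulrC.
Qed.

Lemma lmulA : associative lmul.
Proof.
move=> f g h; apply: laurentP => n.
have [M f0] := laurent_trunc f; have [N g0] := laurent_trunc g.
have [P h0] := laurent_trunc h.
have fg0 := lmul_lt f0 g0; have gh0 := lmul_lt g0 h0.
have [nl|nge] := ltP n (M + N + P).
  by rewrite (lmul_lt fg0 h0) // (lmul_lt f0 gh0) // addrA.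
have En : n = M + N + P + (absz (n - (M + N + P))%R)%:Z by lia.
move: (absz _) En => t ->; rewrite (lmulE fg0 h0 (ltnSn _)) -[M + N + P]addrA.
rewrite (lmulE f0 gh0 (ltnSn _)).
transitivity ((pt f M t.+1 * (pt g N t.+1 * pt h P t.+1))`_t).
  by apply: coefM_eq => // i it; rewrite coef_poly ltnS it (@lmulE _ _ _ _ _ t.+1 g0 h0).
rewrite mulrA; apply: coefM_eq => // i it.
by rewrite coef_poly ltnS it (@lmulE _ _ _ _ _ t.+1 f0 g0).
Qed.

Lemma lmul1 : left_id (lconst (1 : R)) lmul.
Proof.
move=> f; apply: laurentP => n /=; rewrite /conv (@fsum_int _ _ 0 1).
  by rewrite big_ord1 /= mul1r subr0.
by move=> i h; case: eqP => [ei|_]; [lia|rewrite mul0r].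
Qed.

Lemma lmulDl : left_distributive lmul +%R.
Proof.
move=> f g h; apply: laurentP => n; rewrite (lmulC (f + g)) (lmulC f) (lmulC g).
have [M h0] := laurent_trunc h; have [N f0] := laurent_trunc f.
have [P g0] := laurent_trunc g; pose Q := Num.min N P.
have fQ i : i < Q -> f i = 0 by rewrite lt_min => /andP[iN _]; exact: f0.
have gQ i : i < Q -> g i = 0 by rewrite lt_min => /andP[_ iP]; exact: g0.
have fgQ i : i < Q -> (f + g) i = 0.
  by move=> iQ; rewrite lcoefD fQ // gQ // addr0.
have nD : n - Q < M + (absz (n - Q - M)%R).+1%:Z by lia.
rewrite lcoefD /= !(@convE _ _ _ _ _ _ M Q n _ (@mul0r R) (@mulr0 R) h0 _ nD) //.
by rewrite -big_split; apply: eq_bigr => j _ /=; exact: mulrDr.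
Qed.

Lemma lconst1_neq0 : lconst (1 : R) != 0.
Proof.
by apply/eqP => /(congr1 (fun f : laurent R => f 0)); exact/eqP/oner_neq0.
Qed.

HB.instance Definition _ :=
  GRing.Zmodule_isComNzRing.Build (laurent R) lmulA lmulC lmul1 lmulDl lconst1_neq0.

End LaurentRing.

Section LaurentField.
Variable F : fieldType.
Implicit Types f g : laurent F.

Lemma power_series_inv (u : nat -> F) : u 0%N != 0 ->
  exists v : nat -> F, forall t,
    \sum_(j < t.+1) v j * u (t - j)%N = (t == 0%N)%:R.
Proof.
move=> u0.
pose c (s : seq F) :=
  ((size s == 0%N)%:R - \sum_(j < size s) s`_j * u (size s - j)%N) / u 0%N.
pose ps n := iter n (fun s => rcons s (c s)) [::].
have sz n : size (ps n) = n by elim: n => //= n IH; rewrite size_rcons IH.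
have st k n : (k < n)%N -> (ps n)`_k = (ps k.+1)`_k.
  elim: n => // n IH; rewrite ltnS leq_eqVlt => /predU1P[->//|kn].
  by rewrite -IH //= nth_rcons sz kn.
exists (fun n => (ps n.+1)`_n) => t.
rewrite big_ord_recr /= subnn nth_rcons sz ltnn eqxx /c sz divfK //.
rewrite addrC -addrA -[RHS]addr0; congr (_ + _).
apply/eqP; rewrite addrC subr_eq0; apply/eqP; apply: eq_bigr => j _.
by rewrite st.
Qed.

Lemma laurent_inv_ex f : f != 0 -> exists g, g * f = 1.
Proof.
move=> fn0; have [N f0] := laurent_trunc f.
have exk : exists k : nat, f (N + k%:Z) != 0.
  apply: contrapT => nex; move/eqP: fn0; apply; apply: laurentP => n.
  rewrite lcoef0; have [nN|Nn] := ltP n N; first exact: f0.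
  apply/eqP; apply: contrapT => /negP fn; apply: nex; exists (absz (n - N)%R).
  by have -> : N + (absz (n - N)%R)%:Z = n by lia.
case: (ex_minnP exk) => m fm mmin.
pose M := N + m%:Z.
have fM i : i < M -> f i = 0.
  move=> iM; have [/f0//|Ni] := ltP i N; apply/eqP; apply: contraT => fi.
  have := mmin (absz (i - N)%R).
  have -> : N + (absz (i - N)%R)%:Z = i by lia.
  by move=> /(_ fi); lia.
have fM0 : f (M + 0%:Z) != 0 by rewrite addr0.
have [v vP] := @power_series_inv (fun k => f (M + k%:Z)) fM0.
pose g0 (i : int) := if - M <= i then v (absz (i + M)%R) else 0.
have gM i : i < - M -> g0 i = 0 by rewrite /g0; case: ltP.
have gT : truncated g0 by exists (- M).
exists (mkLaurent gT); apply: laurentP => n.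
have [nl|nge] := ltP n 0.
  rewrite /= (@convE _ _ _ _ _ _ (- M) M n 0 (@mul0r F) (@mulr0 F)) //;
    last by lia.
  by rewrite big_ord0; case: eqP => //; lia.
have -> : n = (absz n)%:Z by lia.
move: (absz n) => t /=.
rewrite (@convE _ _ _ _ _ _ (- M) M t t.+1 (@mul0r F) (@mulr0 F)) //;
  last by lia.
transitivity (\sum_(j < t.+1) v j * f (M + (t - j)%N%:Z)).
  apply: eq_bigr => j _; rewrite /g0 ifT; last lia.
  by congr (v _ * f _); have := ltn_ord j; lia.
by rewrite vP; case: t {nge} => [|t].
Qed.

Definition linv f : laurent F :=
  if f == 0 then 0 else xget 0 [set g | g * f = 1].

Lemma lmulVf f : f != 0 -> linv f * f = 1.
Proof.
move=> f0; rewrite /linv (negPf f0).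
by case: xgetP => // h; have [g /h] := laurent_inv_ex f0.
Qed.

Lemma linv0 : linv 0 = 0.
Proof. by rewrite /linv eqxx. Qed.

HB.instance Definition _ :=
  GRing.ComNzRing_isField.Build (laurent F) lmulVf linv0.

End LaurentField.

(* In [laurent (laurent V)], standing for V((x))((x0)), the outer index is the
   exponent of [x0] and the inner one that of [x]. *)
Section Scaling.
Variables (F : fieldType) (W : lmodType F).

Definition lscale (f : laurent F) (v : laurent W) : laurent W :=
  mkLaurent (@conv_trunc _ _ _ *:%R f v (@scale0r F W) (@scaler0 F W)).

Lemma lscale_linear f : linear (lscale f).
Proof.
move=> c v w; apply: laurentP => n; apply: conv_linearr; first exact: scale0r.
by move=> a b x y; rewrite scalerDr !scalerA mulrC.
Qed.

Lemma lscale0r v : lscale 0 v = 0.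
Proof.
apply: laurentP => n; have [N v0] := laurent_trunc v.
rewrite /= (@convE _ _ _ _ _ _ (n - N + 1) N n 0 (@scale0r F W) (@scaler0 F W)) //;
  last lia.
by rewrite big_ord0.
Qed.

Lemma lscaler0 f : lscale f 0 = 0.
Proof.
by have := lscale_linear f (-1) 0 0; rewrite scaler0 addr0 scaleN1r addNr.
Qed.

Lemma lscaleDl v : {morph lscale^~ v : f g / f + g}.
Proof.
move=> f g; apply: laurentP => n; rewrite lcoefD.
have [N v0] := laurent_trunc v.
have [M f0] := laurent_trunc f; have [P g0] := laurent_trunc g.
pose Q := Num.min M P.
have fQ i : i < Q -> f i = 0 by rewrite lt_min => /andP[iM _]; exact: f0.
have gQ i : i < Q -> g i = 0 by rewrite lt_min => /andP[_ iP]; exact: g0.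
have fgQ i : i < Q -> (f + g) i = 0.
  by move=> iQ; rewrite lcoefD fQ // gQ // addr0.
have nD : n - N < Q + (absz (n - N - Q)%R).+1%:Z by lia.
rewrite /= !(@convE _ _ _ _ _ _ Q N n _ (@scale0r F W) (@scaler0 F W) _ v0 nD) //.
by rewrite -big_split; apply: eq_bigr => j _ /=; exact: scalerDl.
Qed.

Lemma lscaleZl c f v : lscale (lconst c * f) v = c *: lscale f v.
Proof.
have cf n : (lconst c * f) n = c * f n.
  rewrite /= /conv (@fsum_int _ _ 0 1) ?big_ord1 /= ?subr0 // => i h.
  by case: eqP => [ei|_]; [lia|rewrite mul0r].
move: (lconst c * f) cf => g cf.
apply: laurentP => n; rewrite lcoefZ.
have [N v0] := laurent_trunc v; have [M f0] := laurent_trunc f.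
have g0 i : i < M -> g i = 0 by move=> iM; rewrite cf f0 ?mulr0.
have nD : n - N < M + (absz (n - N - M)%R).+1%:Z by lia.
rewrite /lscale /= !(@convE _ _ _ _ _ _ M N n _ (@scale0r F W) (@scaler0 F W) _ v0 nD) //.
by rewrite scaler_sumr; apply: eq_bigr => j _ /=; rewrite cf scalerA.
Qed.

Definition lscale2 (f : laurent (laurent F)) (v : laurent (laurent W)) :
    laurent (laurent W) :=
  mkLaurent (@conv_trunc _ _ _ lscale f v lscale0r lscaler0).

Lemma lscale2_linear f : linear (lscale2 f).
Proof.
move=> c v w; apply: laurentP => n; apply: conv_linearr; first exact: lscale0r.
exact: lscale_linear.
Qed.

End Scaling.

(* E(W) = Hom(W, W((x))); [a w n] is the coefficient of [x^n] in [a(x)w]. *)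
Section FieldSpace.
Variables (F : fieldType) (W : lmodType F).

Definition linearb : pred (W -> laurent W) := fun a => `[< linear a >].

Record calE := CalE {
  calE_fun :> W -> laurent W;
  _ : linearb calE_fun }.

HB.instance Definition _ := [isSub for calE_fun].
HB.instance Definition _ := [Choice of calE by <:].

Lemma linearb_submod : submod_closed linearb.
Proof.
split; first by apply/asboolP => c u v; rewrite /= scaler0 addr0.
move=> c a b /asboolP la /asboolP lb; apply/asboolP => d u v.
change (c *: a (d *: u + v) + b (d *: u + v) =
  d *: (c *: a u + b u) + (c *: a v + b v)).
by rewrite la lb !scalerDr !scalerA [c * d]mulrC addrACA.
Qed.

HB.instance Definition _ :=
  GRing.SubChoice_isSubLmodule.Build F (W -> laurent W) linearb calE
    (GRing.submod_closed_semi linearb_submod).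

Lemma calE_linear (a : calE) : linear a.
Proof. by case: a => a ha; exact: asboolW. Qed.

HB.instance Definition _ (a : calE) :=
  GRing.isLinear.Build F W (laurent W) *:%R a (@calE_linear a).

Lemma calEP (a b : calE) : (forall w n, a w n = b w n) -> a = b.
Proof. by move=> ab; apply: val_inj; apply: funext => w; exact: laurentP. Qed.

Lemma lconst_linear : linear (@lconst W).
Proof.
move=> c u v; apply: laurentP => n; rewrite lcoefD lcoefZ /=.
by case: eqP; rewrite ?scaler0 ?addr0.
Qed.

Definition idE : calE := CalE (asboolT lconst_linear).

Lemma lact_linear (f : laurent F) (a : calE) : linear (fun w => lscale f (a w)).
Proof. by move=> c u v; rewrite linearP lscale_linear. Qed.

Definition lact (f : laurent F) (a : calE) : calE := CalE (asboolT (lact_linear f a)).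

End FieldSpace.

(* The binomial coefficient (m choose k), for an integer [m]. *)
Definition gbinom (F : fieldType) (m : int) (k : nat) : F :=
  (\prod_(i < k) (m - i%:Z)%:~R) / k`!%:R.

(* A polynomial p(x1,x2) is an element of {poly {poly F}} whose outer variable
   'X is [x1] and whose inner variable 'Y is [x2]; thus p(x1 + x2, x2) is
   [p \Po ('X + 'Y)]. *)
Section TwoVariables.
Variables (F : fieldType) (W : lmodType F).
Implicit Types (p : {poly {poly F}}) (A : int -> int -> W) (a b : calE W).

(* [A m n] is the coefficient of [x1^m x2^n]. *)
Definition pmul p A : int -> int -> W := fun m n =>
  \sum_(i < size p) \sum_(j < size p`_i) p`_i`_j *: A (m - i%:Z) (n - j%:Z).

Definition truncated2 A : Prop :=
  exists N : int, forall m n, m < N \/ n < N -> A m n = 0.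

(* The coefficient of [x0^i x2^j] in [A(x0 + x2, x2)], expanded in nonnegative
   powers of [x2]. *)
Definition subst_x0x2 A : int -> int -> W := fun i j =>
  \sum_(k \in [set: nat]) gbinom F (i + k%:Z) k *: A (i + k%:Z) (j - k%:Z).

(* The coefficient of [x0^k x^i] in [A(x + x0, x)], expanded in nonnegative
   powers of [x0]. *)
Definition subst_xx0_coef A : int -> int -> W := fun k i =>
  if k is Posz k' then
    \sum_(m \in [set: int]) gbinom F m k' *: A m (i + k - m)
  else 0.

Lemma subst_xx0_coefE A (N i : int) (k D : nat) :
    (forall m n, m < N \/ n < N -> A m n = 0) -> i + k%:Z - N < N + D%:Z ->
  subst_xx0_coef A k i =
  \sum_(j < D) gbinom F (N + j%:Z) k *: A (N + j%:Z) (i + k%:Z - (N + j%:Z)).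
Proof.
move=> A0 iD; rewrite /= (@fsum_int _ _ N D) // => m hm.
by rewrite A0 ?scaler0 //; case: hm => hm; [left|right; lia].
Qed.

Lemma subst_xx0_trunc_in A k : truncated2 A -> truncated (subst_xx0_coef A k).
Proof.
case=> N A0; case: k => k; last by exists 0.
exists (N + N - k%:Z) => i hi.
by rewrite (@subst_xx0_coefE A N i k 0) ?big_ord0 //; lia.
Qed.

Lemma subst_xx0_trunc A (hA : truncated2 A) :
  truncated (fun k => mkLaurent (@subst_xx0_trunc_in A k hA)).
Proof. by exists 0 => -[//|k] _; apply: laurentP. Qed.

Definition subst_xx0 A (hA : truncated2 A) : laurent (laurent W) :=
  mkLaurent (subst_xx0_trunc hA).

Lemma subst_xx0_linear c A B C (hA : truncated2 A) (hB : truncated2 B)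
    (hC : truncated2 C) :
    (forall m n, C m n = c *: A m n + B m n) ->
  subst_xx0 hC = c *: subst_xx0 hA + subst_xx0 hB.
Proof.
move=> CE; apply: laurentP => k; apply: laurentP => i.
change (subst_xx0_coef C k i = c *: subst_xx0_coef A k i + subst_xx0_coef B k i).
case: k => k; last by rewrite /= scaler0 addr0.
have [M A0] := hA; have [N B0] := hB; pose Q := Num.min M N.
have AQ m n : m < Q \/ n < Q -> A m n = 0 by move=> h; apply: A0; lia.
have BQ m n : m < Q \/ n < Q -> B m n = 0 by move=> h; apply: B0; lia.
have CQ m n : m < Q \/ n < Q -> C m n = 0.
  by move=> h; rewrite CE AQ // BQ // scaler0 addr0.
have iD : i + k%:Z - Q < Q + (absz (i + k%:Z - Q - Q)%R).+1%:Z by lia.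
rewrite !(subst_xx0_coefE _ iD) // scaler_sumr -big_split.
by apply: eq_bigr => j _; rewrite CE scalerDr !scalerA mulrC.
Qed.

(* a(x1)b(x2)w *)
Definition pair_prod a b (w : W) : int -> int -> W := fun m n => a (b w n) m.

Definition pair_cond p a b : Prop :=
  forall w, truncated2 (pmul p (pair_prod a b w)).

Lemma pmul_pair_linear p a b c u v m n :
  pmul p (pair_prod a b (c *: u + v)) m n =
  c *: pmul p (pair_prod a b u) m n + pmul p (pair_prod a b v) m n.
Proof.
rewrite /pmul scaler_sumr -big_split; apply: eq_bigr => i _ /=.
rewrite scaler_sumr -big_split; apply: eq_bigr => j _ /=.
have -> : pair_prod a b (c *: u + v) (m - i%:Z) (n - j%:Z) =
    c *: pair_prod a b u (m - i%:Z) (n - j%:Z) +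
    pair_prod a b v (m - i%:Z) (n - j%:Z).
  by rewrite /pair_prod linearP lcoefD lcoefZ linearP.
by rewrite scalerDr !scalerA mulrC.
Qed.

Definition lpoly_coef (R : nzRingType) (p : {poly R}) (n : int) : R :=
  if n is Posz k then p`_k else 0.

Lemma lpoly_trunc (R : nzRingType) (p : {poly R}) : truncated (lpoly_coef p).
Proof. by exists 0 => -[]. Qed.

Definition lpoly (R : nzRingType) (p : {poly R}) : laurent R :=
  mkLaurent (lpoly_trunc p).

(* The image in F((x))((x0)) of the polynomial with outer variable [x0] and inner
   variable [x]. As [iota_{x,x0}] is an algebra embedding, it maps [1/p] to the
   inverse of [iota_poly p] in the field F((x))((x0)). *)
Definition iota_poly p : laurent (laurent F) :=
  lpoly (map_poly (@lpoly F) p).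

Definition YE_series p a b (hp : pair_cond p a b) (w : W) : laurent (laurent W) :=
  lscale2 (iota_poly (p \Po ('X + 'Y)))^-1 (subst_xx0 (hp w)).

Lemma YE_series_linear p a b (hp : pair_cond p a b) : linear (YE_series hp).
Proof.
move=> c u v; rewrite /YE_series -lscale2_linear; congr lscale2.
by apply: subst_xx0_linear => m n; exact: pmul_pair_linear.
Qed.

Lemma YE_coef_linear p a b (hp : pair_cond p a b) (n : int) :
  linear (fun w => YE_series hp w n).
Proof. by move=> c u v; rewrite YE_series_linear. Qed.

(* The polynomial chosen for the pair [(a, b)]; it is 0 if the pair is not quasi
   compatible. *)
Definition YE_poly a b : {poly {poly F}} :=
  xget 0 [set p | p != 0 /\ pair_cond p a b].

Lemma YE_polyP a b : pair_cond (YE_poly a b) a b.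
Proof.
rewrite /YE_poly; case: xgetP => [p _ []//|_] w.
by exists 0 => m n _; rewrite /pmul size_poly0 big_ord0.
Qed.

(* The coefficient of [x0^n] in [Y_E(a(x),x0)b(x)]. *)
Definition YE a b (n : int) : calE W :=
  CalE (asboolT (YE_coef_linear (@YE_polyP a b) n)).

(* a(x)_n b(x) *)
Definition nprod a b (n : int) : calE W := YE a b (- n - 1).

End TwoVariables.

Section Compatible.
Variables (F : fieldType) (W : lmodType F).
Implicit Types (p : {poly {poly F}}) (U K : set (calE W)).

(* The coefficient of x_1^{n_1}...x_r^{n_r} in a_1(x_1)...a_r(x_r)w. *)
Definition mprod r (a : 'I_r -> calE W) (w : W) : ('I_r -> int) -> W :=
  fun n => foldr (fun i u => a i u (n i)) w (enum 'I_r).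

(* Multiplication by p(x_i,x_j). *)
Definition mpmul r p (i j : 'I_r) (A : ('I_r -> int) -> W) : ('I_r -> int) -> W :=
  fun n => \sum_(s < size p) \sum_(t < size p`_s) p`_s`_t *:
    A (fun k => n k - (s * (k == i))%N%:Z - (t * (k == j))%N%:Z).

Definition mtruncated r (A : ('I_r -> int) -> W) : Prop :=
  exists N : int, forall n, (exists i, n i < N) -> A n = 0.

Definition seq_cond r p (a : 'I_r -> calE W) : Prop := forall w,
  mtruncated ((\big[(fun f g => f \o g)/id]_(ij : 'I_r * 'I_r | (ij.1 < ij.2)%N)
                 mpmul p ij.1 ij.2) (mprod a w)).

Definition quasi_compatible_seq r (a : 'I_r -> calE W) : Prop :=
  exists2 p, p != 0 & seq_cond p a.

Definition compatible_seq r (a : 'I_r -> calE W) : Prop :=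
  exists k : nat, seq_cond (('X - 'Y) ^+ k) a.

Definition quasi_compatible U : Prop :=
  forall r (a : 'I_r -> calE W), (forall i, U (a i)) -> quasi_compatible_seq a.

Definition compatible U : Prop :=
  forall r (a : 'I_r -> calE W), (forall i, U (a i)) -> compatible_seq a.

Definition YE_closed K : Prop :=
  forall a b n, K a -> K b -> K (nprod a b n).

Definition subspace K : Prop :=
  K 0 /\ forall (c : F) a b, K a -> K b -> K (c *: a + b).

Definition Fx_submodule K : Prop :=
  [/\ K 0, forall a b, K a -> K b -> K (a + b) &
      forall (f : laurent F) a, K a -> K (lact f a)].

(* [K] is the smallest Y_E-closed subspace with property [C] that contains [U]
   and the identity operator. *)
Definition is_smallest_closed (C : set (calE W) -> Prop) U K : Prop :=
  let good L := [/\ subspace L, C L, YE_closed L, U `<=` L & L (idE W)] in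
  good K /\ forall L, good L -> K `<=` L.

Definition Fx_span K : set (calE W) :=
  [set a | exists s : seq (laurent F * calE W),
     (forall fb, fb \in s -> K fb.2) /\ a = \sum_(fb <- s) lact fb.1 fb.2].

Definition Fx_spanb K : pred (calE W) := fun a => `[< Fx_span K a >].

(* F((x))K as a vector space in its own right. *)
Record Fx_spanType K := FxSpan {
  Fx_span_val :> calE W;
  _ : Fx_spanb K Fx_span_val }.

HB.instance Definition _ K := [isSub for @Fx_span_val K].
HB.instance Definition _ K := [Choice of Fx_spanType K by <:].

Lemma Fx_spanb_submod K : submod_closed (Fx_spanb K).
Proof.
split; first by apply/asboolP; exists [::]; rewrite big_nil; split.
move=> c a b /asboolP[s [Ks ->]] /asboolP[t [Kt ->]]; apply/asboolP.
exists ([seq (lconst c * fb.1, fb.2) | fb <- s] ++ t); split.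
  by move=> fb; rewrite mem_cat => /orP[/mapP[gd /Ks Kgd ->]//|/Kt].
rewrite big_cat big_map scaler_sumr; congr (_ + _); apply: eq_bigr => fb _ /=.
apply: calEP => w n.
exact: (congr1 (fun u : laurent W => u n) (esym (lscaleZl c fb.1 (fb.2 w)))).
Qed.

HB.instance Definition _ K :=
  GRing.SubChoice_isSubLmodule.Build F (calE W) (Fx_spanb K) (Fx_spanType K)
    (GRing.submod_closed_semi (@Fx_spanb_submod K)).

End Compatible.

Section NonlocalVertexAlgebra.
Variable F : fieldType.

(* p(x0+x2,x2) Y_W(u,x0+x2) Y_W(v,x2) w = p(x0+x2,x2) Y_W(Y(u,x0)v,x2) w *)
Definition weak_assoc (V W : lmodType F) (p : {poly {poly F}})
    (Y : V -> calE V) (YW : V -> calE W) (u v : V) (w : W) : Prop :=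
  forall i j,
    pmul (p \Po ('X + 'Y)) (subst_x0x2 (pair_prod (YW u) (YW v) w)) i j =
    pmul (p \Po ('X + 'Y)) (fun m n => YW (Y u v m) w n) i j.

Definition is_nonlocal_va (V : lmodType F) (Y : {linear V -> calE V}) (one : V) :
    Prop :=
  [/\ Y one = idE V,
      forall v n, n < 0 -> Y v one n = 0,
      forall v, Y v one 0 = v &
      forall u v w, exists l : nat, weak_assoc 'X^l Y Y u v w].

Definition is_module (V : lmodType F) (Y : {linear V -> calE V}) (one : V)
    (W : lmodType F) (YW : {linear V -> calE W}) : Prop :=
  YW one = idE W /\ forall u v w, exists l : nat, weak_assoc 'X^l Y YW u v w.

Definition is_quasi_module (V : lmodType F) (Y : {linear V -> calE V}) (one : V)
    (W : lmodType F) (YW : {linear V -> calE W}) : Prop :=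
  YW one = idE W /\
  forall u v w, exists2 p, p != 0 & weak_assoc p Y YW u v w.

(* [act] is an F((t))-module structure on [V] extending that of F-vector space. *)
Definition is_Ft_module (V : lmodType F) (act : laurent F -> V -> V) : Prop :=
  [/\ forall c v, act (lconst c) v = c *: v,
      forall f g v, act (f * g) v = act f (act g v),
      forall f g v, act (f + g) v = act f v + act g v &
      forall f u v, act f (u + v) = act f u + act f v].

Lemma lderiv_trunc (f : laurent F) :
  truncated (fun n : int => (n + 1)%:~R * f (n + 1)).
Proof.
have [N f0] := laurent_trunc f; exists (N - 1) => n nN.
by rewrite f0 ?mulr0 //; lia.
Qed.

Definition lderiv (f : laurent F) : laurent F := mkLaurent (lderiv_trunc f).

(* f(t + x) = e^{x d/dt} f(t), as a series in [x] with coefficients in F((t)). *)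
Definition taylor (f : laurent F) : int -> laurent F := fun n =>
  if n is Posz k then lconst k`!%:R^-1 * iter k lderiv f else 0.

Definition is_nonlocal_Ft_va (V : lmodType F) (act : laurent F -> V -> V)
    (Y : {linear V -> calE V}) (one : V) : Prop :=
  [/\ is_nonlocal_va Y one, is_Ft_module act &
      forall f g u v n,
        Y (act f u) (act g v) n =
        conv act (taylor f) (fun m => act g (Y u v m)) n].

Definition type_zero (V : lmodType F) (act : laurent F -> V -> V)
    (W : lmodType F) (YW : {linear V -> calE W}) : Prop :=
  forall f v w, YW (act f v) w = lscale f (YW v w).

End NonlocalVertexAlgebra.

(* Main.v *)
(* Call B in W((x))((x0)) the value of a series A(z,x) at z = x + x0 if
   p(x + x0,x) B is the substitution z = x + x0 into p A for some nonzero
   polynomial p such that p A is truncated in both variables. Since F((x))((x0))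
   is a field, B is unique; it depends linearly on A, and multiplying A by f(z) g(x)
   multiplies B by f(x + x0) g(x). By definition Y_E(a,x0)b is the value of a(z)b(x),
   so Y_E is bilinear and Y_E(fa,x0)(gb) = f(x + x0) g(x) Y_E(a,x0)b. Hence the
   F((x))-span is Y_E-closed.

   For weak associativity take p such that
   T = p(z,y) p(z,x) p(y,x) a(z)b(y)c(x)w is truncated in z, y, x. With q the
   polynomial p(z,y) p(z,x) p(y,x) at z = x + x2 + x0, y = x + x2, both
   Y_E(a,x0+x2)Y_E(b,x2)c and Y_E(Y_E(a,x0)b,x2)c, multiplied by q, give T at the
   same point. Now p(x + u,x) = u^l r(u) with r(0) a nonzero polynomial in x, so
   q = x0^l (x0+x2)^l x2^l s where the constant term of s as a power series in
   x0, x2 is invertible in F((x)). Thus s, x0^l and x2^l cancel, although the two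
   series lie in different spaces, and only (x0+x2)^l remains. *)
Require Import Defs.
From HB Require Import structures.
From mathcomp Require Import all_boot all_order all_algebra.
From mathcomp Require Import polyXY zify ring.
From mathcomp Require Import boolp classical_sets functions fsbigop.

Set Implicit Arguments.
Unset Strict Implicit.
Unset Printing Implicit Defensive.
Import Order.TTheory GRing.Theory Num.Theory.
Local Open Scope classical_set_scope.
Local Open Scope ring_scope.

(** * Sums over the integers and binomial coefficients *)

(** Doubly infinite series cannot be multiplied, so polynomials act on them as operators, evaluated
    at commuting shifts of the exponents, and a substitution is a relation intertwining two families
    of shifts. The two sides of weak associativity lie in W((x))((x0))((x2)) and W((x))((x2))((x0)),
    where the inverse of x0 + x2 expands differently; this is why its power remains. The other
    factors cancel because T, being truncated, yields a series without negative powers of x0 and x2.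
    As s has an invertible lowest term, both sides, once multiplied by the three powers, have no
    negative powers either, and power series in x0, x2 belong to both spaces. Compatibility of the
    span is a separate matter: a product of operators is linear in each factor and f(x_i) commutes
    with polynomials, so the entries of a sequence are replaced one at a time. The compatible and
    quasi compatible cases are treated together through a set [C] of admissible polynomials. *)

Notation "\isum_ i F" := (\sum_(i \in [set: int]) F)
  (at level 41, i at level 0, F at level 41, format "\isum_ i  F") : ring_scope.

Section IntegerSums.
Implicit Types (N M : int) (s t : seq int).

(** A sum over an infinite support is 0 by convention, so additivity fails without this condition,
    whereas reindexing needs nothing. *)
Definition fin_supp (V : zmodType) (h : int -> V) : Prop :=
  exists s, forall i, i \notin s -> h i = 0.

Lemma fin_supp_bound (V : zmodType) (h : int -> V) N M :
  (forall i, i < N -> h i = 0) -> (forall i, M <= i -> h i = 0) -> fin_supp h.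
Proof.
move=> hN hM; exists [seq N + j%:Z | j <- iota 0 `|M - N|%N] => i iNM.
have [/hN//|Ni] := ltP i N; have [/hM//|iM] := leP M i.
case/mapP: iNM; exists `|i - N|%N; last lia.
by rewrite mem_iota; lia.
Qed.

Lemma isumE (V : zmodType) (h : int -> V) s :
  uniq s -> (forall i, i \notin s -> h i = 0) -> \isum_i h i = \sum_(i <- s) h i.
Proof.
move=> us h0; rewrite (@fsbigE _ _ _ _ setT s) //; last by move=> i _ /h0.
by apply: eq_bigl => i; rewrite mem_set.
Qed.

Lemma isum1 (V : zmodType) (h : int -> V) c :
  (forall i, i != c -> h i = 0) -> \isum_i h i = h c.
Proof.
move=> h0; rewrite (@isumE _ _ [:: c]) ?big_seq1 // => i.
by rewrite inE => /h0.
Qed.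

Lemma isum0 (V : zmodType) (h : int -> V) :
  (forall i, h i = 0) -> \isum_i h i = 0.
Proof. by move=> h0; rewrite (@isum1 _ _ 0). Qed.

Lemma eq_isum (V : zmodType) (h g : int -> V) :
  (forall i, h i = g i) -> \isum_i h i = \isum_i g i.
Proof. by move=> hg; apply: eq_fsbigr => i _. Qed.

Lemma isum_shift (V : zmodType) (h : int -> V) c :
  \isum_i h i = \isum_i h (i + c).
Proof.
apply: (reindex_fsbigT (fun i => i + c)).
by exists (fun i => i - c) => i; [exact: addrK | exact: subrK].
Qed.

Lemma raddf_isum (V V' : zmodType) (L : V -> V') (h : int -> V) :
    L 0 = 0 -> {morph L : x y / x + y} -> fin_supp h ->
  L (\isum_i h i) = \isum_i L (h i).
Proof.
move=> L0 LD [s hs].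
rewrite (isumE (undup_uniq s)) => [|i]; last by rewrite mem_undup; exact: hs.
rewrite (isumE (undup_uniq s)); first exact: big_morph.
by move=> i; rewrite mem_undup => /hs ->.
Qed.

Lemma isum_linear (F : pzRingType) (V V' : lmodType F) (L : {linear V -> V'})
    (h : int -> V) :
  fin_supp h -> L (\isum_i h i) = \isum_i L (h i).
Proof. by apply: raddf_isum; [exact: linear0 | exact: linearD]. Qed.

Lemma isumZ (F : pzRingType) (V : lmodType F) (c : F) (h : int -> V) :
  fin_supp h -> c *: (\isum_i h i) = \isum_i (c *: h i).
Proof.
by apply: (@raddf_isum _ _ ( *:%R c)); [exact: scaler0 | exact: scalerDr].
Qed.

Lemma isumP (F : pzRingType) (V : lmodType F) (c : F) (h g : int -> V) :
    fin_supp h -> fin_supp g ->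
  \isum_i (c *: h i + g i) = c *: (\isum_i h i) + \isum_i g i.
Proof.
move=> [s hs] [t gt]; pose r := undup (s ++ t).
have ur : uniq r by exact: undup_uniq.
have hr i : i \notin r -> h i = 0.
  by rewrite mem_undup mem_cat negb_or => /andP[/hs].
have gr i : i \notin r -> g i = 0.
  by rewrite mem_undup mem_cat negb_or => /andP[_ /gt].
rewrite !(isumE ur) // => [|i ir]; first by rewrite scaler_sumr big_split.
by rewrite hr ?gr // scaler0 addr0.
Qed.

Lemma isumD (V : zmodType) (h g : int -> V) :
    fin_supp h -> fin_supp g ->
  \isum_i (h i + g i) = \isum_i h i + \isum_i g i.
Proof.
move=> [s hs] [t gt]; pose r := undup (s ++ t).
have ur : uniq r by exact: undup_uniq.
have hr i : i \notin r -> h i = 0.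
  by rewrite mem_undup mem_cat negb_or => /andP[/hs].
have gr i : i \notin r -> g i = 0.
  by rewrite mem_undup mem_cat negb_or => /andP[_ /gt].
rewrite !(isumE ur) // => [|i ir]; first by rewrite big_split.
by rewrite hr ?gr // addr0.
Qed.

Lemma exchange_isum (V : zmodType) (h : int -> int -> V) s t :
    (forall i j, i \notin s \/ j \notin t -> h i j = 0) ->
  \isum_i \isum_j h i j = \isum_j \isum_i h i j.
Proof.
move=> h0; have us := undup_uniq s; have ut := undup_uniq t.
have h1 i j : i \notin undup s -> h i j = 0.
  by rewrite mem_undup => ?; apply: h0; left.
have h2 i j : j \notin undup t -> h i j = 0.
  by rewrite mem_undup => ?; apply: h0; right.
rewrite (isumE us) => [|i iz]; last by apply: isum0 => j; exact: h1.
rewrite [RHS](isumE ut) => [|j jz]; last by apply: isum0 => i; exact: h2.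
under eq_bigr => i _ do rewrite (isumE ut (h2 i)).
under [RHS]eq_bigr => j _ do rewrite (isumE us (fun i => h1 i j)).
exact: exchange_big.
Qed.

Lemma exchange_isum_bound (V : zmodType) (h : int -> int -> V) N M P Q :
    (forall i j, i < N -> h i j = 0) -> (forall i j, M <= i -> h i j = 0) ->
    (forall i j, j < P -> h i j = 0) -> (forall i j, Q <= j -> h i j = 0) ->
  \isum_i \isum_j h i j = \isum_j \isum_i h i j.
Proof.
move=> h1 h2 h3 h4.
apply: (@exchange_isum _ _ [seq N + j%:Z | j <- iota 0 `|M - N|%N]
                           [seq P + j%:Z | j <- iota 0 `|Q - P|%N]) => i j [iz|jz].
- have [/h1//|Ni] := ltP i N; have [/h2//|iM] := leP M i.
  case/mapP: iz; exists `|i - N|%N; last lia.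
  by rewrite mem_iota; lia.
- have [/h3//|Ni] := ltP j P; have [/h4//|iM] := leP Q j.
  case/mapP: jz; exists `|j - P|%N; last lia.
  by rewrite mem_iota; lia.
Qed.

End IntegerSums.

Section Binomials.
Variables (F : fieldType).
Hypothesis charF : [pchar F] =i pred0.
Implicit Types (m n : int).

(** The falling factorial m (m - 1) ... (m - k + 1). *)
Definition ff (m : int) (k : nat) : F := \prod_(i < k) (m - i%:Z)%:~R.

(* The binomial coefficient extended by 0 to negative lower arguments, so that
   every sum can run over all the integers. *)
Definition gb m (k : int) : F := if k is Posz k' then gbinom F m k' else 0.

Lemma gb_neg m (k : int) : k < 0 -> gb m k = 0. Proof. by case: k. Qed.

Lemma fact_neq0 k : k`!%:R != 0 :> F.
Proof. by rewrite (pcharf0P _).1 // -lt0n fact_gt0. Qed.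

Lemma ffS m k : ff m k.+1 = m%:~R * ff (m - 1) k.
Proof.
rewrite /ff big_ord_recl subr0; congr (_ * _); apply: eq_bigr => i _.
by congr (_%:~R); rewrite /= /bump; lia.
Qed.

Lemma ffSr m k : ff m k.+1 = ff m k * (m - k%:Z)%:~R.
Proof. by rewrite /ff big_ord_recr. Qed.

Lemma ffD m k l : ff m (k + l) = ff m k * ff (m - k%:Z) l.
Proof.
elim: k m => [|k IH] m; first by rewrite /ff big_ord0 mul1r subr0.
by rewrite addSn !ffS IH mulrA; congr (_ * ff _ _); lia.
Qed.

Lemma ff_fact (k l : nat) : ff (k + l)%N k * l`!%:R = (k + l)`!%:R.
Proof.
elim: k => [|k IH]; first by rewrite /ff big_ord0 mul1r.
rewrite addSn ffS -mulrA; have -> : (k + l).+1%:Z - 1 = (k + l)%N by lia.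
by rewrite IH factS natrM.
Qed.

Lemma ff_small (n k : nat) : (n < k)%N -> ff n k = 0.
Proof.
by move=> nk; rewrite /ff (bigD1 (Ordinal nk)) //= subrr mul0r.
Qed.

Lemma gb_ff m (k : nat) : gb m k = ff m k / k`!%:R.
Proof. by []. Qed.

Lemma gb0 m : gb m 0 = 1.
Proof. by rewrite (gb_ff m 0) /ff big_ord0 divr1. Qed.

Lemma gb_small (n : nat) (k : int) : n%:Z < k -> gb n k = 0.
Proof. by case: k => // k nk; rewrite gb_ff ff_small ?mul0r. Qed.

(** Pascal's rule for an integral upper argument: for k > 0, up to the factor [ff m (k - 1)] over
    k!, it reads m + 1 = (m - k + 1) + k. *)
Lemma gbS m (k : int) : gb (m + 1) k = gb m k + gb m (k - 1).
Proof.
case: k => [[|k]|k]; last by rewrite !gb_neg ?addr0 //; lia.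
  by rewrite !gb0 gb_neg ?addr0.
have -> : k.+1%:Z - 1 = k by lia.
rewrite !gb_ff ffS addrK ffSr factS natrM.
have k0 := fact_neq0 k.
have k1 : k.+1%:R != 0 :> F by rewrite (pcharf0P _).1.
rewrite !intrD !intrN; field.
by rewrite k0 nat1r k1.
Qed.

(** By Pascal's rule a unit passes from one upper argument to the other without changing the sum
    ([step]). This brings [m] to 0 from either side, where only the term j = 0 is left ([base]). *)
Lemma gb_vandermonde m n (k : int) :
  gb (m + n) k = \isum_j (gb m j * gb n (k - j)).
Proof.
have fin m' n' k' : fin_supp (fun j => gb m' j * gb n' (k' - j)).
  apply: (@fin_supp_bound _ _ 0 (k' + 1)) => j jk; first by rewrite gb_neg ?mul0r.
  by rewrite [gb n' _]gb_neg ?mulr0 //; lia.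
have step m' n' k' : \isum_j (gb (m' + 1) j * gb n' (k' - j)) =
    \isum_j (gb m' j * gb (n' + 1) (k' - j)).
  transitivity (\isum_j (gb m' j * gb n' (k' - j)) +
                \isum_j (gb m' j * gb n' (k' - 1 - j))).
    rewrite (isum_shift (fun j => gb m' j * gb n' (k' - 1 - j)) (-1)) -isumD //.
      by apply: eq_isum => j; rewrite gbS mulrDl; congr (_ + _ * gb _ _); lia.
    apply: (@fin_supp_bound _ _ 1 (k' + 1)) => j jk.
      by rewrite gb_neg ?mul0r //; lia.
    by rewrite [gb n' _]gb_neg ?mulr0 //; lia.
  rewrite -isumD //; apply: eq_isum => j; rewrite gbS mulrDr.
  by congr (_ + _ * gb _ _); lia.
have base n' k' : \isum_j (gb 0 j * gb n' (k' - j)) = gb n' k'.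
  rewrite (@isum1 _ _ 0) ?gb0 ?mul1r ?subr0 // => j j0.
  case: j j0 => [j|j] j0; last by rewrite mul0r.
  by rewrite (@gb_small 0) ?mul0r //; lia.
elim/int_rec: m n => [|m IH|m IH] n.
- by rewrite add0r base.
- by rewrite -[in RHS]addn1 PoszD step -IH; congr gb; lia.
- have := step (- m.+1%:Z) (n - 1) k; rewrite subrK => <-.
  have -> : - m.+1%:Z + 1 = - m%:Z by lia.
  by rewrite -IH; congr gb; lia.
Qed.

(** For 0 <= j <= k both sides are [ff F m k] over j! (k - j)!. Otherwise both vanish; for negative
    [k] this is due to [gb m k], as [gb k j] need not be 0. The identity governs the composition of
    two binomial expansions. *)
Lemma gb_trinomial m (k j : int) :
  gb m k * gb k j = gb m (k - j) * gb (m - (k - j)) j.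
Proof.
case: j => [j|j]; last by rewrite !mulr0.
have [kj|jk] := ltP k j%:Z.
  rewrite (@gb_neg m (k - j%:Z)) ?mul0r; last lia.
  case: k kj => [k kj|k _]; last by rewrite mul0r.
  by rewrite (@gb_small k j) ?mulr0.
have [l ->] : exists l : nat, k = (j + l)%N by exists `|k - j|%N; lia.
have -> : (j + l)%N%:Z - j%:Z = l by lia.
rewrite !gb_ff addnC ffD addnC -ff_fact invfM.
have j0 := fact_neq0 j; have l0 := fact_neq0 l.
have jl0 : ff (j + l)%N j != 0.
  by apply: contraNneq (fact_neq0 (j + l)) => j0'; rewrite -ff_fact j0' mul0r.
by field; rewrite j0 l0 jl0.
Qed.

Lemma gb_sym (n : nat) (k : int) : gb n (n%:Z - k) = gb n k.
Proof.
have [kn|nk] := ltP n%:Z k; first by rewrite (gb_small kn) gb_neg //; lia.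
case: k nk => [k nk|k _]; last by rewrite gb_small // ?gb_neg //; lia.
have [l ->] : exists l : nat, n = (k + l)%N by exists (n - k)%N; lia.
have -> : (k + l)%N%:Z - k%:Z = l by lia.
rewrite !gb_ff; have k0 := fact_neq0 k; have l0 := fact_neq0 l.
apply: (mulfI k0); rewrite [RHS]mulrC divfK //.
apply: (mulIf l0); rewrite -mulrA divfK // ff_fact mulrC.
by rewrite [in LHS]addnC ff_fact addnC.
Qed.

End Binomials.

(** * Polynomials in two commuting operators *)

Lemma poly2_ind (R : comNzRingType) (P : {poly {poly R}} -> Prop) :
    (forall c, P c%:P%:P) -> (forall p q, P p -> P q -> P (p + q)) ->
    (forall p, P p -> P ('X * p)) -> (forall p, P p -> P ('Y * p)) ->
  forall p, P p.
Proof.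
move=> PC PD PX PY; elim/poly_ind => [|p q Pp]; first by rewrite -!polyC0; exact: PC.
rewrite mulrC; apply: (PD) (PX _ Pp) _; elim/poly_ind: q => [|q c Pq].
  exact: PC.
by rewrite rmorphD rmorphM /= mulrC; apply: (PD) (PY _ Pq) _; exact: PC.
Qed.

Section PolynomialAction.
Variable F : fieldType.
Implicit Types (p q : {poly {poly F}}).

(* The operator p(O1,O2), where [O1] stands for the outer variable. *)
Definition pact (V : lmodType F) (O1 O2 : V -> V) p (v : V) : V :=
  \sum_(i < size p) \sum_(j < size p`_i) p`_i`_j *: iter i O1 (iter j O2 v).

Definition linear_rel (V V' : lmodType F) (Rel : V -> V' -> Prop) : Prop :=
  Rel 0 0 /\ forall c u v u' v', Rel u u' -> Rel v v' ->
    Rel (c *: u + v) (c *: u' + v').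

(* Taking [Rel] to be the graph of an operator S restricted to a subspace, this
   says that S p(O1,O2) = p(O1',O2') S as soon as it holds for p = x1, x2. *)
Lemma pact_rel (V V' : lmodType F) (Rel : V -> V' -> Prop) O1 O2 O1' O2' p v v' :
    linear_rel Rel -> (forall u u', Rel u u' -> Rel (O1 u) (O1' u')) ->
    (forall u u', Rel u u' -> Rel (O2 u) (O2' u')) -> Rel v v' ->
  Rel (pact O1 O2 p v) (pact O1' O2' p v').
Proof.
move=> [R0 RP] R1 R2 Rv.
have RD u u' w w' : Rel u u' -> Rel w w' -> Rel (u + w) (u' + w').
  by move=> Ru Rw; have := RP 1 _ _ _ _ Ru Rw; rewrite !scale1r.
have RZ c u u' : Rel u u' -> Rel (c *: u) (c *: u').
  by move=> Ru; have := RP c _ _ _ _ Ru R0; rewrite !addr0.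
have RI (O : V -> V) O' k u u' : (forall w w', Rel w w' -> Rel (O w) (O' w')) ->
    Rel u u' -> Rel (iter k O u) (iter k O' u').
  by move=> RO Ru; elim: k => //= k; exact: RO.
apply: (big_ind2 Rel) => [//|x1 x2 y1 y2|i _]; first exact: RD.
apply: (big_ind2 Rel) => [//|x1 x2 y1 y2|j _]; first exact: RD.
apply: RZ.
by apply: (RI) => //; exact: RI.
Qed.

(** The sums in [pact] run up to the sizes of [p] and of its coefficients; uniform bounds give
    different polynomials the same index set. *)
Lemma pact_wide (V : lmodType F) (O1 O2 : V -> V) p v (N M : nat) :
    (size p <= N)%N -> (forall i, size (p`_i)%R <= M)%N ->
  pact O1 O2 p v =
  \sum_(i < N) \sum_(j < M) p`_i`_j *: iter i O1 (iter j O2 v).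
Proof.
move=> pN pM; rewrite /pact.
rewrite (big_ord_widen N (fun i => \sum_(j < size p`_i)
    p`_i`_j *: iter i O1 (iter j O2 v))) // big_mkcond.
apply: eq_bigr => i _.
rewrite (big_ord_widen M (fun j => p`_i`_j *: iter i O1 (iter j O2 v))) //.
rewrite big_mkcond; case: ltnP => [_|ip].
  apply: eq_bigr => j _; case: ltnP => // jp.
  by rewrite nth_default ?scale0r.
by rewrite big1 // => j _; rewrite (nth_default 0 ip) coef0 scale0r.
Qed.

Lemma poly2_bound p : exists M, forall i, (size (p`_i)%R <= M)%N.
Proof.
exists (\max_(i < size p) size (p`_i)%R) => i; have [ip|ip] := ltnP i (size p).
  exact: (@leq_bigmax _ (fun i : 'I_(size p) => size p`_i) (Ordinal ip)).
by rewrite nth_default // size_poly0.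
Qed.

Section Ring.
Variables (V : lmodType F) (O1 O2 : {linear V -> V}).
Hypothesis O12 : forall v, O1 (O2 v) = O2 (O1 v).

Lemma pact_linear p : linear (pact O1 O2 p).
Proof.
(* The relation is the graph of (u1, u2) -> c u1 + u2, with the operators acting componentwise on
   pairs; the two projections are then handled in the same way. *)
move=> c u v; pose Rel (u : V * V) (u' : V) := u' = c *: u.1 + u.2.
pose O1' (u : V * V) := (O1 u.1, O1 u.2); pose O2' (u : V * V) := (O2 u.1, O2 u.2).
have : Rel (pact O1' O2' p (u, v)) (pact O1 O2 p (c *: u + v)).
  apply: (@pact_rel _ _ Rel) => //.
  - split=> [|d u1 v1 u2 v2 -> ->]; first by rewrite /Rel scaler0 addr0.
    by rewrite /Rel /= !scalerDr !scalerA [d * c]mulrC addrACA.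
  - by move=> u1 u2 ->; rewrite /Rel linearP.
  - by move=> u1 u2 ->; rewrite /Rel linearP.
rewrite /Rel => ->; congr (_ *: _ + _).
  apply: (@pact_rel _ _ (fun u u' => u.1 = u')) => //=.
  - by split=> //= d u1 v1 u2 v2 <- <-.
  - by move=> u1 u2 <-.
  - by move=> u1 u2 <-.
apply: (@pact_rel _ _ (fun u u' => u.2 = u')) => //=.
- by split=> //= d u1 v1 u2 v2 <- <-.
- by move=> u1 u2 <-.
- by move=> u1 u2 <-.
Qed.

HB.instance Definition _ p :=
  GRing.isLinear.Build F V V *:%R (pact O1 O2 p) (pact_linear p).

Lemma pactD p q v : pact O1 O2 (p + q) v = pact O1 O2 p v + pact O1 O2 q v.
Proof.
have [M pM] := poly2_bound p; have [M' qM] := poly2_bound q.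
have pW i : (size (p`_i)%R <= maxn M M')%N by rewrite leq_max pM.
have qW i : (size (q`_i)%R <= maxn M M')%N by rewrite leq_max qM orbT.
have pqW i : (size ((p + q)`_i)%R <= maxn M M')%N.
  by rewrite coefD (leq_trans (size_polyD _ _)) // geq_max pW qW.
rewrite !(@pact_wide _ _ _ _ _ (maxn (size p) (size q)) (maxn M M')) //.
- rewrite -big_split; apply: eq_bigr => i _; rewrite -big_split.
  by apply: eq_bigr => j _; rewrite !coefD scalerDl.
- exact: leq_maxr.
- exact: leq_maxl.
- exact: size_polyD.
Qed.

Lemma pactC c v : pact O1 O2 c%:P%:P v = c *: v.
Proof.
rewrite (@pact_wide _ _ _ _ _ 1 1) ?big_ord1 ?coefC ?size_polyC ?leq_b1 //.
by move=> i; rewrite coefC; case: eqP => _; rewrite ?size_poly0 // size_polyC leq_b1.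
Qed.

Lemma pactX p v : pact O1 O2 ('X * p) v = O1 (pact O1 O2 p v).
Proof.
have [M pM] := poly2_bound p.
rewrite (@pact_wide _ _ _ p _ (size p) M) //.
rewrite (@pact_wide _ _ _ _ _ (size p).+1 M).
- rewrite big_ord_recl big1 ?add0r => [|j _]; last by rewrite coefXM coef0 scale0r.
  rewrite linear_sum; apply: eq_bigr => i _; rewrite linear_sum.
  by apply: eq_bigr => j _; rewrite coefXM linearZ.
- by rewrite mulrC; have [->|p0] := eqVneq p 0; rewrite ?mul0r ?size_poly0 ?size_mulX.
- by move=> i; rewrite coefXM; case: eqP => _; rewrite ?size_poly0.
Qed.

Lemma pactY p v : pact O1 O2 ('Y * p) v = O2 (pact O1 O2 p v).
Proof.
have [M pM] := poly2_bound p.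
rewrite (@pact_wide _ _ _ p _ (size p) M) //.
rewrite (@pact_wide _ _ _ _ _ (size p) M.+1).
- rewrite linear_sum; apply: eq_bigr => i _; rewrite big_ord_recl coefCM coefXM.
  rewrite scale0r add0r linear_sum; apply: eq_bigr => j _.
  rewrite coefXM linearZ /=; congr (_ *: _).
  by elim: (i : nat) => //= k ->; rewrite O12.
- rewrite (leq_trans (size_polyMleq _ _)) // size_polyC.
  by case: (_ != 0); rewrite /= ?addSn ?add0n ?leq_pred.
- by move=> i; rewrite coefCM mulrC; have [->|p0] := eqVneq p`_i 0;
    rewrite ?mul0r ?size_poly0 ?size_mulX // ltnS pM.
Qed.

Lemma pactM p q v : pact O1 O2 (p * q) v = pact O1 O2 p (pact O1 O2 q v).
Proof.
elim/poly2_ind: p => [c|p p' IH IH'|p IH|p IH].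
- rewrite pactC; elim/poly2_ind: q => [d|q q' IH IH'|q IH|q IH].
  + by rewrite -!polyCM !pactC scalerA.
  + by rewrite mulrDr !pactD IH IH' scalerDr.
  + by rewrite mulrCA !pactX IH linearZ.
  + by rewrite mulrCA !pactY IH linearZ.
- by rewrite mulrDl !pactD IH IH'.
- by rewrite -mulrA !pactX IH.
- by rewrite -mulrA !pactY IH.
Qed.

Lemma pactXn n v : pact O1 O2 'X^n v = iter n O1 v.
Proof.
elim: n => [|n IH]; first by rewrite expr0 -!polyC1 pactC scale1r.
by rewrite exprS pactX IH.
Qed.

End Ring.

(** Replaces the polynomial p(x0 + x2, x2) of the definitions by [p] evaluated at a sum of
    operators, so that coefficients of a composition are never computed. *)
Lemma pact_compD (V : lmodType F) (O1 O2 : {linear V -> V}) p v :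
    (forall v, O1 (O2 v) = O2 (O1 v)) ->
  pact O1 O2 (p \Po ('X + 'Y)) v = pact (O1 \+ O2) O2 p v.
Proof.
move=> O12; have O32 w : (O1 \+ O2) (O2 w) = O2 ((O1 \+ O2) w).
  by rewrite /= linearD O12.
elim/poly2_ind: p => [c|p q IH IH'|p IH|p IH].
- by rewrite comp_polyC !pactC.
- by rewrite linearD !pactD IH IH'.
- by rewrite rmorphM /= comp_polyX mulrDl pactD // pactX pactY // IH pactX.
- by rewrite rmorphM /= comp_polyC !pactY // IH.
Qed.

End PolynomialAction.

(** * Shifts of exponents and scalar multiplication by Laurent series *)

Section Shifts.
Variable F : fieldType.

(* Multiplication by the variable. *)
Definition shift (V : lmodType F) (A : int -> V) : int -> V := fun n => A (n - 1).

Lemma shift_linear (V : lmodType F) : linear (@shift V).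
Proof. by []. Qed.

HB.instance Definition _ (V : lmodType F) :=
  GRing.isLinear.Build F (int -> V) (int -> V) *:%R (@shift V) (@shift_linear V).

(** [shift] moves the outermost exponent; nesting [under] around it reaches the exponents further
    in. *)
Definition under (V V' : lmodType F) (L : V -> V') (A : int -> V) : int -> V' :=
  fun n => L (A n).

Lemma under_linear (V V' : lmodType F) (L : {linear V -> V'}) : linear (under L).
Proof. by move=> c A B; apply: funext => n; exact: linearP. Qed.

HB.instance Definition _ (V V' : lmodType F) (L : {linear V -> V'}) :=
  GRing.isLinear.Build F (int -> V) (int -> V') *:%R (under L)
    (@under_linear V V' L).

Lemma iter_shift (V : lmodType F) k (A : int -> V) n :
  iter k (@shift V) A n = A (n - k%:Z).
Proof.
elim: k n => [|k IH] n /=; first by rewrite subr0.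
by rewrite /shift IH; congr A; lia.
Qed.

Lemma iter_under (V : lmodType F) k (L : V -> V) (A : int -> V) n :
  iter k (under L) A n = iter k L (A n).
Proof. by elim: k => //= k IH; rewrite {1}/under IH. Qed.

Variable W : lmodType F.
Implicit Types (A B : int -> int -> W) (p : {poly {poly F}}).

Definition s1 A : int -> int -> W := shift A.
Definition s2 A : int -> int -> W := under (@shift W) A.

HB.instance Definition _ := GRing.Linear.copy s1 (@shift (int -> W)).
HB.instance Definition _ := GRing.Linear.copy s2 (under (@shift W)).

Lemma s12 A : s1 (s2 A) = s2 (s1 A). Proof. by []. Qed.

Lemma pmulE p A : pmul p A = pact s1 s2 p A.
Proof.
apply: funext => m; apply: funext => n; rewrite /pmul /pact !fct_sumE.
apply: eq_bigr => i _; rewrite !fct_sumE; apply: eq_bigr => j _.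
by rewrite -[RHS]/(_ *: _) iter_shift iter_under iter_shift.
Qed.


Lemma pact_comm (V V' : lmodType F) (O1 O2 : V -> V) (O1' O2' : V' -> V')
    (L : {linear V -> V'}) p v :
    (forall u, L (O1 u) = O1' (L u)) -> (forall u, L (O2 u) = O2' (L u)) ->
  L (pact O1 O2 p v) = pact O1' O2' p (L v).
Proof.
move=> L1 L2; apply: (@pact_rel _ _ _ (fun u u' => L u = u')) => //.
- by split=> [|c u w u' w' <- <-]; [exact: linear0 | exact: linearP].
- by move=> u _ <-.
- by move=> u _ <-.
Qed.

Lemma isum_ord (V : zmodType) (h : int -> V) (N : nat) :
  (forall i, i < 0 \/ N%:Z <= i -> h i = 0) -> \isum_i h i = \sum_(j < N) h j.
Proof.
move=> h0; rewrite (@fsum_int _ _ 0 N) => [|i]; last by rewrite add0r; exact: h0.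
by apply: eq_bigr => j _; rewrite add0r.
Qed.

Lemma lscale_lpoly (q : {poly F}) (v : laurent W) n :
  lscale (lpoly q) v n = \sum_(j < size q) q`_j *: v (n - j%:Z).
Proof.
rewrite /= /conv (@isum_ord _ _ (size q)) // => -[i [//|qi]|i _]; last first.
  by rewrite scale0r.
by rewrite /= nth_default ?scale0r.
Qed.

Lemma lcoef_sum (V : zmodType) (I : Type) (r : seq I) (P : pred I)
    (f : I -> laurent V) n : (\sum_(i <- r | P i) f i) n = \sum_(i <- r | P i) f i n.
Proof. exact: (big_morph (fun g : laurent V => g n)). Qed.

Lemma lpoly0 : lpoly (0 : {poly F}) = 0.
Proof. by apply: laurentP => -[n|n] //=; rewrite coef0. Qed.

(** Links the operators to the field F((x))((x0)): inverting [iota_poly], as in the definition of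
    Y_E, undoes a polynomial in the shifts. *)
Lemma lscale2_iota p (B : laurent (laurent W)) k i :
  lscale2 (iota_poly p) B k i = pact s1 s2 p (fun k i => B k i) k i.
Proof.
rewrite -pmulE /pmul -[LHS]/((\isum_j lscale (iota_poly p j) (B (k - j))) i).
have E (j : nat) : (iota_poly p) j = lpoly p`_j by rewrite /= coef_map_id0 // lpoly0.
rewrite (@isum_ord _ _ (size p)) => [|[j [//|pj]|j _]].
- rewrite lcoef_sum; apply: eq_bigr => j _; rewrite E.
  exact: lscale_lpoly.
- by rewrite E nth_default // lpoly0 lscale0r.
- exact: lscale0r.
Qed.

(** Stated for general operations because it serves at two levels, with scalars in F and with
    scalars in F((x)). *)
Lemma conv_assoc (A V : zmodType) (mul : A -> A -> A) (op : A -> V -> V)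
    (f g : laurent A) (v : laurent V) n :
    (forall a, mul 0 a = 0) -> (forall a, mul a 0 = 0) ->
    (forall a, op a 0 = 0) -> (forall v, op 0 v = 0) ->
    (forall a, {morph op a : u w / u + w}) -> (forall u, {morph op^~ u : a b / a + b}) ->
    (forall a b u, op (mul a b) u = op a (op b u)) ->
  conv op (conv mul f g) v n = conv op f (conv op g v) n.
Proof.
move=> m0 m0r opr0 op0 opD opDl opM; have [M f0] := laurent_trunc f.
have [N g0] := laurent_trunc g; have [P v0] := laurent_trunc v.
rewrite /conv.
transitivity (\isum_i \isum_j op (mul (f j) (g (i - j))) (v (n - i))).
  apply: eq_isum => i; apply: (@raddf_isum _ _ (fun a => op a (v (n - i)))).
  - exact: op0.
  - exact: opDl.
  - apply: (@fin_supp_bound _ _ M (i - N + 1)) => j jM; first by rewrite f0.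
  by rewrite g0 //; lia.
rewrite (@exchange_isum_bound _ _ (M + N) (n - P + 1) M (n - P - N + 1)).
- apply: eq_isum => j.
  rewrite (isum_shift (fun i => op (mul (f j) (g (i - j))) (v (n - i))) j).
  rewrite (@raddf_isum _ _ (op (f j))) //.
    apply: eq_isum => i; rewrite -opM; congr (op (mul _ (g _)) (v _)); lia.
  apply: (@fin_supp_bound _ _ N (n - j - P + 1)) => i iN; first by rewrite g0.
  by rewrite v0 //; lia.
- move=> i j iMN; have [jM|Mj] := ltP j M; first by rewrite f0 ?m0.
  by rewrite g0 ?m0r //; lia.
- by move=> i j ni; rewrite v0 ?opr0 //; lia.
- by move=> i j jM; rewrite f0 ?m0.
- move=> i j jn; have [iP|Pi] := ltP (n - i) P; first by rewrite v0.
  by rewrite g0 ?m0r //; lia.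
Qed.

Lemma lscaleM (f g : laurent F) (v : laurent W) :
  lscale (f * g) v = lscale f (lscale g v).
Proof.
apply: laurentP => n; apply: (conv_assoc f g v n).
- exact: mul0r.
- exact: mulr0.
- exact: scaler0.
- exact: scale0r.
- by move=> a u w; rewrite scalerDr.
- by move=> a u w; rewrite scalerDl.
- by move=> a b u; rewrite scalerA.
Qed.

Lemma lscale2M (f g : laurent (laurent F)) (B : laurent (laurent W)) :
  lscale2 (f * g) B = lscale2 f (lscale2 g B).
Proof.
apply: laurentP => n; apply: (conv_assoc f g B n).
- exact: mul0r.
- exact: mulr0.
- exact: lscaler0.
- exact: lscale0r.
- move=> a u w; have := lscale_linear a 1 u w.
  by rewrite !scale1r.
- by move=> u a b; rewrite lscaleDl.
- exact: lscaleM.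
Qed.

Lemma lscale1 (v : laurent W) : lscale 1 v = v.
Proof.
apply: laurentP => n; rewrite /= /conv (@isum1 _ _ 0) /= => [|i i0].
  by rewrite scale1r subr0.
by rewrite (negPf i0) scale0r.
Qed.

Lemma lscale21 (B : laurent (laurent W)) : lscale2 1 B = B.
Proof.
apply: laurentP => n; rewrite /= /conv (@isum1 _ _ 0) /= => [|i i0].
  by rewrite lscale1 subr0.
by rewrite (negPf i0) lscale0r.
Qed.

Lemma iota_poly_neq0 p : p != 0 -> iota_poly (p \Po ('X + 'Y)) != 0.
Proof.
move=> p0; have : p \Po ('X + 'Y) != 0 by rewrite comp_poly_eq0 // size_XaddC.
move: (p \Po _) => q; apply: contra => /eqP q0; apply/eqP/polyP => i.
apply/polyP => j; rewrite !coef0.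
have := congr1 (fun f : laurent (laurent F) => f i j) q0.
by rewrite /= coef_map_id0 // lpoly0.
Qed.
End Shifts.

Arguments shift {F V}.
Arguments s1 {F W}.
Arguments s2 {F W}.
Arguments under {F V V'}.

(** * The substitution x1 = x + x0 *)

Section Substitution.
Variables (F : fieldType) (W : lmodType F).
Hypothesis charF : [pchar F] =i pred0.
Implicit Types (A B : int -> int -> W) (p q : {poly {poly F}}).

(* Membership in W((x))((x0)), the first index being the exponent of x0. *)
Definition ltr2 B : Prop :=
  (exists N : int, forall k i, k < N -> B k i = 0) /\ forall k, truncated (B k).

Lemma ltr2_laurent (B : laurent (laurent W)) : ltr2 (fun k i => B k i).
Proof.
split=> [|k]; last exact: laurent_trunc.
by have [N B0] := laurent_trunc B; exists N => k i /B0 ->.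
Qed.

Lemma laurent_ltr2 B : ltr2 B ->
  exists B' : laurent (laurent W), (fun k i => B' k i) = B.
Proof.
move=> [[N B0] Bk].
have tB : truncated (fun k => mkLaurent (Bk k)).
  by exists N => k kN; apply: laurentP => i; exact: B0.
by exists (mkLaurent tB).
Qed.

Lemma truncatedP c (f g : int -> W) :
  truncated f -> truncated g -> truncated (c *: f + g).
Proof.
move=> [M f0] [N g0]; exists (Num.min M N) => n; rewrite lt_min => /andP[nM nN].
by rewrite -[LHS]/(c *: f n + g n) f0 // g0 // scaler0 addr0.
Qed.

Lemma truncated_shift (f : int -> W) : truncated f -> truncated (shift f).
Proof. by move=> [N f0]; exists N => n nN; rewrite /shift f0 //; lia. Qed.

Lemma ltr2P c A B : ltr2 A -> ltr2 B -> ltr2 (c *: A + B).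
Proof.
move=> [[M A0] Ak] [[N B0] Bk]; split=> [|k]; last exact: truncatedP.
exists (Num.min M N) => n i; rewrite lt_min => /andP[nM nN].
by rewrite -[LHS]/(c *: A n i + B n i) A0 // B0 // scaler0 addr0.
Qed.

Lemma ltr20 : ltr2 0.
Proof. by split=> [|k]; exists 0. Qed.

Lemma ltr2_s1 B : ltr2 B -> ltr2 (s1 B).
Proof.
move=> [[N B0] Bk]; split=> [|k]; last exact: Bk.
by exists N => k i kN; rewrite /s1 /shift B0 //; lia.
Qed.

Lemma ltr2_s2 B : ltr2 B -> ltr2 (s2 B).
Proof.
move=> [[N B0] Bk]; split=> [|k]; last exact/truncated_shift/Bk.
by exists N => k i kN; rewrite /s2 /under /shift B0.
Qed.

Lemma ltr2_s12 B : ltr2 B -> ltr2 ((s1 \+ s2) B).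
Proof.
move=> hB; rewrite -[_ B]/(s1 B + s2 B) -[s1 B]scale1r.
by apply: ltr2P; [exact: ltr2_s1 | exact: ltr2_s2].
Qed.

Lemma truncated2P c A B : truncated2 A -> truncated2 B -> truncated2 (c *: A + B).
Proof.
move=> [M A0] [N B0]; exists (Num.min M N) => m n mn.
by rewrite -[LHS]/(c *: A m n + B m n) A0 ?B0 ?scaler0 ?addr0 //; lia.
Qed.

Lemma truncated2_0 : truncated2 (0 : int -> int -> W).
Proof. by exists 0. Qed.

Lemma truncated2_s1 A : truncated2 A -> truncated2 (s1 A).
Proof. by move=> [N A0]; exists N => m n mn; rewrite /s1 /shift A0 //; lia. Qed.

Lemma truncated2_s2 A : truncated2 A -> truncated2 (s2 A).
Proof. by move=> [N A0]; exists N => m n mn; rewrite /s2 /under /shift A0 //; lia. Qed.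

(* A(x + x0, x), the first index of the result being the exponent of x0. *)
Definition Subst A : int -> int -> W := fun k i =>
  \isum_m (gb F m k *: A m (i + k - m)).

Lemma subst_xx0_coef_Subst A : subst_xx0_coef A = Subst A.
Proof.
apply: funext => k; apply: funext => i; case: k => // k.
by rewrite /Subst isum0 // => m; rewrite scale0r.
Qed.

Lemma Subst_fin A k i : truncated2 A ->
  fin_supp (fun m => gb F m k *: A m (i + k - m)).
Proof.
move=> [N A0]; apply: (@fin_supp_bound _ _ N (i + k - N + 1)) => m mN;
  by rewrite A0 ?scaler0 //; lia.
Qed.

Lemma SubstP c A B : truncated2 A -> truncated2 B ->
  Subst (c *: A + B) = c *: Subst A + Subst B.
Proof.
move=> hA hB; apply: funext => k; apply: funext => i.
rewrite -[RHS]/(c *: Subst A k i + Subst B k i) /Subst -isumP; try exact: Subst_fin.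
apply: eq_isum => m; rewrite -[(c *: A + B) m _]/(c *: A m _ + B m _).
by rewrite scalerDr !scalerA mulrC.
Qed.

Lemma Subst0 : Subst 0 = 0.
Proof.
apply: funext => k; apply: funext => i; apply: isum0 => m; exact: scaler0.
Qed.

(** Pascal's rule read on coefficients: (x + x0)^(m + 1) is (x + x0) times (x + x0)^m. *)
Lemma Subst_s1 A : truncated2 A -> Subst (s1 A) = (s1 \+ s2) (Subst A).
Proof.
move=> hA; apply: funext => k; apply: funext => i.
rewrite -[RHS]/(Subst A (k - 1) i + Subst A k (i - 1)) [RHS]addrC.
have E (m : int) : i + (k - 1) - m = i - 1 + k - m by lia.
have -> : Subst A (k - 1) i = \isum_m (gb F m (k - 1) *: A m (i - 1 + k - m)).
  by apply: eq_isum => m; rewrite E.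
rewrite /Subst (isum_shift (fun m => gb F m k *: s1 A m (i + k - m)) 1).
have h1 := Subst_fin k (i - 1) hA.
have h2 := Subst_fin (k - 1) i hA.
rewrite -isumD //; last by case: h2 => s h2; exists s => m /h2; rewrite E.
apply: eq_isum => m; rewrite gbS // scalerDl /s1 /shift.
by congr (_ *: A _ _ + _ *: A _ _); lia.
Qed.

Lemma Subst_s2 A : Subst (s2 A) = s2 (Subst A).
Proof.
apply: funext => k; apply: funext => i.
by apply: eq_isum => m; rewrite /s2 /under /shift; congr (_ *: A _ _); lia.
Qed.

Lemma Subst_ltr2 A : truncated2 A -> ltr2 (Subst A).
Proof.
move=> [N A0]; split=> [|k].
  by exists 0 => k i k0; apply: isum0 => m; rewrite gb_neg ?scale0r.
exists (N + N - k) => i ik; apply: isum0 => m; rewrite A0 ?scaler0 //.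
by case: (ltP m N) => [|Nm]; [left | right; lia].
Qed.

Lemma pact_Subst p A : truncated2 A ->
  truncated2 (pact s1 s2 p A) /\
  Subst (pact s1 s2 p A) = pact (s1 \+ s2) s2 p (Subst A).
Proof.
move=> hA; pose Rel A B := truncated2 A /\ Subst A = B.
apply: (@pact_rel _ _ _ Rel) => //.
- split; first by split; [exact: truncated2_0 | exact: Subst0].
  move=> c u v _ _ [hu <-] [hv <-]; split; first exact: truncated2P.
  exact: SubstP.
- by move=> u _ [hu <-]; split; [exact: truncated2_s1 | exact: Subst_s1].
- by move=> u _ [hu <-]; split; [exact: truncated2_s2 | exact: Subst_s2].
Qed.

Lemma s12D B : (s1 \+ s2) (s2 B) = s2 ((s1 \+ s2) B). Proof. by []. Qed.

(** On W((x))((x0)) the operator is multiplication by a nonzero element of the field F((x))((x0)).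
    Truncation is essential: a series of delta function type is killed by x + x0. *)
Lemma pact_cancel p B : p != 0 -> ltr2 B -> pact (s1 \+ s2) s2 p B = 0 -> B = 0.
Proof.
move=> p0 /laurent_ltr2[B' <-]; rewrite -pact_compD; last exact: s12.
move=> pB; pose f := iota_poly (p \Po ('X + 'Y)).
have fB : lscale2 f B' = 0.
  apply: laurentP => k; apply: laurentP => i; rewrite lscale2_iota.
  by rewrite pB.
suff -> : B' = 0 by [].
rewrite -(lscale21 B') -(@mulVf _ f) ?iota_poly_neq0 // lscale2M fB.
by have := lscale2_linear f^-1 (-1) (0 : laurent (laurent W)) 0;
  rewrite scaler0 addr0 scaleN1r addNr.
Qed.

(* [B] is the expansion in W((x))((x0)) of "A(x + x0, x)", where [A] becomes
   an element of W((x1,x2)) once multiplied by a nonzero polynomial. *)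
Definition phi A B : Prop :=
  ltr2 B /\ exists2 p, p != 0 & truncated2 (pact s1 s2 p A) /\
    pact (s1 \+ s2) s2 p B = Subst (pact s1 s2 p A).

(** A witness of [phi] may be replaced by any multiple, so two instances of [phi] can be compared
    through a common polynomial. *)
Lemma phi_mul A B q p :
    truncated2 (pact s1 s2 p A) /\ pact (s1 \+ s2) s2 p B = Subst (pact s1 s2 p A) ->
  truncated2 (pact s1 s2 (q * p) A) /\
    pact (s1 \+ s2) s2 (q * p) B = Subst (pact s1 s2 (q * p) A).
Proof.
move=> [hA hB]; have [h E] := pact_Subst q hA.
by rewrite !pactM // hB -E.
Qed.

Lemma phi_uniq A B B' : phi A B -> phi A B' -> B = B'.
Proof.
move=> [hB [p p0 pAB]] [hB' [q q0 qAB]].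
have [h1 h2] := phi_mul q pAB; have [h3 h4] := phi_mul p qAB.
apply/eqP; rewrite -subr_eq0; apply/eqP.
apply: (@pact_cancel (q * p)).
- by rewrite mulf_neq0.
- by rewrite addrC -scaleN1r; exact: ltr2P.
- rewrite addrC -scaleN1r pact_linear // h2 mulrC h4.
  by rewrite mulrC scaleN1r addNr.
Qed.

Lemma phi_linear : linear_rel phi.
Proof.
split.
  split; first exact: ltr20.
  exists 1; first exact: oner_neq0.
  rewrite -!polyC1 !pactC !scaler0 Subst0; split=> //; exact: truncated2_0.
move=> c A A' B B' [hB [p p0 pAB]] [hB' [q q0 qAB]].
have [h1 h2] := phi_mul q pAB; have [h3 h4] := phi_mul p qAB.
split; first exact: ltr2P.
exists (q * p); first by rewrite mulf_neq0.
rewrite mulrC in h3 h4.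
by rewrite !pact_linear // h2 h4 SubstP //; split=> //; exact: truncated2P.
Qed.

Lemma phi_s1 A B : phi A B -> phi (s1 A) ((s1 \+ s2) B).
Proof.
move=> [hB [p p0 [h1 h2]]]; split; first exact: ltr2_s12.
exists p => //.
have -> : pact s1 s2 p (s1 A) = s1 (pact s1 s2 p A).
  by apply: esym; apply: (@pact_comm F _ _ _ _ _ _ s1).
split; first exact: truncated2_s1.
rewrite Subst_s1 // -h2; apply: esym; apply: pact_comm => // u; exact: linearD.
Qed.

Lemma phi_s2 A B : phi A B -> phi (s2 A) (s2 B).
Proof.
move=> [hB [p p0 [h1 h2]]]; split; first exact: ltr2_s2.
exists p => //.
have -> : pact s1 s2 p (s2 A) = s2 (pact s1 s2 p A).
  by apply: esym; apply: (@pact_comm F _ _ _ _ _ _ s2).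
split; first exact: truncated2_s2.
by rewrite Subst_s2 // -h2; apply: esym; apply: (@pact_comm F _ _ _ _ _ _ s2).
Qed.

Lemma phi_trunc A : truncated2 A -> phi A (Subst A).
Proof.
move=> hA; split; first exact: Subst_ltr2.
exists 1; first exact: oner_neq0.
by rewrite -!polyC1 !pactC !scale1r.
Qed.

Definition quasi_pair (a b : calE W) : Prop :=
  exists2 p, p != 0 & pair_cond p a b.

Lemma phi_YE a b w : quasi_pair a b ->
  phi (pair_prod a b w) (fun k i => YE a b k w i).
Proof.
move=> [q q0 qab].
(* The default value 0 of [YE_poly] is excluded by the witness [q]. *)
have [p0 pab] : YE_poly a b != 0 /\ pair_cond (YE_poly a b) a b.
  by rewrite /YE_poly; case: xgetP => [p _ //|/(_ q)[]].
pose B := YE_series (@YE_polyP F W a b) w.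
split; first exact: (ltr2_laurent B).
exists (YE_poly a b) => //; split; first by rewrite -pmulE; exact: pab.
rewrite -pact_compD; last exact: s12.
apply: funext => k; apply: funext => i; rewrite -(lscale2_iota _ B).
rewrite /B /YE_series -lscale2M divff ?iota_poly_neq0 // lscale21.
by rewrite -pmulE -subst_xx0_coef_Subst.
Qed.

(** The bound is uniform in the vector acted on: the substituted series has no negative powers of
    x0, so these come only from the inverse of the polynomial, which does not involve [w]. Hence
    Y_E(a,x0)b is a Laurent series in x0 with operator coefficients. *)
Lemma YE_trunc (a b : calE W) : exists N : int, forall k, k < N -> YE a b k = 0.
Proof.
pose f : laurent (laurent F) := (iota_poly (YE_poly a b \Po ('X + 'Y)))^-1.
have [N f0] := laurent_trunc f; exists N => k kN; apply: calEP => w n.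
rewrite -[LHS]/((\isum_j lscale (f j) (subst_xx0 (@YE_polyP F W a b w) (k - j))) n).
rewrite isum0 // => j; have [/f0 ->|Nj] := ltP j N; first exact: lscale0r.
have : k - j < 0 by lia.
case: (k - j) => // l _; rewrite (_ : subst_xx0 _ _ = 0) ?lscaler0 //.
exact: laurentP.
Qed.

End Substitution.

(** * Multiplication by a Laurent series in either variable *)

Section LaurentMultiplication.
Variables (F : fieldType) (W : lmodType F).
Hypothesis charF : [pchar F] =i pred0.
Implicit Types (A B : int -> int -> W) (p q : {poly {poly F}}) (f g : laurent F).

Lemma taylor_trunc f : truncated (taylor f).
Proof. by exists 0 => -[]. Qed.

Definition ltaylor f : laurent (laurent F) := mkLaurent (taylor_trunc f).

Lemma iter_lderiv f (k : nat) n : iter k (@lderiv F) f n = ff F (n + k%:Z) k * f (n + k%:Z).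
Proof.
elim: k n => [|k IH] n; first by rewrite /ff big_ord0 mul1r addr0.
rewrite iterS /= IH mulrA ffSr.
have -> : n + 1 + k%:Z = n + k.+1%:Z by lia.
have -> : n + k.+1%:Z - k%:Z = n + 1 by lia.
by rewrite [ff _ _ _ * _]mulrC.
Qed.

(** Iterated derivatives produce falling factorials, so the exponential form of f(x + x0) is the
    binomial expansion used by [Subst]. *)
Lemma ltaylorE f (t j : int) : ltaylor f t j = gb F (j + t) t * f (j + t).
Proof.
case: t => [t|t]; last by rewrite mul0r.
rewrite -[LHS]/(\isum_i (lconst t`!%:R^-1 i * iter t (@lderiv F) f (j - i))).
rewrite (@isum1 _ _ 0) => [|i i0]; last by rewrite /= (negPf i0) mul0r.
by rewrite subr0 iter_lderiv mulrA gb_ff mulrC [in RHS]mulrC [ff _ _ _ * _]mulrC.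
Qed.

(* Multiplication of the series A(z,x) by f(z), resp. by g(x). *)
Definition zmul f A : int -> int -> W := fun m n =>
  \isum_s (f s *: A (m - s) n).
Definition xmul g A : int -> int -> W := fun m n =>
  \isum_s (g s *: A m (n - s)).

Lemma pair_prod_lactl f (a b : calE W) w :
  pair_prod (lact f a) b w = zmul f (pair_prod a b w).
Proof. by []. Qed.

Lemma lscale_fin f (v : int -> W) n :
  truncated v -> fin_supp (fun s => f s *: v (n - s)).
Proof.
move=> [N v0]; have [M f0] := laurent_trunc f.
apply: (@fin_supp_bound _ _ M (n - N + 1)) => s sM; first by rewrite f0 ?scale0r.
by rewrite v0 ?scaler0 //; lia.
Qed.

Lemma pair_prod_lactr g (a b : calE W) w :
  pair_prod a (lact g b) w = xmul g (pair_prod a b w).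
Proof.
apply: funext => m; apply: funext => n.
have E := (@isum_linear _ _ _ a (fun s => g s *: b w (n - s))
  (lscale_fin g n (laurent_trunc _))).
rewrite -[LHS]/(a (\isum_s (g s *: b w (n - s))) m) E.
rewrite (@raddf_isum _ _ (fun u : laurent W => u m)) //.
  by apply: eq_isum => s; rewrite linearZ.
have [s hs] := lscale_fin g n (laurent_trunc (b w)); exists s => i /hs ->.
by rewrite linear0.
Qed.

(** [O1] is left open because it is multiplication by x1 before the substitution and by x + x0 after
    it. Truncation keeps the sums in [xmul] finite. *)
Lemma pact_xmul (O1 : (int -> int -> W) -> int -> int -> W) g p A :
    (forall A, (forall m, truncated (A m)) -> forall m, truncated (O1 A m)) ->
    (forall A, (forall m, truncated (A m)) -> O1 (xmul g A) = xmul g (O1 A)) ->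
    (forall m, truncated (A m)) ->
  (forall m, truncated (pact O1 s2 p A m)) /\
  xmul g (pact O1 s2 p A) = pact O1 s2 p (xmul g A).
Proof.
move=> O1t O1g hA.
apply: (@pact_rel _ _ _ (fun A A' => (forall m, truncated (A m)) /\ xmul g A = A')) => //.
- split.
    split=> [m|]; first by exists 0.
    apply: funext => m; apply: funext => n; apply: isum0 => s; exact: scaler0.
  move=> c u v _ _ [hu <-] [hv <-]; split=> [m|]; first exact: truncatedP.
  apply: funext => m; apply: funext => n.
  rewrite -[RHS]/(c *: xmul g u m n + xmul g v m n) /xmul.
  rewrite -isumP; try exact: lscale_fin.
  apply: eq_isum => s; rewrite -[(c *: u + v) m _]/(c *: u m _ + v m _).
  by rewrite scalerDr !scalerA mulrC.
- by move=> u _ [hu <-]; split; [exact: O1t | rewrite O1g].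
- move=> u _ [hu <-]; split=> [m|]; first exact/truncated_shift/hu.
  apply: funext => m; apply: funext => n; apply: eq_isum => s.
  by rewrite /s2 /under /shift; congr (_ *: u _ _); lia.
Qed.

Lemma xmulD g A B : (forall m, truncated (A m)) -> (forall m, truncated (B m)) ->
  xmul g (A + B) = xmul g A + xmul g B.
Proof.
move=> hA hB; apply: funext => m; apply: funext => n.
rewrite -[RHS]/(xmul g A m n + xmul g B m n) /xmul.
rewrite -isumD; try exact: lscale_fin.
by apply: eq_isum => s; rewrite -scalerDr.
Qed.

Lemma xmul_s1 g A : s1 (xmul g A) = xmul g (s1 A). Proof. by []. Qed.

Lemma xmul_s2 g A : s2 (xmul g A) = xmul g (s2 A).
Proof.
apply: funext => m; apply: funext => n; apply: eq_isum => s.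
by rewrite /s2 /under /shift; congr (_ *: A _ _); lia.
Qed.

Lemma truncated2_xmul g A : truncated2 A -> truncated2 (xmul g A).
Proof.
move=> [N A0]; have [M g0] := laurent_trunc g; exists (Num.min N (N + M)) => m n mn.
apply: isum0 => s; have [sM|Ms] := ltP s M; first by rewrite g0 ?scale0r.
by rewrite A0 ?scaler0 //; lia.
Qed.

Lemma Subst_xmul g A : truncated2 A -> Subst (xmul g A) = xmul g (Subst A).
Proof.
move=> [N A0]; have [M g0] := laurent_trunc g.
apply: funext => k; apply: funext => i; rewrite /Subst /xmul.
transitivity (\isum_m \isum_s (gb F m k * g s) *: A m (i + k - m - s)).
  apply: eq_isum => m; rewrite isumZ.
    by apply: eq_isum => s; rewrite scalerA.
  by apply: lscale_fin; exists N => n nN; rewrite A0 //; right.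
rewrite (@exchange_isum_bound _ _ N (i + k - N - M + 1) M (i + k - N - N + 1)).
- apply: eq_isum => s; rewrite isumZ; last first.
    by apply: Subst_fin; exists N.
  apply: eq_isum => m; rewrite scalerA mulrC; congr (_ *: A _ _); lia.
- by move=> m s mN; rewrite A0 ?scaler0 //; left.
- move=> m s hm; have [sM|Ms] := ltP s M; first by rewrite g0 // mulr0 scale0r.
  by rewrite A0 ?scaler0 //; right; lia.
- by move=> m s sM; rewrite g0 // mulr0 scale0r.
- move=> m s hs; have [mN|Nm] := ltP m N; first by rewrite A0 ?scaler0 //; left.
  by rewrite A0 ?scaler0 //; right; lia.
Qed.

Lemma phi_xmul g A B : (forall m, truncated (A m)) -> phi A B ->
  phi (xmul g A) (xmul g B).
Proof.
move=> hA [hB [p p0 [h1 h2]]].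
have [_ E1] := @pact_xmul s1 g p A (fun A hA m => hA _) (fun _ _ => erefl) hA.
have [_ E2] : (forall m, truncated (pact (s1 \+ s2) s2 p B m)) /\
    xmul g (pact (s1 \+ s2) s2 p B) = pact (s1 \+ s2) s2 p (xmul g B).
  apply: pact_xmul => [C hC m|C hC|]; last exact: hB.2.
    rewrite -[_ m]/(C (m - 1) + @shift F W (C m)) -[C (m - 1)]scale1r.
    apply: truncatedP => //. exact (truncated_shift (hC m)).
  rewrite -[LHS]/(s1 (xmul g C) + s2 (xmul g C)) xmul_s1 xmul_s2 -xmulD //.
  - by move=> m; exact: hC.
  - by move=> m; exact (truncated_shift (hC m)).
split.
  split=> [|k]; first have [[N B0] _] := hB.
    by exists N => k i kN; apply: isum0 => s; rewrite B0 ?scaler0.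
  by apply: conv_trunc (Laurent (asboolT (hB.2 k))) _ _;
    [exact: scale0r | exact: scaler0].
exists p => //; rewrite -E1 -E2 h2 Subst_xmul //; split=> //.
exact: truncated2_xmul.
Qed.

(* Multiplication by f(x + x0), the first index being the exponent of x0. *)
Definition tmul f B : int -> int -> W := fun k i =>
  \isum_t \isum_j (ltaylor f t j *: B (k - t) (i - j)).

Lemma tmul_lscale2 f (B : laurent (laurent W)) :
  tmul f (fun k i => B k i) = fun k i => lscale2 (ltaylor f) B k i.
Proof.
apply: funext => k; apply: funext => i.
rewrite -[RHS]/((\isum_t lscale (ltaylor f t) (B (k - t))) i).
rewrite (@raddf_isum _ _ (fun u : laurent W => u i)) //.
have [N B0] := laurent_trunc B; have [M f0] := laurent_trunc (ltaylor f).
apply: (@fin_supp_bound _ _ M (k - N + 1)) => t tM; first by rewrite f0 ?lscale0r.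
by rewrite B0 ?lscaler0 //; lia.
Qed.

(** Vandermonde's identity expresses that z = x + x0 respects the product of the powers z^s and z^m;
    the rest is interchange of finite sums. *)
Lemma Subst_zmul f A : truncated2 A -> Subst (zmul f A) = tmul f (Subst A).
Proof.
move=> [N A0]; have [M f0] := laurent_trunc f.
apply: funext => k; apply: funext => i.
pose h s m := A m (i + k - s - m).
(* A nonzero term needs s >= M, m >= N and a remaining exponent i + k - s - m >= N; together these
   also bound s and m from above. *)
have h0 s m : s < M \/ m < N \/ i + k - N - N < s \/ i + k - N - M < m ->
    f s *: h s m = 0.
  move=> hsm; have [sM|Ms] := ltP s M; first by rewrite f0 ?scale0r.
  by rewrite /h A0 ?scaler0 //; lia.
transitivity (\isum_s \isum_m (gb F (m + s) k *: (f s *: h s m))).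
  transitivity (\isum_m \isum_s (gb F m k *: (f s *: A (m - s) (i + k - m)))).
    apply: eq_isum => m; apply: isumZ.
    apply: (@fin_supp_bound _ _ M (m - N + 1)) => s hs.
      by rewrite f0 ?scale0r.
    by rewrite A0 ?scaler0 //; left; lia.
  rewrite (@exchange_isum_bound _ _ (N + M) (i + k - N + 1) M (i + k - N - N + 1)).
  - apply: eq_isum => s.
    rewrite (isum_shift (fun m => gb F m k *: (f s *: A (m - s) (i + k - m))) s).
    by apply: eq_isum => m; rewrite /h; congr (_ *: (_ *: A _ _)); lia.
  - move=> m s hm; have [sM|Ms] := ltP s M; first by rewrite f0 ?scale0r ?scaler0.
    by rewrite A0 ?scaler0 //; lia.
  - by move=> m s hm; rewrite A0 ?scaler0 //; lia.
  - by move=> m s hs; rewrite f0 ?scale0r ?scaler0.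
  - move=> m s hs; have [mN|Nm] := ltP (m - s) N; first by rewrite A0 ?scaler0 //; left.
    by rewrite A0 ?scaler0 //; lia.
transitivity (\isum_s \isum_m \isum_t
    (gb F s t * gb F m (k - t)) *: (f s *: h s m)).
  apply: eq_isum => s; apply: eq_isum => m; rewrite addrC gb_vandermonde //.
  apply: (@raddf_isum _ _ (fun c => c *: (f s *: h s m))).
  - exact: scale0r.
  - by move=> a b; exact: scalerDl.
  apply: (@fin_supp_bound _ _ 0 (k + 1)) => t tk; first by rewrite gb_neg ?mul0r.
  by rewrite [gb F m _]gb_neg ?mulr0 //; lia.
transitivity (\isum_s \isum_t \isum_m
    (gb F s t * gb F m (k - t)) *: (f s *: h s m)).
  apply: eq_isum => s.
  apply: (@exchange_isum_bound _ _ N (i + k - N - M + 1) 0 (k + 1)) => [m t hm|m t hm|m t ht|m t ht].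
  - by rewrite h0 ?scaler0 //; lia.
  - by rewrite h0 ?scaler0 //; lia.
  - by rewrite gb_neg ?mul0r ?scale0r.
  - by rewrite [gb F m _]gb_neg ?mulr0 ?scale0r //; lia.
rewrite (@exchange_isum_bound _ _ M (i + k - N - N + 1) 0 (k + 1)).
- apply: eq_isum => t; rewrite (isum_shift _ t); apply: eq_isum => j.
  rewrite ltaylorE /Subst isumZ; last by apply: Subst_fin; exists N.
  apply: eq_isum => m; rewrite !scalerA mulrAC /h.
  by congr (_ *: A _ _); lia.
- by move=> s t hs; apply: isum0 => m; rewrite h0 ?scaler0 //; left.
- by move=> s t hs; apply: isum0 => m; rewrite h0 ?scaler0 //; lia.
- by move=> s t ht; apply: isum0 => m; rewrite gb_neg ?mul0r ?scale0r.
- by move=> s t ht; apply: isum0 => m; rewrite [gb F m _]gb_neg ?mulr0 ?scale0r //; lia.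
Qed.

Lemma zmul_fin f A m n : truncated (A^~ n) -> fin_supp (fun s => f s *: A (m - s) n).
Proof. exact: (@lscale_fin f (A^~ n)). Qed.

Lemma pact_zmul f p A : (forall n, truncated (A^~ n)) ->
  zmul f (pact s1 s2 p A) = pact s1 s2 p (zmul f A).
Proof.
move=> hA; pose Rel A A' := (forall n, truncated (A^~ n)) /\ zmul f A = A'.
suff [] : Rel (pact s1 s2 p A) (pact s1 s2 p (zmul f A)) by [].
apply: (@pact_rel _ _ _ Rel) => //.
- split.
    split=> [n|]; first by exists 0.
    apply: funext => m; apply: funext => n; apply: isum0 => s; exact: scaler0.
  move=> c u v _ _ [hu <-] [hv <-]; split=> [n|].
    exact: (truncatedP c (hu n) (hv n)).
  apply: funext => m; apply: funext => n.
  rewrite -[RHS]/(c *: zmul f u m n + zmul f v m n) /zmul.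
  rewrite -isumP; try exact: zmul_fin.
  apply: eq_isum => s; rewrite -[(c *: u + v) _ n]/(c *: u _ n + v _ n).
  by rewrite scalerDr !scalerA mulrC.
- move=> u _ [hu <-]; split=> [n|]; first exact (truncated_shift (hu n)).
  apply: funext => m; apply: funext => n; apply: eq_isum => s.
  by rewrite /s1 /shift; congr (_ *: u _ _); lia.
- by move=> u _ [hu <-]; split=> [n|]; first exact (hu (n - 1)).
Qed.

Lemma truncated2_zmul f A : truncated2 A -> truncated2 (zmul f A).
Proof.
move=> [N A0]; have [M f0] := laurent_trunc f; exists (Num.min N (N + M)) => m n mn.
apply: isum0 => s; have [sM|Ms] := ltP s M; first by rewrite f0 ?scale0r.
by rewrite A0 ?scaler0 //; lia.
Qed.

Lemma phi_zmul f A B : (forall n, truncated (A^~ n)) -> phi A B ->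
  phi (zmul f A) (tmul f B).
Proof.
move=> hA [/laurent_ltr2[B' <-] [p p0 [h1 h2]]].
rewrite tmul_lscale2; split; first exact: ltr2_laurent.
exists p => //; rewrite -pact_zmul //; split; first exact: truncated2_zmul.
(* Both multiplications become scalars of the field F((x))((x0)), where they commute. *)
have C (D : laurent (laurent W)) : pact (s1 \+ s2) s2 p (fun k i => D k i) =
    (fun k i => lscale2 (iota_poly (p \Po ('X + 'Y))) D k i).
  rewrite -pact_compD; last exact: s12.
  by apply: funext => k; apply: funext => i; rewrite lscale2_iota.
by rewrite Subst_zmul // -h2 !C -lscale2M mulrC lscale2M tmul_lscale2.
Qed.

Lemma pair_prod_truncl (a b : calE W) w n : truncated ((pair_prod a b w)^~ n).
Proof. exact: laurent_trunc. Qed.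

Lemma pair_prod_truncr (a b : calE W) w :
  exists N : int, forall m n, n < N -> pair_prod a b w m n = 0.
Proof.
have [N b0] := laurent_trunc (b w); exists N => m n nN.
by rewrite /pair_prod b0 // linear0.
Qed.

Lemma taylor_conv_fin f (B : int -> calE W) n :
    (exists N : int, forall k, k < N -> B k = 0) ->
  fin_supp (fun t => lact (taylor f t) (B (n - t))).
Proof.
move=> [N B0]; apply: (@fin_supp_bound _ _ 0 (n - N + 1)) => t ht.
  apply: calEP => u j; rewrite -[LHS]/(lscale (ltaylor f t) _ j).
  by case: t ht => // t _; rewrite (_ : ltaylor f _ = 0) ?lscale0r //; exact: laurentP.
rewrite B0; last lia.
by apply: calEP => u j; rewrite -[LHS]/(lscale _ 0 j) lscaler0.
Qed.

Lemma lact0 g : lact g (0 : calE W) = 0.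
Proof. by apply: calEP => u j; rewrite -[LHS]/(lscale g 0 j) lscaler0. Qed.

Lemma YE_lact f g (a b : calE W) n :
    quasi_pair a b -> quasi_pair (lact f a) (lact g b) ->
  YE (lact f a) (lact g b) n =
  conv (@lact F W) (taylor f) (fun m => lact g (YE a b m)) n.
Proof.
move=> hab hab'; apply: calEP => w i.
have E : (fun k i => YE (lact f a) (lact g b) k w i) =
    tmul f (xmul g (fun k i => YE a b k w i)).
  apply: (phi_uniq charF (phi_YE w hab')).
  rewrite pair_prod_lactl pair_prod_lactr; apply: phi_zmul.
    by move=> m; rewrite -pair_prod_lactr; exact: pair_prod_truncl.
  apply: phi_xmul; last exact: phi_YE.
  by move=> m; have [N h] := pair_prod_truncr a b w; exists N => i'; exact: h.
rewrite -[LHS]/((fun k i => YE (lact f a) (lact g b) k w i) n i) E.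
rewrite /conv (@raddf_isum _ _ (fun c : calE W => c w i)) //.
apply: (@taylor_conv_fin f (fun m => lact g (YE a b m))).
by have [N B0] := YE_trunc a b; exists N => k kN; rewrite B0 // lact0.
Qed.

End LaurentMultiplication.

(** * Weak associativity *)

Section SubstitutionX0X2.
Variables (F : fieldType).
Hypothesis charF : [pchar F] =i pred0.

(* A(x0 + x2, x2), the first index of the result being the exponent of x0. *)
Definition Subst02 (V : lmodType F) (A : int -> int -> V) : int -> int -> V :=
  fun m n => \isum_j (gb F (m + j) j *: A (m + j) (n - j)).

Definition trunc_snd (V : lmodType F) (A : int -> int -> V) : Prop :=
  exists N : int, forall m n, n < N -> A m n = 0.

Lemma Subst02_fin (V : lmodType F) (A : int -> int -> V) m n : trunc_snd A ->
  fin_supp (fun j => gb F (m + j) j *: A (m + j) (n - j)).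
Proof.
move=> [N A0]; apply: (@fin_supp_bound _ _ 0 (n - N + 1)) => j hj.
  by rewrite gb_neg ?scale0r.
by rewrite A0 ?scaler0 //; lia.
Qed.

Lemma subst_x0x2E (V : lmodType F) (A : int -> int -> V) : trunc_snd A ->
  subst_x0x2 A = Subst02 A.
Proof.
move=> [N A0]; apply: funext => m; apply: funext => n.
pose D := `|n - N|%N.+1.
rewrite /subst_x0x2 (@fsbigE _ _ _ _ _ (iota 0 D)) ?iota_uniq //; last first.
  move=> k _; rewrite mem_iota add0n -leqNgt => Dk.
  by rewrite A0 ?scaler0 //; lia.
rewrite /Subst02 (@isum_ord _ _ D) => [|j [j0|Dj]]; last first.
- by rewrite A0 ?scaler0 //; lia.
- by rewrite gb_neg ?scale0r.
rewrite -[D in iota 0 D]subn0 -/(index_iota 0 D) big_mkord.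
by apply: eq_bigl => j; rewrite mem_set.
Qed.

Section Relation.
Variable V : lmodType F.
Implicit Types A : int -> int -> V.

Lemma trunc_sndP c A B : trunc_snd A -> trunc_snd B -> trunc_snd (c *: A + B).
Proof.
move=> [M A0] [N B0]; exists (Num.min M N) => m n; rewrite lt_min => /andP[nM nN].
by rewrite -[LHS]/(c *: A m n + B m n) A0 // B0 // scaler0 addr0.
Qed.

Lemma Subst02_rel : linear_rel (fun A A' => trunc_snd A /\ Subst02 A = A').
Proof.
split.
  split; first by exists 0.
  apply: funext => m; apply: funext => n; apply: isum0 => j; exact: scaler0.
move=> c A B _ _ [hA <-] [hB <-]; split; first exact: trunc_sndP.
apply: funext => m; apply: funext => n.
rewrite -[RHS]/(c *: Subst02 A m n + Subst02 B m n) /Subst02 -isumP; try exact: Subst02_fin.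
apply: eq_isum => j; rewrite -[(c *: A + B) _ _]/(c *: A _ _ + B _ _).
by rewrite scalerDr !scalerA mulrC.
Qed.

Lemma trunc_snd_s1 A : trunc_snd A -> trunc_snd (s1 A).
Proof. by move=> [N A0]; exists N => m n /A0; apply. Qed.

Lemma trunc_snd_s2 A : trunc_snd A -> trunc_snd (s2 A).
Proof. by move=> [N A0]; exists N => m n nN; apply: A0; lia. Qed.

Lemma Subst02_s1 A : trunc_snd A -> Subst02 (s1 A) = (s1 \+ s2) (Subst02 A).
Proof.
move=> hA; apply: funext => m; apply: funext => n.
rewrite -[RHS]/(Subst02 A (m - 1) n + Subst02 A m (n - 1)).
rewrite {3}/Subst02 (isum_shift (fun j => gb F (m + j) j *: _) (-1)).
rewrite /Subst02 -isumD; first 1 last.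
- exact: Subst02_fin.
- have [s h] := Subst02_fin m (n - 1) hA; exists [seq j + 1 | j <- s] => j js.
  by apply: h; apply: contra js => js; apply/mapP; exists (j - 1); rewrite ?subrK.
apply: eq_isum => j; rewrite /s1 /shift.
have -> : m + (j - 1) = m + j - 1 by lia.
have -> : m - 1 + j = m + j - 1 by lia.
have -> : n - 1 - (j - 1) = n - j by lia.
by rewrite -scalerDl -gbS // subrK.
Qed.

Lemma Subst02_s2 A : Subst02 (s2 A) = s2 (Subst02 A).
Proof.
apply: funext => m; apply: funext => n; apply: eq_isum => j.
by rewrite /s2 /under /shift; congr (_ *: A _ _); lia.
Qed.

Lemma pact_Subst02 p A : trunc_snd A ->
  trunc_snd (pact s1 s2 p A) /\
  Subst02 (pact s1 s2 p A) = pact (s1 \+ s2) s2 p (Subst02 A).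
Proof.
move=> hA.
apply: (@pact_rel _ _ _ (fun A A' => trunc_snd A /\ Subst02 A = A')) => //.
- exact: Subst02_rel.
- by move=> u _ [hu <-]; split; [exact: trunc_snd_s1 | exact: Subst02_s1].
- by move=> u _ [hu <-]; split; [exact: trunc_snd_s2 | exact: Subst02_s2].
Qed.

End Relation.

(* (x0 + x2)^m = (x2 + x0)^m when m >= 0. *)
Lemma Subst_Subst02 (V : lmodType F) (A : int -> int -> V) :
  (forall m n, m < 0 -> A m n = 0) -> Subst A = Subst02 A.
Proof.
move=> A0; apply: funext => k; apply: funext => i.
rewrite /Subst (isum_shift _ k); apply: eq_isum => j.
have -> : i + k - (j + k) = i - j by lia.
rewrite addrC; have [kj|] := ltP (k + j) 0; first by rewrite A0 // !scaler0.
case E : (k + j) => [n|//] _; congr (_ *: _); rewrite -gb_sym //.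
by congr gb; lia.
Qed.

(** The power x1^l is chosen to remove the negative powers of x1 from p(x1,x2) a(x1)b(x2)w. Then x1
    = x0 + x2 may be expanded in either order with the same result, and one of the two orders is the
    value given by Y_E. The bound, and hence [l], may depend on [w]. *)
Lemma Subst_weak_assoc (W : lmodType F) (a b : calE W) w p :
    p != 0 -> pair_cond p a b ->
  exists l : nat,
    pact (s1 \+ s2) s2 ('X^l * p) (Subst02 (pair_prod a b w)) =
    pact (s1 \+ s2) s2 ('X^l * p) (fun k i => YE a b k w i).
Proof.
move=> p0 hp; pose A := pair_prod a b w.
have tA : truncated2 (pact s1 s2 p A) by rewrite -pmulE; exact: hp.
have [N A0] := tA; exists `|N|%N.
have sA : trunc_snd A by have [M h] := pair_prod_truncr a b w; exists M.
have [_ <-] := pact_Subst02 ('X^`|N| * p) sA.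
rewrite pactM // -Subst_Subst02; last first.
  by move=> m n m0; rewrite pactXn iter_shift A0 //; lia.
have [_ ->] := pact_Subst charF 'X^`|N| tA.
rewrite pactM //.
congr (pact _ _ _); apply: (phi_uniq charF (phi_trunc tA)).
apply: (@pact_rel _ _ _ (@phi F W)).
- exact: phi_linear.
- exact: phi_s1.
- exact: phi_s2.
- by apply: phi_YE; exists p.
Qed.

End SubstitutionX0X2.

(** * Products of three operators and iterated substitutions *)

Section ThreeVariables.
Variables (F : fieldType) (W : lmodType F).
Hypothesis charF : [pchar F] =i pred0.
Implicit Types (A B : int -> int -> W) (p : {poly {poly F}}).
Local Notation series3 := (int -> int -> int -> W).
Implicit Types (G H T : series3).

Definition s3 G : series3 := under (@s2 F W) G.

HB.instance Definition _ := GRing.Linear.copy s3 (under (@s2 F W)).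

Definition pact3 (V : lmodType F) (O1 O2 O3 : V -> V) p (v : V) : V :=
  pact O1 O2 p (pact O1 O3 p (pact O2 O3 p v)).

Lemma pact3_rel (V V' : lmodType F) (Rel : V -> V' -> Prop) O1 O2 O3 O1' O2' O3'
    p v v' :
    linear_rel Rel -> (forall u u', Rel u u' -> Rel (O1 u) (O1' u')) ->
    (forall u u', Rel u u' -> Rel (O2 u) (O2' u')) ->
    (forall u u', Rel u u' -> Rel (O3 u) (O3' u')) -> Rel v v' ->
  Rel (pact3 O1 O2 O3 p v) (pact3 O1' O2' O3' p v').
Proof. by move=> RP R1 R2 R3 Rv; do !apply: pact_rel => //. Qed.

Definition truncated3 T : Prop :=
  exists N : int, forall m n i, m < N \/ n < N \/ i < N -> T m n i = 0.

Definition triple_prod (a b c : calE W) (w : W) : series3 :=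
  fun m n i => a (b (c w i) n) m.

Definition Subst12 T : series3 := fun k n i => Subst (fun m n => T m n i) k n.
Definition Subst13 T : series3 := fun k n i => Subst (fun m i => T m n i) k i.
Definition Subst23 T : series3 := fun m => Subst (T m).

(* Here the two indices that are not fixed play the roles of (z,x) and (x0,x). *)
Definition phi12 G H := forall i, phi (fun m n => G m n i) (fun k n => H k n i).
Definition phi13 G H := forall n, phi (fun m i => G m n i) (fun k i => H k n i).
Definition phi23 G H := forall m, phi (G m) (H m).

Lemma phi12_linear : linear_rel phi12.
Proof.
have [P0 PP] := phi_linear W charF.
by split=> [i|c G H G' H' GG' HH' i]; [exact: P0 | exact: PP (GG' i) (HH' i)].
Qed.

Lemma phi13_linear : linear_rel phi13.
Proof.
have [P0 PP] := phi_linear W charF.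
by split=> [n|c G H G' H' GG' HH' n]; [exact: P0 | exact: PP (GG' n) (HH' n)].
Qed.

Lemma phi23_linear : linear_rel phi23.
Proof.
have [P0 PP] := phi_linear W charF.
by split=> [m|c G H G' H' GG' HH' m]; [exact: P0 | exact: PP (GG' m) (HH' m)].
Qed.

Lemma phi12_pact3 G H p : phi12 G H ->
  phi12 (pact3 s1 s2 s3 p G) (pact3 (s1 \+ s2) s2 s3 p H).
Proof.
apply: pact3_rel => [|u u' h i|u u' h i|u u' h i]; first exact: phi12_linear.
- exact: phi_s1 (h i).
- exact: phi_s2 (h i).
- exact: h.
Qed.

Lemma phi23_pact3 G H p : phi23 G H ->
  phi23 (pact3 s1 s2 s3 p G) (pact3 s1 (s2 \+ s3) s3 p H).
Proof.
apply: pact3_rel => [|u u' h m|u u' h m|u u' h m]; first exact: phi23_linear.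
- exact: h.
- exact: phi_s1 (h m).
- exact: phi_s2 (h m).
Qed.

Lemma phi13_s13 G H : phi13 G H -> phi13 (s1 G) ((s1 \+ s3) H).
Proof. by move=> h n; exact: phi_s1 (h n). Qed.

Lemma phi13_s3 G H : phi13 G H -> phi13 (s3 G) (s3 H).
Proof. by move=> h n; exact: phi_s2 (h n). Qed.

Lemma phi13_s2 G H : phi13 G H -> phi13 (s2 G) (s2 H).
Proof. by move=> h n; exact: h (n - 1). Qed.

Lemma phi13_pact3 G H p : phi13 G H ->
  phi13 (pact3 s1 (s2 \+ s3) s3 p G) (pact3 (s1 \+ s3) (s2 \+ s3) s3 p H).
Proof.
apply: pact3_rel.
- exact: phi13_linear.
- exact: phi13_s13.
- move=> u u' h n; have [_ PP] := phi_linear W charF.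
  by have := PP 1 _ _ _ _ (phi13_s2 h n) (phi13_s3 h n); rewrite !scale1r.
- exact: phi13_s3.
Qed.

Lemma phi23_pact3_s12 G H p : phi23 G H ->
  phi23 (pact3 (s1 \+ s2) s2 s3 p G) (pact3 (s1 \+ (s2 \+ s3)) (s2 \+ s3) s3 p H).
Proof.
have h2 u u' : phi23 u u' -> phi23 (s2 u) ((s2 \+ s3) u').
  by move=> h m; exact: phi_s1 (h m).
apply: pact3_rel => // [|u u' h m|u u' h m]; first exact: phi23_linear.
  have [_ PP] := phi_linear W charF.
  by have := PP 1 _ _ _ _ (h (m - 1)) (h2 _ _ h m); rewrite !scale1r.
exact: phi_s2 (h m).
Qed.

(** Used with [coefE a m]: the value of b(y)c(x)w is carried through a(z), one power of z at a
    time. *)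
Lemma phi_map (L : {linear W -> W}) A B : phi A B ->
  phi (fun m n => L (A m n)) (fun k i => L (B k i)).
Proof.
have tL C : truncated2 C -> truncated2 (fun m n => L (C m n)).
  by move=> [N C0]; exists N => m n mn; rewrite C0 ?linear0.
move=> [[[N B0] Bk] [p p0 [h1 h2]]]; split.
  split=> [|k]; first by exists N => k i kN; rewrite B0 ?linear0.
  by have [M BM] := Bk k; exists M => i iM; rewrite BM ?linear0.
exists p => //.
rewrite -[fun m n => L (A m n)]/(under (under L) A) -[fun m n => L (B m n)]/(under (under L) B).
rewrite -(@pact_comm F _ _ s1 s2 _ _ (under (under L))) //.
rewrite -(@pact_comm F _ _ (s1 \+ s2) s2 _ _ (under (under L))) //; last first.
  move=> u; exact: linearD.
split; first exact: tL.
rewrite h2; apply: funext => k; apply: funext => i.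
rewrite -[LHS]/(L (Subst (pact s1 s2 p A) k i)) /Subst isum_linear; last exact: Subst_fin.
by apply: eq_isum => m; rewrite linearZ.
Qed.

Definition coefE (a : calE W) (m : int) (u : W) : W := a u m.

Lemma coefE_linear a m : linear (coefE a m).
Proof. by move=> c u v; rewrite /coefE linearP. Qed.

HB.instance Definition _ a m :=
  GRing.isLinear.Build F W W *:%R (coefE a m) (@coefE_linear a m).

(** Under x1 = x0 + x2 the point z = x + x1 becomes z = x + x2 + x0, while y = x + x2 stays. *)
Lemma pact3_Subst02 H p : trunc_snd H ->
  Subst02 (pact3 (s1 \+ s3) (s2 \+ s3) s3 p H) =
  pact3 (s1 \+ (s2 \+ s3)) (s2 \+ s3) s3 p (Subst02 H).
Proof.
move=> hH; pose Rel G G' := trunc_snd G /\ Subst02 G = G'.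
have RP : linear_rel Rel := Subst02_rel (int -> W).
have RD u u' v v' : Rel u u' -> Rel v v' -> Rel (u + v) (u' + v').
  by move=> Ru Rv; have := RP.2 1 _ _ _ _ Ru Rv; rewrite !scale1r.
have R1 u u' : Rel u u' -> Rel (s1 u) (s1 u' + s2 u').
  by move=> [hu <-]; split; [exact: trunc_snd_s1 | exact: (Subst02_s1 charF)].
have R2 u u' : Rel u u' -> Rel (s2 u) (s2 u').
  by move=> [hu <-]; split; [exact: trunc_snd_s2 | exact: Subst02_s2].
have R3 u u' : Rel u u' -> Rel (s3 u) (s3 u').
  move=> [hu <-]; split.
    by have [N u0] := hu; exists N => m n nN; rewrite /s3 /under /s2 /under u0.
  apply: funext => m; apply: funext => n.
  rewrite -[RHS]/(@shift F W (Subst02 u m n)) /Subst02 isum_linear; last exact: Subst02_fin.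
  by apply: eq_isum => j; rewrite linearZ.
suff [] : Rel (pact3 (s1 \+ s3) (s2 \+ s3) s3 p H)
  (pact3 (s1 \+ (s2 \+ s3)) (s2 \+ s3) s3 p (Subst02 H)) by [].
apply: pact3_rel => // u u' Ru; last exact: (RD _ _ _ _ (R2 _ _ Ru) (R3 _ _ Ru)).
have := RD _ _ _ _ (R1 _ _ Ru) (R3 _ _ Ru).
by rewrite -addrA.
Qed.

(* T(x + x1, x + x2, x) at x1 = x0 + x2 is T(y + x0, y, x) at y = x + x2. *)
Lemma Subst02_Subst13 T : truncated3 T ->
  Subst02 (Subst13 (Subst23 T)) = Subst23 (Subst12 T).
Proof.
move=> [N T0]; apply: funext => m; apply: funext => n; apply: funext => i.
(* Substitution preserves the total exponent i + m + n, so the third exponent of T is determined by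
   the first two. *)
pose h a b := T a b (i + m + n - a - b).
pose E := i + m + n - N - N + 1.
have h0 a b : a < N \/ b < N \/ E <= a \/ E <= b -> h a b = 0.
  move=> hab; apply: T0; have [|Na] := ltP a N; first by left.
  by right; have [|Nb] := ltP b N; [left | right; rewrite /E in hab; lia].
transitivity (\isum_j \isum_a \isum_b
    ((gb F (a - m) j * gb F b (n - j)) *: (gb F a m *: h a b))).
  rewrite -[LHS]/((\isum_j (gb F (m + j) j *:
    (Subst13 (Subst23 T) (m + j) (n - j)))) i).
  rewrite (@raddf_isum _ _ (fun u : int -> W => u i)) //; last first.
    apply: (@Subst02_fin _ _ (Subst13 (Subst23 T))); exists 0 => k l l0.
    apply: funext => i'; apply: isum0 => a; rewrite [Subst23 _ _ _ _]isum0 ?scaler0 //.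
    by move=> b; rewrite gb_neg ?scale0r.
  apply: eq_isum => j.
  have F1 k l i' : fin_supp (fun a => gb F a k *: Subst23 T a l (i' + k - a)).
    apply: (@fin_supp_bound _ _ N (i' + k + l - N - N + 1)) => a aN.
      by rewrite [Subst23 _ _ _ _]isum0 ?scaler0 // => b; rewrite T0 ?scaler0 //; left.
    rewrite [Subst23 _ _ _ _]isum0 ?scaler0 // => b; rewrite T0 ?scaler0 //.
    by right; have [|Nb] := ltP b N; [left | right; lia].
  rewrite -[LHS]/(gb F (m + j) j *: (\isum_a (gb F a (m + j) *:
    Subst23 T a (n - j) (i + (m + j) - a)))) isumZ //.
  apply: eq_isum => a.
  have F2 : fin_supp (fun b => gb F b (n - j) *: T a b (i + (m + j) - a + (n - j) - b)).
    by apply: Subst_fin; exists N => b i' hb; apply: T0; right.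
  rewrite -[Subst23 T _ _ _]/(\isum_b (gb F b (n - j) *:
    T a b (i + (m + j) - a + (n - j) - b))) scalerA isumZ //.
  apply: eq_isum => b; rewrite !scalerA /h.
  have -> : i + (m + j) - a + (n - j) - b = i + m + n - a - b by lia.
  (* The trinomial identity leaves (a choose m)(a - m choose j), so that [j] occurs only in a
     product to which Vandermonde's identity applies. *)
  congr (_ *: _); have := gb_trinomial charF a (m + j) j; rewrite addrK => Etri.
  by rewrite [gb F (m + j) j * _]mulrC Etri; ring.
transitivity (\isum_a \isum_b (gb F (a + b - m) n *: (gb F a m *: h a b))).
  rewrite (@exchange_isum_bound _ _ 0 (n + 1) N E); first last.
  - by move=> j a ha; apply: isum0 => b; rewrite h0 ?scaler0 //; tauto.
  - by move=> j a ha; apply: isum0 => b; rewrite h0 ?scaler0 //; tauto.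
  - move=> j a ha; apply: isum0 => b; rewrite [gb F b _]gb_neg ?mulr0 ?scale0r //; lia.
  - by move=> j a ha; apply: isum0 => b; rewrite gb_neg ?mul0r ?scale0r.
  apply: eq_isum => a; rewrite (@exchange_isum_bound _ _ 0 (n + 1) N E); first last.
  - by move=> j b hb; rewrite h0 ?scaler0 //; tauto.
  - by move=> j b hb; rewrite h0 ?scaler0 //; tauto.
  - move=> j b hb; rewrite [gb F b _]gb_neg ?mulr0 ?scale0r //; lia.
  - by move=> j b hb; rewrite gb_neg ?mul0r ?scale0r.
  apply: eq_isum => b.
  have -> : a + b - m = (a - m) + b by lia.
  rewrite gb_vandermonde //; apply: esym.
  apply: (@raddf_isum _ _ (fun c => c *: (gb F a m *: h a b))).
  - exact: scale0r.
  - by move=> x y; exact: scalerDl.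
  apply: (@fin_supp_bound _ _ 0 (n + 1)) => j hj; first by rewrite gb_neg ?mul0r.
  by rewrite [gb F b _]gb_neg ?mulr0 //; lia.
(* The new [b] is the exponent of y after z = y + x0, so the sum over [a] becomes a coefficient of
   [Subst12 T]. *)
transitivity (\isum_a \isum_b (gb F b n *: (gb F a m *: h a (b + m - a)))).
  apply: eq_isum => a; rewrite (isum_shift _ (m - a)) /=; apply: eq_isum => b.
  by congr (gb F _ _ *: (_ *: h _ _)); lia.
rewrite (@exchange_isum_bound _ _ N E (N + N - m) (i + n - N + 1)); first last.
- move=> a b hb; rewrite /h T0 ?scaler0 //; right; right; lia.
- move=> a b hb; have [aN|Na] := ltP a N; first by rewrite h0 ?scaler0 //; tauto.
  by rewrite h0 ?scaler0 //; lia.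
- by move=> a b hb; rewrite h0 ?scaler0 //; tauto.
- by move=> a b hb; rewrite h0 ?scaler0 //; tauto.
apply: eq_isum => b.
rewrite -[Subst12 T m _ _]/(\isum_a (gb F a m *: T a (b + m - a) (i + n - b))).
rewrite isumZ.
  by apply: eq_isum => a; rewrite /h; congr (_ *: (_ *: T _ _ _)); lia.
apply: (@fin_supp_bound _ _ N (b + m - N + 1)) => a ha; rewrite T0 ?scaler0 //.
  by left.
by right; left; lia.
Qed.

Variables (a b c : calE W).
Hypotheses (hab : quasi_pair a b) (hbc : quasi_pair b c).
Hypothesis habc : forall n, quasi_pair a (YE b c n).
Hypothesis habc' : forall n, quasi_pair (YE a b n) c.
Variables (p : {poly {poly F}}) (w : W).

Let T := pact3 s1 s2 s3 p (triple_prod a b c w).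
Hypothesis hT : truncated3 T.

Let T12 i : truncated2 (fun m n => T m n i).
Proof. by have [N T0] := hT; exists N => m n mn; rewrite T0 //; lia. Qed.

Let T23 m : truncated2 (T m).
Proof. by have [N T0] := hT; exists N => n i ni; rewrite T0 //; lia. Qed.

Let S13 n : truncated2 (fun m i => Subst23 T m n i).
Proof.
have [N T0] := hT; exists (Num.min N (N + N - n)) => m i mi.
apply: isum0 => j; rewrite T0 ?scaler0 //.
have [|Nm] := ltP m N; first by left.
by right; have [|Nj] := ltP j N; [left | right; lia].
Qed.

Let R23 k : truncated2 (Subst12 T k).
Proof.
have [N T0] := hT; exists (Num.min N (N + N - k)) => n i ni.
apply: isum0 => j; rewrite T0 ?scaler0 //.
have [|Ni] := ltP i N; first by right; right.
by have [|Nj] := ltP j N; [left | right; left; lia].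
Qed.

Let H : series3 := fun k n i => YE a (YE b c n) k w i.
Let B : series3 := fun k n i => YE (YE a b k) c n w i.

(** Two stages: y = x + x2 evaluates b(y)c(x) behind a(z), then z = x + x1 evaluates a(z) against
    each coefficient obtained. At each stage uniqueness identifies the value with a plain
    substitution, as T is truncated. *)
Lemma pact3_YE_right :
  pact3 (s1 \+ s3) (s2 \+ s3) s3 p H = Subst13 (Subst23 T).
Proof.
pose G : series3 := fun m n i => a (YE b c n w i) m.
have E1 : pact3 s1 (s2 \+ s3) s3 p G = Subst23 T.
  have h : phi23 (triple_prod a b c w) G.
    by move=> m; exact: (phi_map (coefE a m) (phi_YE w hbc)).
  apply: funext => m; apply: (phi_uniq charF (A := T m)); last exact: phi_trunc.
  exact: (phi23_pact3 p h m).
have h : phi13 G H by move=> n; exact: phi_YE (habc n).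
have := phi13_pact3 p h; rewrite E1 => h'.
apply: funext => k; apply: funext => n; apply: funext => i.
have := phi_uniq charF (h' n) (phi_trunc (S13 n)).
by move=> /(congr1 (fun A => A k i)).
Qed.

(** Here z = y + x0 is substituted before y = x + x2; the second stage also moves the y contained in
    z, which produces x0 + x2 + x. *)
Lemma pact3_YE_left :
  pact3 (s1 \+ (s2 \+ s3)) (s2 \+ s3) s3 p B = Subst23 (Subst12 T).
Proof.
pose G : series3 := fun m n i => YE a b m (c w i) n.
have E1 : pact3 (s1 \+ s2) s2 s3 p G = Subst12 T.
  have h : phi12 (triple_prod a b c w) G by move=> i; exact: phi_YE.
  have h' := phi12_pact3 p h.
  apply: funext => k; apply: funext => n; apply: funext => i.
  have := phi_uniq charF (h' i) (phi_trunc (T12 i)).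
  by move=> /(congr1 (fun A => A k n)).
have h : phi23 G B by move=> m; exact: phi_YE (habc' m).
have := phi23_pact3_s12 p h; rewrite E1 => h'.
apply: funext => k.
apply: (phi_uniq charF (A := Subst12 T k)); first exact: h'.
exact: phi_trunc.
Qed.

Lemma trunc_snd_YE : trunc_snd H.
Proof.
have [N h] := YE_trunc b c; exists N => k n nN; apply: funext => i.
rewrite /H h // -[RHS]/((0 : calE W) w i).
(* Quasi compatibility of [a] with 0 is read off from an index at which [YE b c] vanishes. *)
have : phi (pair_prod a 0 w) (fun k i => YE a 0 k w i).
  by rewrite -(h (N - 1)) ?habc //; [apply: phi_YE; exact: habc | lia].
have -> : pair_prod a 0 w = 0.
  by apply: funext => m; apply: funext => j; rewrite /pair_prod linear0.
move=> h'; have := phi_uniq charF h' (phi_linear W charF).1.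
by move=> /(congr1 (fun A => A k i)).
Qed.

End ThreeVariables.

Arguments s3 {F W}.

(** Induction on j and, for each j, on i, from a bound on i that may depend on j. This is the shape
    of the truncation of a series in ((x0))((x2)). *)
Lemma lex_ind (P : int -> int -> Prop) :
    (exists N : int, forall i j, j < N -> P i j) ->
    (forall j, exists M : int, forall i, i < M -> P i j) ->
    (forall i j, (forall i' j', i' <= i -> j' <= j -> i' < i \/ j' < j -> P i' j') ->
       P i j) ->
  forall i j, P i j.
Proof.
move=> [N PN] PM step.
have main (d : nat) : forall j : int, j < N + d%:Z -> forall i, P i j.
  elim: d => [|d IHd] j jd i; first by apply: PN; lia.
  have [M PMj] := PM j.
  have inner (e : nat) : forall i : int, i < M + e%:Z -> P i j.
    elim: e => [|e IHe] i0 ie; first by apply: PMj; lia.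
    apply: step => i' j' ii jj [i'i|j'j]; last by apply: IHd; lia.
    have [j'j|jj'] := ltP j' j; first by apply: IHd; lia.
    have -> : j' = j by lia.
    by apply: IHe; lia.
  by apply: (inner `|i - M|%N.+1); lia.
by move=> i j; apply: (main `|j - N|%N.+1); lia.
Qed.

Lemma iter_comm (T : Type) (f g : T -> T) k l x :
  (forall y, f (g y) = g (f y)) -> iter k f (iter l g x) = iter l g (iter k f x).
Proof.
move=> fg; elim: k => //= k ->; elim: l => //= l IH.
by rewrite fg IH.
Qed.

(** * Cancellation of factors by lowest terms *)

Section Cancellation.
Variables (F : fieldType) (W : lmodType F).
Hypothesis charF : [pchar F] =i pred0.
Implicit Types (p q : {poly {poly F}}).
Local Notation series3 := (int -> int -> int -> W).
Implicit Types (D G H : series3).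

Definition below (i j : int) D : Prop :=
  forall i' j', i' <= i -> j' <= j -> i' < i \/ j' < j -> D i' j' = 0.

(* Operators acting on the lowest terms in (x0,x2) of a series through an injective
   operator on W((x)). *)
Definition triangular (U : series3 -> series3) : Prop :=
  exists2 R : (int -> W) -> int -> W,
    (forall v, truncated v -> truncated (R v) /\ (R v = 0 <-> v = 0)) &
    forall D i j, below i j D -> U D i j = R (D i j).

Lemma triangular_comp U U' :
  triangular U -> triangular U' -> triangular (U \o U').
Proof.
move=> [R R0 UR] [R' R0' UR']; exists (R \o R') => [v tv|D i j Dij] /=.
  have [tR' R'v] := R0' v tv; have [tR Rv] := R0 _ tR'.
  by split=> //; rewrite Rv.
rewrite UR ?UR' // => i' j' ii jj ij; rewrite UR'.
  by rewrite Dij //; apply: (R0' 0 _).2.2 => //; exists 0.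
by move=> i2 j2 i2i j2j ij2; apply: Dij; lia.
Qed.

(** The inductive step: below (i, j) nothing is left of [D], so [U] acts there through the injective
    [R]. The set [X] is closed downwards because the vanishing of [U D] is at first known only where
    some exponent is negative. *)
Lemma triangular_lex (X : int -> int -> Prop) U D :
    triangular U -> (forall i j, truncated (D i j)) ->
    (forall i j i' j', X i j -> i' <= i -> j' <= j -> X i' j') ->
    (forall i j, X i j -> U D i j = 0) ->
  forall i j,
    (forall i' j', i' <= i -> j' <= j -> i' < i \/ j' < j -> X i' j' -> D i' j' = 0) ->
    X i j -> D i j = 0.
Proof.
move=> [R R0 UR] tD Xdown UX i j IH Xij.
apply/(R0 _ (tD i j)).2; rewrite -UR; first exact: UX.
by move=> i' j' ii jj ij; apply: IH => //; exact: Xdown Xij ii jj.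
Qed.

Lemma triangular_eq0 (X : int -> int -> Prop) U D :
    triangular U -> (forall i j, truncated (D i j)) ->
    (forall i j i' j', X i j -> i' <= i -> j' <= j -> X i' j') ->
    (forall i j, X i j -> U D i j = 0) ->
    (exists N : int, forall i j, j < N -> D i j = 0) ->
    (forall j, exists M : int, forall i, i < M -> D i j = 0) ->
  forall i j, X i j -> D i j = 0.
Proof.
move=> tU tD Xd UX [N DN] DM; apply: lex_ind.
- by exists N => i j jN _; exact: DN.
- by move=> j; have [M DMj] := DM j; exists M => i iM _; exact: DMj.
- by move=> i j IH; apply: (triangular_lex tU tD Xd UX).
Qed.

(** The counterpart for ((x2))((x0)): the order of the two inductions follows the order of the
    truncations. *)
Lemma triangular_eq0_swap (X : int -> int -> Prop) U D :
    triangular U -> (forall i j, truncated (D i j)) ->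
    (forall i j i' j', X i j -> i' <= i -> j' <= j -> X i' j') ->
    (forall i j, X i j -> U D i j = 0) ->
    (exists N : int, forall i j, i < N -> D i j = 0) ->
    (forall i, exists M : int, forall j, j < M -> D i j = 0) ->
  forall i j, X i j -> D i j = 0.
Proof.
move=> tU tD Xd UX [N DN] DM i j.
move: i j; suff H : forall j i, X i j -> D i j = 0 by move=> i j; exact: H.
apply: (lex_ind (P := fun j i => X i j -> D i j = 0)).
- by exists N => j i iN _; exact: DN.
- by move=> i; have [M DMi] := DM i; exists M => j jM _; exact: DMi.
- move=> j i IH; apply: (triangular_lex tU tD Xd UX) => i' j' ii jj ij.
  by apply: IH => //; tauto.
Qed.

Lemma triangular_pact O1 O2 q : q`_0 != 0 ->
    (forall i j D, below i j D -> below i j (O1 D) /\ O1 D i j = 0) ->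
    (forall i j D, below i j D -> below i j (O2 D) /\ O2 D i j = shift (D i j)) ->
  triangular (pact O1 O2 q).
Proof.
move=> q0 h1 h2; pose R := pact (fun _ : int -> W => 0) shift q.
have RE v : R v = \sum_(t < size q`_0) q`_0`_t *: iter t shift v.
  have : (0 < size q)%N by rewrite lt0n size_poly_eq0; apply: contraNneq q0 => ->; rewrite coef0.
  rewrite /R /pact; case: (size q) => // n _.
  rewrite big_ord_recl [X in _ + X]big1 ?addr0 // => s _.
  by rewrite big1 // => t _; rewrite /= scaler0.
have RL (v : laurent W) : R v = lscale (lpoly q`_0) v.
  apply: funext => n; rewrite lscale_lpoly RE fct_sumE; apply: eq_bigr => t _.
  by rewrite -[LHS]/(_ *: iter t shift v n) iter_shift.
exists R => [v tv|D i j Dij].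
  rewrite -[v]/(lcoef (mkLaurent tv)); move: (mkLaurent tv) => {tv}v; rewrite RL.
  split; first exact: laurent_trunc.
  have E (u : laurent W) : (u = 0 :> (int -> W)) <-> u = 0.
    by split=> [u0|-> //]; apply: laurentP => n; rewrite u0.
  rewrite !E; split=> [Rv0|->]; last exact: lscaler0.
  have l0 : lpoly q`_0 != 0.
    apply: contraNneq q0 => l0; apply/eqP/polyP => t; rewrite coef0.
    exact: (congr1 (fun f : laurent F => f t) l0).
  by rewrite -[v]lscale1 -(mulVf l0) lscaleM Rv0 lscaler0.
pose Rel D v := below i j D /\ D i j = v.
suff [] : Rel (pact O1 O2 q D) (R (D i j)) by [].
apply: (@pact_rel _ _ _ Rel) => //.
- split; first by split.
  move=> c D1 D2 _ _ [b1 <-] [b2 <-]; split=> // i' j' ii jj ij.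
  by rewrite -[LHS]/(c *: D1 i' j' + D2 i' j') b1 // b2 // scaler0 addr0.
- by move=> D1 v [b1 _]; exact: h1.
- by move=> D1 v [b1 <-]; exact: h2.
Qed.

Lemma below_s1 i j D : below i j D -> below i j (s1 D) /\ s1 D i j = 0.
Proof.
move=> Dij; split; last by apply: Dij; lia.
by move=> i' j' ii jj ij; apply: Dij; lia.
Qed.

Lemma below_s2 i j D : below i j D -> below i j (s2 D) /\ s2 D i j = 0.
Proof.
move=> Dij; split; last by apply: Dij; lia.
by move=> i' j' ii jj ij; apply: Dij; lia.
Qed.

Lemma below_s3 i j D : below i j D -> below i j (s3 D) /\ s3 D i j = shift (D i j).
Proof.
move=> Dij; split=> // i' j' ii jj ij.
by apply: funext => n; rewrite /s3 /under /s2 /under Dij.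
Qed.

Lemma below_s12 i j D : below i j D ->
  below i j ((s1 \+ s2) D) /\ (s1 \+ s2) D i j = 0.
Proof.
move=> Dij; have [b1 e1] := below_s1 Dij; have [b2 e2] := below_s2 Dij.
split; last by rewrite -[LHS]/(s1 D i j + s2 D i j) e1 e2 addr0.
move=> i' j' ii jj ij; rewrite -[LHS]/(s1 D i' j' + s2 D i' j') b1 // b2 //.
by rewrite addr0.
Qed.

Lemma below_s23 i j D : below i j D ->
  below i j ((s2 \+ s3) D) /\ (s2 \+ s3) D i j = shift (D i j).
Proof.
move=> Dij; have [b2 e2] := below_s2 Dij; have [b3 e3] := below_s3 Dij.
split; last by rewrite -[LHS]/(s2 D i j + s3 D i j) e2 e3 add0r.
move=> i' j' ii jj ij; rewrite -[LHS]/(s2 D i' j' + s3 D i' j') b2 // b3 //.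
by rewrite addr0.
Qed.

Lemma poly_val0 p : p != 0 ->
  exists l q, q`_0 != 0 /\ p \Po ('X + 'Y) = 'X^l * q.
Proof.
move=> p0; have : p \Po ('X + 'Y) != 0 by rewrite comp_poly_eq0 // size_XaddC.
move: (p \Po _) => r; elim/poly_ind: r => [|r c IH] rc; first by rewrite eqxx in rc.
have [c0|c0] := eqVneq c 0; last first.
  exists 0%N, (r * 'X + c%:P); rewrite expr0 mul1r; split=> //.
  by rewrite coefD coefMX coefC /= add0r.
have r0 : r != 0 by apply: contraNneq rc => ->; rewrite c0 mul0r addr0.
have [l [q [q0 ->]]] := IH r0; exists l.+1, q; split=> //.
by rewrite c0 addr0 exprSr -!mulrA [q * _]mulrC.
Qed.

Lemma pact_iter (V : lmodType F) (O1 O2 : V -> V) (L : {linear V -> V}) q l v :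
    (forall u, L (O1 u) = O1 (L u)) -> (forall u, L (O2 u) = O2 (L u)) ->
  pact O1 O2 q (iter l L v) = iter l L (pact O1 O2 q v).
Proof.
by move=> h1 h2; elim: l => //= l IH; rewrite -IH; apply: esym; exact: pact_comm.
Qed.

(** The three powers come from the differences of the points: z - y = x0, z - x = x0 + x2 and y - x
    = x2. *)
Lemma pact3_factor p : p != 0 ->
  exists l U, [/\ triangular U, forall D G, U (D - G) = U D - U G &
    forall D, pact3 (s1 \+ (s2 \+ s3)) (s2 \+ s3) s3 p D =
      U (iter l s1 (iter l (s1 \+ s2) (iter l s2 D)))].
Proof.
move=> p0; have [l [q [q0 pq]]] := poly_val0 p0.
pose U1 := pact s1 (@s2 F (int -> W) \+ s3) q; pose U2 := pact (s1 \+ @s2 F (int -> W)) s3 q.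
pose U3 := pact (@s2 F (int -> W)) s3 q.
exists l, (U1 \o (U2 \o U3)); split.
- apply: triangular_comp; last apply: triangular_comp.
  + by apply: triangular_pact => //; [exact: below_s1 | exact: below_s23].
  + by apply: triangular_pact => //; [exact: below_s12 | exact: below_s3].
  + by apply: triangular_pact => //; [exact: below_s2 | exact: below_s3].
- have L (O1 O2 : {linear series3 -> series3}) D G :
    pact O1 O2 q (D - G) = pact O1 O2 q D - pact O1 O2 q G.
    have := @pact_linear F _ O1 O2 q (-1) G D.
    by rewrite !scaleN1r ![- _ + _]addrC.
  by move=> D G; rewrite /U1 /U2 /U3 /= !L.
move=> D; rewrite /pact3.
have -> E : pact (s1 \+ (s2 \+ s3)) (s2 \+ s3) p E = iter l s1 (U1 E).
  by rewrite -pact_compD // pq pactM // pactXn.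
have -> E : pact (s1 \+ (@s2 F (int -> W) \+ s3)) s3 p E = iter l (s1 \+ s2) (U2 E).
  have -> : s1 \+ (@s2 F (int -> W) \+ s3) = (s1 \+ s2) \+ s3.
    by apply: funext => G; exact: addrA.
  by rewrite -pact_compD // pq pactM // pactXn.
have -> E : pact (s2 \+ s3) s3 p E = iter l s2 (U3 E).
  by rewrite -pact_compD // pq pactM // pactXn.
rewrite /comp /U1 /U2 /U3.
have C23 (u : series3) : (s1 \+ s2) ((s2 \+ s3) u) = (s2 \+ s3) ((s1 \+ s2) u).
  by apply: funext => m; apply: funext => n; apply: funext => i; exact: addrACA.
rewrite !pact_iter //.
all: by move=> u; exact: C23.
Qed.

(* The series in W((x))((x0))((x2)) and in W((x))((x2))((x0)), respectively. *)
Definition trunc02 D : Prop :=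
  [/\ forall i j, truncated (D i j), exists N : int, forall i j, j < N -> D i j = 0 &
      forall j, exists M : int, forall i, i < M -> D i j = 0].

Definition trunc20 D : Prop :=
  [/\ forall i j, truncated (D i j), exists N : int, forall i j, i < N -> D i j = 0 &
      forall i, exists M : int, forall j, j < M -> D i j = 0].

Lemma trunc02_s1 D : trunc02 D -> trunc02 (s1 D).
Proof.
move=> [tD [N DN] DM]; split=> [i j||j]; first exact: tD.
  by exists N => i j jN; exact: DN.
by have [M DMj] := DM j; exists M => i iM; apply: DMj; lia.
Qed.

Lemma trunc02_s2 D : trunc02 D -> trunc02 (s2 D).
Proof.
move=> [tD [N DN] DM]; split=> [i j||j]; first exact: tD.
  by exists N => i j jN; apply: DN; lia.
by have [M DMj] := DM (j - 1); exists M => i iM; exact: DMj.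
Qed.

Lemma trunc02D D G : trunc02 D -> trunc02 G -> trunc02 (D + G).
Proof.
move=> [tD [N DN] DM] [tG [N' GN] GM]; split=> [i j||j].
- by rewrite -[D]scale1r; exact: truncatedP.
- exists (Num.min N N') => i j; rewrite lt_min => /andP[jN jN'].
  by rewrite -[LHS]/(D i j + G i j) DN // GN // addr0.
- have [M DMj] := DM j; have [M' GMj] := GM j.
  exists (Num.min M M') => i; rewrite lt_min => /andP[jN jN'].
  by rewrite -[LHS]/(D i j + G i j) DMj // GMj // addr0.
Qed.

Lemma trunc20_s1 D : trunc20 D -> trunc20 (s1 D).
Proof.
move=> [tD [N DN] DM]; split=> [i j||i]; first exact: tD.
  by exists N => i j iN; apply: DN; lia.
by have [M DMj] := DM (i - 1); exists M => j jM; exact: DMj.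
Qed.

Lemma trunc20_s2 D : trunc20 D -> trunc20 (s2 D).
Proof.
move=> [tD [N DN] DM]; split=> [i j||i]; first exact: tD.
  by exists N => i j iN; exact: DN.
by have [M DMj] := DM i; exists M => j jM; apply: DMj; lia.
Qed.

Lemma trunc20D D G : trunc20 D -> trunc20 G -> trunc20 (D + G).
Proof.
move=> [tD [N DN] DM] [tG [N' GN] GM]; split=> [i j||j].
- by rewrite -[D]scale1r; exact: truncatedP.
- exists (Num.min N N') => i j; rewrite lt_min => /andP[jN jN'].
  by rewrite -[LHS]/(D i j + G i j) DN // GN // addr0.
- have [M DMj] := DM j; have [M' GMj] := GM j.
  exists (Num.min M M') => i; rewrite lt_min => /andP[jN jN'].
  by rewrite -[LHS]/(D j i + G j i) DMj // GMj // addr0.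
Qed.

Lemma trunc02_Subst02 H :
    (forall k n, truncated (H k n)) -> trunc_snd H ->
    (forall n, exists M : int, forall k, k < M -> H k n = 0) ->
  trunc02 (Subst02 H).
Proof.
move=> tH hH HM; have [N HN] := hH.
(* Only the exponents between [N] and [n] contribute, so finitely many bounds have a common
   minimum. *)
have HMle n : exists M : int, forall k n', n' <= n -> k < M -> H k n' = 0.
  suff h (d : nat) : exists M : int, forall k n', n' < N + d%:Z -> k < M -> H k n' = 0.
    have [M h'] := h `|n - N|%N.+1; exists M => k n' nn'; apply: h'; lia.
  elim: d => [|d [M IH]]; first by exists 0 => k n' n'N _; apply: HN; lia.
  have [M' h] := HM (N + d%:Z); exists (Num.min M M') => k n' n'd.
  rewrite lt_min => /andP[kM kM']; have [n'N|Nn'] := ltP n' (N + d%:Z).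
    exact: IH.
  by have -> : n' = N + d%:Z by [lia]; exact: h.
split=> [m n||n].
- have [s hs] := Subst02_fin m n hH.
  rewrite /Subst02 (@isumE _ _ (undup s)) ?undup_uniq // => [|j]; last first.
    by rewrite mem_undup; exact: hs.
  apply: (big_ind (@truncated W)).
  + by exists 0.
  + by move=> u v tu tv; rewrite -[u]scale1r; exact: truncatedP.
  + by move=> j _; rewrite -[_ *: _]addr0; apply: truncatedP => //; exists 0.
- exists N => m n nN; apply: isum0 => j; have [j0|j0] := ltP j 0.
    by rewrite gb_neg ?scale0r.
  by rewrite HN ?scaler0 //; lia.
- have [M h] := HMle n; exists (M - (`|n - N|%N)%:Z) => m mM.
  apply: isum0 => j; have [j0|j0] := ltP j 0; first by rewrite gb_neg ?scale0r.
  have [nj|jn] := ltP (n - j) N; first by rewrite HN ?scaler0.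
  by rewrite h ?scaler0 //; lia.
Qed.

Lemma iter_ind (V : Type) (P : V -> Prop) (O : V -> V) l v :
  (forall u, P u -> P (O u)) -> P v -> P (iter l O v).
Proof. by move=> PO Pv; elim: l => //= l; exact: PO. Qed.

(** [R] has no negative powers of x0 or x2, so neither have [D'] and [G'], each by the induction
    fitting its own space. Only then is their difference truncated well enough for the same
    induction, now over all exponents. *)
Lemma pact3_cancel p : p != 0 -> exists l, forall D G R,
    trunc02 D -> trunc20 G -> (forall i j, i < 0 \/ j < 0 -> R i j = 0) ->
    pact3 (s1 \+ (s2 \+ s3)) (s2 \+ s3) s3 p D = R ->
    pact3 (s1 \+ (s2 \+ s3)) (s2 \+ s3) s3 p G = R ->
  iter l (s1 \+ s2) D = iter l (s1 \+ s2) G.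
Proof.
move=> p0; have [l [U [tU UB UE]]] := pact3_factor p0; exists l => D G R tD tG R0.
rewrite !UE; set D' := iter l s1 _; set G' := iter l s1 _ => UD UG.
have tD' : trunc02 D'.
  apply: iter_ind => [u|]; first exact: trunc02_s1.
  apply: iter_ind => [u hu|].
    by apply: trunc02D; [exact: trunc02_s1 | exact: trunc02_s2].
  by apply: iter_ind => // u; exact: trunc02_s2.
have tG' : trunc20 G'.
  apply: iter_ind => [u|]; first exact: trunc20_s1.
  apply: iter_ind => [u hu|].
    by apply: trunc20D; [exact: trunc20_s1 | exact: trunc20_s2].
  by apply: iter_ind => // u; exact: trunc20_s2.
have [tD1 tD2 tD3] := tD'; have [tG1 tG2 tG3] := tG'.
pose X (i j : int) := i < 0 \/ j < 0.
have Xd i j i' j' : X i j -> i' <= i -> j' <= j -> X i' j' by rewrite /X; lia.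
have D0 : forall i j, X i j -> D' i j = 0.
  by apply: (triangular_eq0 tU) => // i j; rewrite UD; exact: R0.
have G0 : forall i j, X i j -> G' i j = 0.
  by apply: (triangular_eq0_swap tU) => // i j; rewrite UG; exact: R0.
have DG : D' = G'.
  apply/eqP; rewrite -subr_eq0; apply/eqP.
  apply: funext => i; apply: funext => j.
  have DG0 i' j' : X i' j' -> (D' - G') i' j' = 0.
    by move=> h; rewrite -[LHS]/(D' i' j' - G' i' j') D0 // G0 // subrr.
  apply: (@triangular_eq0 (fun _ _ => True) U (D' - G')) => //.
  - move=> i' j'; rewrite -[(D' - G') _ _]/(D' i' j' - G' i' j') addrC -scaleN1r.
    exact: truncatedP.
  - by move=> i' j' _; rewrite UB UD UG subrr.
  - by exists 0 => i' j' j0; apply: DG0; right.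
  - by move=> j'; exists 0 => i' i0; apply: DG0; left.
have C (E : series3) : iter l (s1 \+ s2) (iter l s2 E) = iter l s2 (iter l (s1 \+ s2) E).
  by apply: iter_comm => u; exact: s12D.
(* The factors x0^l and x2^l merely move exponents, so they are removed by reading the coefficient
   at (i + l, j + l). *)
move: DG; rewrite /D' /G' !C; set D2 := iter l _ D; set G2 := iter l _ G => DG.
apply: funext => i; apply: funext => j.
have := congr1 (fun E : series3 => E (i + l%:Z) (j + l%:Z)) DG.
by rewrite /= !(@iter_shift F) !(@iter_under F) !(@iter_shift F) !addrK.
Qed.

Lemma YE0l (b : calE W) n : quasi_pair 0 b -> YE 0 b n = 0.
Proof.
move=> h; apply: calEP => w i.
have E : pair_prod 0 b w = 0 by [].
have := phi_uniq charF (phi_YE w h); rewrite E => /(_ _ (phi_linear W charF).1).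
by move=> /(congr1 (fun A => A n i)).
Qed.

(** The exponent [l] depends on [p] only. In the span the identity is one between operators on W, so
    a single [l] has to serve all [w]. *)
Lemma YE_weak_assoc p : p != 0 -> exists l, forall (a b c : calE W) w,
    quasi_pair a b -> quasi_pair b c ->
    (forall n, quasi_pair a (YE b c n)) -> (forall n, quasi_pair (YE a b n) c) ->
    truncated3 (pact3 s1 s2 s3 p (triple_prod a b c w)) ->
  iter l (s1 \+ s2) (Subst02 (fun k n i => YE a (YE b c n) k w i)) =
  iter l (s1 \+ s2) (fun k n i => YE (YE a b k) c n w i).
Proof.
move=> p0; have [l H] := pact3_cancel p0; exists l => a b c w ab bc abc abc' hT.
pose T := pact3 s1 s2 s3 p (triple_prod a b c w).
have ts := trunc_snd_YE charF abc w.
apply: (H _ _ (Subst23 (Subst12 T))).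
- apply: trunc02_Subst02 => // [k n|n]; first exact: laurent_trunc.
  have [M h] := YE_trunc a (YE b c n); exists M => k kM; apply: funext => i.
  by rewrite h.
- split=> [k n||k]; first exact: laurent_trunc.
    have [M h] := YE_trunc a b; exists M => k n kM; apply: funext => i.
    rewrite h // YE0l //.
    by have := abc' (M - 1); rewrite h //; lia.
  by have [M h] := YE_trunc (YE a b k) c; exists M => n nM; apply: funext => i; rewrite h.
- move=> i j [i0|j0]; apply: funext => n; apply: isum0 => m.
    rewrite [Subst12 _ _ _ _]isum0 ?scaler0 // => m'.
    by rewrite gb_neg ?scale0r.
  by rewrite gb_neg ?scale0r.
- by rewrite -pact3_Subst02 // pact3_YE_right // Subst02_Subst13.
- exact: pact3_YE_left.
Qed.

End Cancellation.

(** * Quasi compatible sequences *)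

Section ManyVariables.
Variables (F : fieldType) (W : lmodType F).
Implicit Types (p q : {poly {poly F}}).

Definition mshift r (k : 'I_r) (A : ('I_r -> int) -> W) : ('I_r -> int) -> W :=
  fun n => A (fun i => n i - (i == k)%N%:Z).

Lemma mshift_linear r (k : 'I_r) : linear (mshift k).
Proof. by []. Qed.

HB.instance Definition _ r (k : 'I_r) :=
  GRing.isLinear.Build F (('I_r -> int) -> W) (('I_r -> int) -> W) *:%R (mshift k)
    (@mshift_linear r k).

Lemma mshiftC r (i j : 'I_r) A : mshift i (mshift j A) = mshift j (mshift i A).
Proof.
apply: funext => n; rewrite /mshift; congr A; apply: funext => k.
by rewrite addrAC.
Qed.

Lemma iter_mshift r (k : 'I_r) s A n :
  iter s (mshift k) A n = A (fun i => n i - (s * (i == k))%N%:Z).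
Proof.
elim: s n => [|s IH] n; first by congr A; apply: funext => i; rewrite subr0.
rewrite iterS {1}/mshift IH; congr A; apply: funext => i.
by rewrite mulSn PoszD opprD addrA.
Qed.

Lemma mpmulE r p (i j : 'I_r) A : mpmul p i j A = pact (mshift i) (mshift j) p A.
Proof.
apply: funext => n; rewrite /mpmul /pact fct_sumE; apply: eq_bigr => s _.
rewrite fct_sumE; apply: eq_bigr => t _.
by rewrite -[RHS]/(_ *: _) !iter_mshift.
Qed.

Definition mpmul_seq r p (l : seq ('I_r * 'I_r)) (A : ('I_r -> int) -> W) :=
  foldr (fun ij => mpmul p ij.1 ij.2) A l.

Definition pairs r := [seq ij : 'I_r * 'I_r <- index_enum (('I_r * 'I_r)%type : finType) |
  (ij.1 < ij.2)%N].

Lemma big_mpmulE r p (A : ('I_r -> int) -> W) :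
  (\big[(fun f g => f \o g)/id]_(ij : 'I_r * 'I_r | (ij.1 < ij.2)%N)
     mpmul p ij.1 ij.2) A = mpmul_seq p (pairs r) A.
Proof.
rewrite /pairs; elim: (index_enum _) => [|ij l IH]; first by rewrite big_nil.
by rewrite big_cons /=; case: ifP => _ //=; rewrite IH.
Qed.

(** Carries the product over all pairs to another space with its own operators: series in two or
    three indices, or the graph of multiplication by f(x_k). *)
Lemma mpmul_seq_rel r p l (V : lmodType F) (Rel : (('I_r -> int) -> W) -> V -> Prop)
    (O : 'I_r -> V -> V) A v :
    linear_rel Rel -> (forall k A v, Rel A v -> Rel (mshift k A) (O k v)) -> Rel A v ->
  Rel (mpmul_seq p l A) (foldr (fun ij => pact (O ij.1) (O ij.2) p) v l).
Proof.
move=> RP RO RA; elim: l => //= ij l IH.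
by rewrite mpmulE; apply: pact_rel => // B u; exact: RO.
Qed.

Lemma mpmul_seq_comm r p l (L : {linear (('I_r -> int) -> W) -> (('I_r -> int) -> W)}) A :
    (forall k B, L (mshift k B) = mshift k (L B)) ->
  L (mpmul_seq p l A) = mpmul_seq p l (L A).
Proof.
move=> LO; elim: l => //= ij l IH.
by rewrite !mpmulE -IH; apply: pact_comm => B; exact: LO.
Qed.

Lemma mpmul_seqM r p q l (A : ('I_r -> int) -> W) :
  mpmul_seq (p * q) l A = mpmul_seq p l (mpmul_seq q l A).
Proof.
elim: l => //= ij l ->; rewrite !mpmulE pactM; last exact: mshiftC.
congr (pact _ _ _ _); apply: mpmul_seq_comm => k B.
by apply: esym; apply: pact_comm => u; exact: mshiftC.
Qed.

Lemma mtruncatedP r c (A B : ('I_r -> int) -> W) :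
  mtruncated A -> mtruncated B -> mtruncated (c *: A + B).
Proof.
move=> [M A0] [N B0]; exists (Num.min M N) => n [i ni].
rewrite -[LHS]/(c *: A n + B n) A0 ?B0 ?scaler0 ?addr0 //; exists i; lia.
Qed.

Lemma mtruncated_mshift r (k : 'I_r) A : mtruncated A -> mtruncated (mshift k A).
Proof.
by move=> [N A0]; exists N => n [i ni]; apply: A0; exists i; lia.
Qed.

Lemma mtruncated_linear r :
  linear_rel (fun A B : ('I_r -> int) -> W => mtruncated A).
Proof.
split; first by exists 0.
by move=> c u v _ _ tu tv; exact: mtruncatedP.
Qed.

Lemma mtruncated_mpmul_seq r p l (A : ('I_r -> int) -> W) :
  mtruncated A -> mtruncated (mpmul_seq p l A).
Proof.
move=> tA; apply: (@mpmul_seq_rel r p l _ (fun A _ => mtruncated A) (@mshift r) A A) => //.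
- exact: mtruncated_linear.
- by move=> k B _; exact: mtruncated_mshift.
Qed.

Definition apply_seq r (a : 'I_r -> calE W) (n : 'I_r -> int) (l : seq 'I_r) (w : W) : W :=
  foldr (fun i u => a i u (n i)) w l.

Lemma apply_seq_linear r (a : 'I_r -> calE W) n l : linear (apply_seq a n l).
Proof. by move=> c u v; elim: l => //= i l ->; rewrite linearP. Qed.

HB.instance Definition _ r (a : 'I_r -> calE W) n l :=
  GRing.isLinear.Build F W W *:%R (apply_seq a n l) (apply_seq_linear a n l).

Lemma eq_apply_seq r (a b : 'I_r -> calE W) m n l w :
    (forall i, i \in l -> a i = b i /\ m i = n i) ->
  apply_seq a m l w = apply_seq b n l w.
Proof.
elim: l => //= i l IH h; rewrite IH => [|j jl]; last by apply: h; rewrite inE jl orbT.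
by have [-> ->] := h i (mem_head _ _).
Qed.

Definition set_at r (a : 'I_r -> calE W) k u : 'I_r -> calE W :=
  fun i => if i == k then u else a i.

Definition shift_at r (k : 'I_r) (m : int) (n : 'I_r -> int) : 'I_r -> int :=
  fun i => if i == k then n i - m else n i.

(** Isolates the k-th factor: [l] and [l'] do not depend on [u], so the coefficient is linear in
    [u]. *)
Lemma mprod_split r (a : 'I_r -> calE W) (k : 'I_r) w : exists l l',
  forall u m n, mprod (set_at a k u) w (shift_at k m n) =
    apply_seq a n l (u (apply_seq a n l' w) (n k - m)).
Proof.
have kE : k \in enum 'I_r by rewrite mem_enum.
have := enum_uniq 'I_r; rewrite /mprod.
case/splitPr: kE => l l'; rewrite cat_uniq /= => /and4P[_ kl kl' _].
rewrite negb_or in kl; case/andP: kl => kl _.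
exists l, l' => u m n; rewrite foldr_cat /=.
have -> : set_at a k u k = u by rewrite /set_at eqxx.
have -> : shift_at k m n k = n k - m by rewrite /shift_at eqxx.
have E s v : k \notin s ->
    apply_seq (set_at a k u) (shift_at k m n) s v = apply_seq a n s v.
  move=> ks; apply: eq_apply_seq => i iks; rewrite /set_at /shift_at.
  by case: eqP ks iks => // -> /negPf ->.
rewrite -[LHS]/(apply_seq (set_at a k u) (shift_at k m n) l
  (u (apply_seq (set_at a k u) (shift_at k m n) l' w) (n k - m))).
by rewrite !E.
Qed.

Lemma shift_at0 r (k : 'I_r) n : shift_at k 0 n = n.
Proof. by apply: funext => i; rewrite /shift_at subr0; case: ifP. Qed.

(* Multiplication by f(x_k). *)
Definition mscale r f (k : 'I_r) (A : ('I_r -> int) -> W) : ('I_r -> int) -> W :=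
  fun n => \isum_m ((f : laurent F) m *: A (shift_at k m n)).

(** As [shift_at] lowers the exponent, this is truncation from below in x_k with a bound depending
    on the other exponents; it makes the sums in [mscale] finite. *)
Definition trunc_at r (k : 'I_r) (A : ('I_r -> int) -> W) : Prop :=
  forall n, exists M : int, forall m, M <= m -> A (shift_at k m n) = 0.

Lemma mscale_fin r f (k : 'I_r) A n : trunc_at k A ->
  fin_supp (fun m => (f : laurent F) m *: A (shift_at k m n)).
Proof.
move=> /(_ n)[M A0]; have [N f0] := laurent_trunc f.
apply: (@fin_supp_bound _ _ N M) => m mN; first by rewrite f0 ?scale0r.
by rewrite A0 ?scaler0.
Qed.

Lemma mpmul_seq_mscale r p l f (k : 'I_r) A : trunc_at k A ->
  mscale f k (mpmul_seq p l A) = mpmul_seq p l (mscale f k A).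
Proof.
move=> tA; pose Rel A B := trunc_at k A /\ mscale f k A = B.
have E B : mpmul_seq p l B =
    foldr (fun ij => pact (mshift ij.1) (mshift ij.2) p) B l.
  by elim: l => //= ij l ->; rewrite mpmulE.
rewrite [RHS]E.
suff [] : Rel (mpmul_seq p l A)
    (foldr (fun ij => pact (mshift ij.1) (mshift ij.2) p) (mscale f k A) l) by [].
apply: mpmul_seq_rel => //.
- split.
    split; first by move=> n; exists 0.
    by apply: funext => n; apply: isum0 => m; exact: scaler0.
  move=> c u v _ _ [tu <-] [tv <-]; split.
    move=> n; have [M u0] := tu n; have [N v0] := tv n; exists (Num.max M N) => m.
    rewrite ge_max => /andP[mM mN].
    by rewrite -[LHS]/(c *: u _ + v _) u0 // v0 // scaler0 addr0.
  apply: funext => n; rewrite -[RHS]/(c *: mscale f k u n + mscale f k v n).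
  rewrite /mscale -isumP; try exact: mscale_fin.
  apply: eq_isum => m; rewrite -[(c *: u + v) _]/(c *: u _ + v _).
  by rewrite scalerDr !scalerA mulrC.
- move=> j u _ [tu <-].
  have C m n : (fun i => shift_at k m n i - (i == j)%N%:Z) =
      shift_at k m (fun i => n i - (i == j)%N%:Z).
    by apply: funext => i; rewrite /shift_at; case: eqP => // _; rewrite addrAC.
  split=> [n|]; last by apply: funext => n; apply: eq_isum => m; rewrite /mshift C.
  have [M u0] := tu (fun i => n i - (i == j)%N%:Z); exists M => m mM.
  by rewrite /mshift C u0.
Qed.

Lemma mtruncated_mscale r f (k : 'I_r) A : mtruncated A -> mtruncated (mscale f k A).
Proof.
move=> [N A0]; have [M f0] := laurent_trunc f; exists (Num.min N (N + M)) => n [i ni].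
apply: isum0 => m; have [mM|Mm] := ltP m M; first by rewrite f0 ?scale0r.
rewrite A0 ?scaler0 //; exists i; rewrite /shift_at; case: ifP => _; lia.
Qed.

Lemma seq_condE r p (a : 'I_r -> calE W) :
  seq_cond p a <-> forall w, mtruncated (mpmul_seq p (pairs r) (mprod a w)).
Proof. by split=> h w; have := h w; rewrite big_mpmulE. Qed.

Lemma seq_condM r p q (a : 'I_r -> calE W) : seq_cond q a -> seq_cond (p * q) a.
Proof.
by move=> /seq_condE h; apply/seq_condE => w; rewrite mpmul_seqM; exact: mtruncated_mpmul_seq.
Qed.

Lemma seq_cond0 r p (a : 'I_r -> calE W) k : seq_cond p (set_at a k 0).
Proof.
apply/seq_condE => w; apply: mtruncated_mpmul_seq; exists 0 => n _.
have [l [l' E]] := mprod_split a k w.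
by rewrite -[n](shift_at0 k) E linear0.
Qed.

(** Multiplication by f(x_k) commutes with the polynomial factors and preserves truncation, so the
    same [p] works. *)
Lemma seq_cond_lact r p (a : 'I_r -> calE W) k f b :
  seq_cond p (set_at a k b) -> seq_cond p (set_at a k (lact f b)).
Proof.
move=> /seq_condE h; apply/seq_condE => w.
have [l [l' E]] := mprod_split a k w.
have bT n := laurent_trunc (b (apply_seq a n l' w)).
have -> : mprod (set_at a k (lact f b)) w = mscale f k (mprod (set_at a k b) w).
  apply: funext => n; rewrite -[n in LHS](shift_at0 k) E subr0.
  rewrite -[lact f b _ _]/(\isum_m (f m *: b (apply_seq a n l' w) (n k - m))).
  rewrite isum_linear; last exact: lscale_fin.
  by apply: eq_isum => m; rewrite E linearZ.
rewrite -mpmul_seq_mscale; first exact: mtruncated_mscale.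
move=> n; have [N b0] := bT n; exists (n k - N + 1) => m Nm.
by rewrite E b0 ?linear0 //; lia.
Qed.

Lemma seq_condD r p q (a : 'I_r -> calE W) k u v :
    seq_cond p (set_at a k u) -> seq_cond q (set_at a k v) ->
  seq_cond (p * q) (set_at a k (u + v)).
Proof.
move=> hu /(seq_condM p)/seq_condE hv; have := seq_condM q hu; rewrite mulrC.
move=> /seq_condE {}hu; apply/seq_condE => w.
have [l [l' E]] := mprod_split a k w.
have -> : mprod (set_at a k (u + v)) w =
    1 *: mprod (set_at a k u) w + mprod (set_at a k v) w.
  rewrite scale1r; apply: funext => n.
  rewrite -[RHS]/(mprod (set_at a k u) w n + mprod (set_at a k v) w n).
  by rewrite -[n](shift_at0 k) !E -linearD.
have L A B : mpmul_seq (p * q) (pairs r) (1 *: A + B) =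
    1 *: mpmul_seq (p * q) (pairs r) A + mpmul_seq (p * q) (pairs r) B.
  elim: (pairs r) => //= ij l0 ->; rewrite !mpmulE; exact: pact_linear.
by rewrite L; apply: mtruncatedP.
Qed.

(** Entries are moved from [K] to its span one at a time. For a single entry, scalars keep the
    polynomial and sums multiply the polynomials, whence the closure conditions on [C]. *)
Lemma seq_cond_span (C : {poly {poly F}} -> Prop) (K : set (calE W)) :
    C 1 -> (forall p q, C p -> C q -> C (p * q)) ->
    (forall r (a : 'I_r -> calE W), (forall i, K (a i)) -> exists2 p, C p & seq_cond p a) ->
  forall r (a : 'I_r -> calE W), (forall i, Fx_span K (a i)) ->
    exists2 p, C p & seq_cond p a.
Proof.
move=> C1 CM KC r a aK.
(* The first [k] entries may already lie in the span, the others are still in [K]. *)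
suff H (k : nat) : (k <= r)%N -> forall b : 'I_r -> calE W,
    (forall i : 'I_r, if (i < k)%N then Fx_span K (b i) else K (b i)) ->
    exists2 p, C p & seq_cond p b.
  by apply: (H r) => // i; rewrite ltn_ord.
elim: k => [_ b bK|k IH kr b bK]; first by apply: KC => i; exact: bK.
pose i0 := Ordinal kr.
have bE : b = set_at b i0 (b i0).
  by apply: funext => i; rewrite /set_at; case: eqP => [->|].
have := bK i0; rewrite ltnSn => -[s [sK E]]; rewrite bE E.
elim: s sK {E} => [_|fb s IHs sK].
  by rewrite big_nil; exists 1 => //; exact: seq_cond0.
rewrite big_cons; have [q Cq hq] : exists2 q, C q & seq_cond q (set_at b i0 (lact fb.1 fb.2)).
  have [|i|q Cq hq] := IH _ (set_at b i0 fb.2); first exact: ltnW.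
    rewrite /set_at; case: eqP => [->|ii0].
      by rewrite ltnn; apply: sK; exact: mem_head.
    have := bK i; rewrite ltnS leq_eqVlt; case: eqP => // ik.
    by case: ii0; apply: val_inj.
  by exists q => //; exact: seq_cond_lact.
have [|q' Cq' hq'] := IHs _; first by move=> gc gcs; apply: sK; rewrite inE gcs orbT.
by exists (q * q'); [exact: CM | exact: seq_condD].
Qed.

End ManyVariables.

(** * Sequences of length two and three *)

Section TwoAndThreeVariables.
Variables (F : fieldType) (W : lmodType F).
Implicit Types (p q : {poly {poly F}}).

Lemma pairs_prod_enum r :
  pairs r = [seq ij : 'I_r * 'I_r <- prod_enum 'I_r 'I_r | (ij.1 < ij.2)%N].
Proof.
rewrite /pairs [index_enum _]unlock.
by have -> : Finite.enum ('I_r * 'I_r)%type = prod_enum 'I_r 'I_r by rewrite unlock.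
Qed.

Lemma pairs2 : pairs 2 = [:: (ord0, lift ord0 ord0)].
Proof. by rewrite pairs_prod_enum /prod_enum !enum_ordSl enum_ord0 /=. Qed.

Lemma pairs3 : pairs 3 = [:: (ord0, lift ord0 ord0); (ord0, lift ord0 (lift ord0 ord0));
  (lift ord0 ord0, lift ord0 (lift ord0 ord0))].
Proof. by rewrite pairs_prod_enum /prod_enum !enum_ordSl enum_ord0 /=. Qed.

Definition seq_fun (T : Type) r (s : seq T) (x : T) : 'I_r -> T := fun i => nth x s i.

Lemma seq_cond_pair p (a b : calE W) :
  seq_cond p (seq_fun (r := 2) [:: a; b] a) -> pair_cond p a b.
Proof.
move=> /seq_condE h w; have [N h0] := h w.
pose S (A : ('I_2 -> int) -> W) : int -> int -> W :=
  fun m n => A (seq_fun [:: m; n] 0).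
pose O (k : 'I_2) : (int -> int -> W) -> int -> int -> W := nth s1 [:: s1; s2] k.
have := @mpmul_seq_rel F W 2 p (pairs 2) _ (fun A v => S A = v) O
  (mprod (seq_fun [:: a; b] a) w) (pair_prod a b w).
rewrite {2}pairs2 /= => E; rewrite pmulE -E.
- exists N => m n mn; apply: h0.
  by case: mn => ?; [exists ord0 | exists (lift ord0 ord0)].
- by split=> // c u v _ _ <- <-.
- move=> k A _ <-; apply: funext => m; apply: funext => n.
  case: k => -[|[|//]] k2; rewrite /S /mshift /O /=; congr A; apply: funext => -[[|[|//]] i2] //=;
    by rewrite ?subr0.
- apply: funext => m; apply: funext => n.
  by rewrite /S /mprod !enum_ordSl enum_ord0 /=.
Qed.

Lemma seq_cond_triple p (a b c : calE W) w :
  seq_cond p (seq_fun (r := 3) [:: a; b; c] a) ->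
  truncated3 (pact3 s1 s2 s3 p (triple_prod a b c w)).
Proof.
move=> /seq_condE h; have [N h0] := h w.
pose S (A : ('I_3 -> int) -> W) : int -> int -> int -> W :=
  fun m n i => A (seq_fun [:: m; n; i] 0).
pose O (k : 'I_3) : (int -> int -> int -> W) -> int -> int -> int -> W :=
  nth s1 [:: s1; s2; s3] k.
have := @mpmul_seq_rel F W 3 p (pairs 3) _ (fun A v => S A = v) O
  (mprod (seq_fun [:: a; b; c] a) w) (triple_prod a b c w).
rewrite {2}pairs3 /= => E; rewrite /pact3 -E.
- exists N => m n i mni; apply: h0.
  by case: mni => [?|[?|?]]; [exists ord0 | exists (lift ord0 ord0) |
    exists (lift ord0 (lift ord0 ord0))].
- by split=> // d u v _ _ <- <-.
- move=> k A _ <-; apply: funext => m; apply: funext => n; apply: funext => i.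
  by case: k => -[|[|[|//]]] k2; rewrite /S /mshift /O /=; congr A;
    apply: funext => -[[|[|[|//]]] i2] //=; rewrite ?subr0.
- apply: funext => m; apply: funext => n; apply: funext => i.
  by rewrite /S /mprod !enum_ordSl enum_ord0 /=.
Qed.

End TwoAndThreeVariables.

(** * The vertex algebra structure on the span *)

Section Bilinear.
Variables (F : fieldType) (W : lmodType F).
Hypothesis charF : [pchar F] =i pred0.
Implicit Types (a b c : calE W).

(** [YE] chooses a polynomial for each pair separately, so linearity is invisible in its definition
    and is obtained from uniqueness of the value. *)
Lemma YE_linearl k a b c n :
    quasi_pair a c -> quasi_pair b c -> quasi_pair (k *: a + b) c ->
  YE (k *: a + b) c n = k *: YE a c n + YE b c n.
Proof.
move=> hac hbc h; apply: calEP => w i.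
have := (phi_linear W charF).2 k _ _ _ _ (phi_YE w hac) (phi_YE w hbc).
move=> /(phi_uniq charF (phi_YE w h)).
by move=> /(congr1 (fun A => A n i)).
Qed.

Lemma YE_linearr k a b c n :
    quasi_pair a b -> quasi_pair a c -> quasi_pair a (k *: b + c) ->
  YE a (k *: b + c) n = k *: YE a b n + YE a c n.
Proof.
move=> hab hac h; apply: calEP => w i.
have := (phi_linear W charF).2 k _ _ _ _ (phi_YE w hab) (phi_YE w hac).
have -> : k *: pair_prod a b w + pair_prod a c w = pair_prod a (k *: b + c) w.
  apply: funext => m; apply: funext => j.
  rewrite -[RHS]/(a (k *: b w j + c w j) m) linearP. by [].
move=> /(phi_uniq charF (phi_YE w h)).
by move=> /(congr1 (fun A => A n i)).
Qed.

(** A product with 1_W is truncated in both variables without any polynomial, so its value is a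
    plain substitution. With 1_W on the left nothing depends on z and x0 does not occur; on the
    right one gets a(x + x0), with constant term a(x). *)
Lemma YE_idl b n : quasi_pair (idE W) b -> YE (idE W) b n = if n == 0 then b else 0.
Proof.
move=> h; apply: calEP => w i.
have tA : truncated2 (pair_prod (idE W) b w).
  have [N b0] := laurent_trunc (b w); exists (Num.min 0 N) => m j mj.
  rewrite /pair_prod /=; case: eqP => // m0; apply: b0; lia.
have := phi_uniq charF (phi_YE w h) (phi_trunc tA).
move=> /(congr1 (fun A => A n i)) ->; rewrite /Subst (@isum1 _ _ 0) => [|m m0]; last first.
  by rewrite /pair_prod /= (negPf m0) scaler0.
rewrite /pair_prod /= subr0; case: eqP => [->|n0]; first by rewrite gb0 scale1r addr0.
case: n n0 => [n n0|n _]; last by rewrite scale0r.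
by rewrite (@gb_small _ 0) ?scale0r //; lia.
Qed.

Lemma YE_idr a n : quasi_pair a (idE W) -> n <= 0 ->
  YE a (idE W) n = if n == 0 then a else 0.
Proof.
move=> h n0; apply: calEP => w i.
have tA : truncated2 (pair_prod a (idE W) w).
  have [N a0] := laurent_trunc (a w); exists (Num.min 0 N) => m j mj.
  rewrite /pair_prod /=; case: eqP => [j0|_]; last by rewrite linear0.
  by apply: a0; lia.
have := phi_uniq charF (phi_YE w h) (phi_trunc tA).
move=> /(congr1 (fun A => A n i)) ->; rewrite /Subst.
have [->|nn0] := eqVneq n 0; last first.
  by apply: isum0 => m; rewrite gb_neg ?scale0r //; lia.
rewrite (@isum1 _ _ i) => [|m mi]; rewrite gb0 scale1r addr0 /pair_prod /=.
  by rewrite subrr.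
by case: eqP => [|_]; [lia | rewrite linear0].
Qed.

End Bilinear.

Section Action.
Variables (F : fieldType) (W : lmodType F).
Implicit Types (a b : calE W) (f g : laurent F) (K : set (calE W)).

Lemma lactM f g a : lact (f * g) a = lact f (lact g a).
Proof. by apply: calEP => w n; rewrite -[LHS]/(lscale (f * g) (a w) n) lscaleM. Qed.

Lemma lactDl f g a : lact (f + g) a = lact f a + lact g a.
Proof. by apply: calEP => w n; rewrite -[LHS]/(lscale (f + g) (a w) n) lscaleDl. Qed.

Lemma lactDr f a b : lact f (a + b) = lact f a + lact f b.
Proof.
apply: calEP => w n; have := lscale_linear f 1 (a w) (b w).
by rewrite !scale1r => /(congr1 (fun u : laurent W => u n)).
Qed.

Lemma lact_const (c : F) a : lact (lconst c) a = c *: a.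
Proof.
apply: calEP => w n; have := lscaleZl c 1 (a w).
by rewrite mulr1 lscale1 => /(congr1 (fun u : laurent W => u n)).
Qed.

Lemma lact1 a : lact 1 a = a.
Proof. by apply: calEP => w n; rewrite -[LHS]/(lscale 1 (a w) n) lscale1. Qed.

Lemma Fx_span_ind K (P : calE W -> Prop) :
    P 0 -> (forall f b u, K b -> Fx_span K u -> P u -> P (lact f b + u)) ->
  forall a, Fx_span K a -> P a.
Proof.
move=> P0 PD _ [s [sK ->]]; elim: s sK => [_|[f b] s IH sK]; first by rewrite big_nil.
have sK' gc : gc \in s -> K gc.2 by move=> gcs; apply: sK; rewrite inE gcs orbT.
rewrite big_cons; apply: PD; last exact: IH.
  by apply: (sK (f, b)); exact: mem_head.
by exists s.
Qed.

Lemma Fx_span_submod K : Fx_submodule (Fx_span K).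
Proof.
split; first by exists [::]; rewrite big_nil.
  move=> _ _ [s [sK ->]] [t [tK ->]]; exists (s ++ t); rewrite big_cat; split=> //.
  by move=> fb; rewrite mem_cat => /orP[/sK|/tK].
move=> f _ [s [sK ->]]; exists [seq (f * gb.1, gb.2) | gb <- s]; split.
  by move=> _ /mapP[gb /sK ? ->].
rewrite big_map (big_morph (lact f) (lactDr f) (lact0 W f)).
by apply: eq_bigr => gb _; rewrite lactM.
Qed.

Lemma Fx_span_gen K f a : K a -> Fx_span K (lact f a).
Proof.
move=> Ka; exists [:: (f, a)]; rewrite big_seq1; split=> // gb.
by rewrite inE => /eqP ->.
Qed.

End Action.

(** * Vertex algebra and module axioms for a class of admissible polynomials *)

Section Span.
Variables (F : fieldType) (W : lmodType F) (C : {poly {poly F}} -> Prop).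
Hypothesis charF : [pchar F] =i pred0.
Hypotheses (C_neq0 : forall p, C p -> p != 0) (C1 : C 1).
Hypothesis CM : forall p q, C p -> C q -> C (p * q).
Variable K : set (calE W).
Hypothesis KC : forall r (a : 'I_r -> calE W), (forall i, K (a i)) ->
  exists2 p, C p & seq_cond p a.
Hypotheses (KYE : YE_closed K) (K1 : K (idE W)).

Let L := Fx_span K.
Let V := Fx_spanType K.

Lemma span_cond r (a : 'I_r -> calE W) : (forall i, L (a i)) ->
  exists2 p, C p & seq_cond p a.
Proof. exact: seq_cond_span. Qed.

Lemma span_pair_cond a b : L a -> L b -> exists2 p, C p & pair_cond p a b.
Proof.
move=> La Lb; have [i|p Cp hp] := @span_cond 2 (seq_fun [:: a; b] a).
  by case: i => -[|[|]].
by exists p => //; exact: seq_cond_pair.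
Qed.

Lemma span_quasi_pair a b : L a -> L b -> quasi_pair a b.
Proof.
by move=> La Lb; have [p /C_neq0 p0 hp] := span_pair_cond La Lb; exists p.
Qed.

Lemma span_YE a b n : L a -> L b -> L (YE a b n).
Proof.
have [L0 LD LZ] := Fx_span_submod K; rewrite -/L in L0 LD LZ.
have LG f u : K u -> L (lact f u) by exact: Fx_span_gen.
have q := span_quasi_pair.
move=> La Lb; elim/Fx_span_ind: La => [|f u a' Ku La' IH].
  by rewrite YE0l //; exact: q.
rewrite -[lact f u]scale1r YE_linearl //; try by apply: q => //; rewrite ?scale1r; auto.
rewrite scale1r; apply: (LD) => // {IH}.
elim/Fx_span_ind: Lb => [|g v b' Kv Lb' IH].
  (* Linearity with scalar -1 and both arguments 0 gives the value 0 at 0. *)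
  have := @YE_linearr _ _ charF (-1) (lact f u) 0 0 n.
  by rewrite scaler0 addr0 scaleN1r addNr => ->; auto.
rewrite -[lact g v]scale1r YE_linearr //; try by apply: q => //; rewrite ?scale1r; auto.
rewrite scale1r; apply: (LD) => // {IH}.
have qKK : quasi_pair u v by apply: q; rewrite -[X in L X]lact1; exact: LG.
rewrite YE_lact //; last by apply: q; exact: LG.
have [s hs] : fin_supp (fun t => lact (taylor f t) (lact g (YE u v (n - t)))).
  apply: (@taylor_conv_fin F W f (fun m => lact g (YE u v m))).
  by have [N B0] := YE_trunc u v; exists N => k kN; rewrite B0 // lact0.
rewrite /conv (@isumE _ _ (undup s)) ?undup_uniq // => [|t]; last first.
  by rewrite mem_undup; exact: hs.
apply: (big_ind L) => // t _; apply: LZ; apply: LG.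
(* The coefficient of x0^(n - t) is the product with index -(n - t) - 1. *)
have := KYE (- (n - t) - 1) Ku Kv; rewrite /nprod.
by have -> : - (- (n - t) - 1) - 1 = n - t by lia.
Qed.

Lemma spanP (a : V) : L a.
Proof. by case: a => a h; exact: asboolW. Qed.

Definition mkspan a (La : L a) : V := FxSpan (asboolT La).

Lemma L1 : L (idE W).
Proof. by rewrite -[idE W]lact1; exact: Fx_span_gen. Qed.

Lemma Llact f (a : V) : L (lact f a).
Proof. by have [_ _ LZ] := Fx_span_submod K; apply: LZ; exact: spanP. Qed.

Definition span_one : V := mkspan L1.
Definition span_act (f : laurent F) (a : V) : V := mkspan (Llact f a).
Definition span_YE_coef (a b : V) (n : int) : V :=
  mkspan (span_YE n (spanP a) (spanP b)).

Lemma span_YE_trunc a b : truncated (span_YE_coef a b).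
Proof.
by have [N h] := YE_trunc a b; exists N => n nN; apply: val_inj; exact: h.
Qed.

Lemma span_Y_linear a : linear (fun b => mkLaurent (span_YE_trunc a b)).
Proof.
move=> k b c; apply: laurentP => n; apply: val_inj.
apply: YE_linearr => //; apply: span_quasi_pair; try exact: spanP.
exact: (spanP (k *: b + c)).
Qed.

Definition span_Y (a : V) : calE V := CalE (asboolT (span_Y_linear a)).

Lemma span_Y_is_linear : linear span_Y.
Proof.
move=> k a b; apply: calEP => c n; apply: val_inj.
apply: YE_linearl => //; apply: span_quasi_pair; try exact: spanP.
exact: (spanP (k *: a + b)).
Qed.

HB.instance Definition _ :=
  GRing.isLinear.Build F V (calE V) *:%R span_Y span_Y_is_linear.

Definition span_YW (a : V) : calE W := a.

Lemma span_YW_linear : linear span_YW.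
Proof. by []. Qed.

HB.instance Definition _ :=
  GRing.isLinear.Build F V (calE W) *:%R span_YW span_YW_linear.

Lemma pmul_comp (X : lmodType F) p (A : int -> int -> X) :
  pmul (p \Po ('X + 'Y)) A = pact (s1 \+ s2) s2 p A.
Proof. by rewrite pmulE pact_compD. Qed.

Definition span_eval (w : W) (a : V) : int -> W := (a : calE W) w.

Lemma span_eval_linear w : linear (span_eval w).
Proof. by []. Qed.

HB.instance Definition _ w :=
  GRing.isLinear.Build F V (int -> W) *:%R (span_eval w) (span_eval_linear w).

Lemma span_weak_assoc u v w : exists l : nat, weak_assoc 'X^l span_Y span_Y u v w.
Proof.
have [i|p Cp hp] := @span_cond 3 (seq_fun [:: u : calE W; v : calE W; w : calE W] 0).
  by case: i => -[|[|[|]]] // k; exact: spanP.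
have [l H] := YE_weak_assoc W charF (C_neq0 Cp); exists l => i j.
have tA : trunc_snd (pair_prod (span_Y u) (span_Y v) w).
  exact: pair_prod_truncr.
rewrite !pmul_comp !pactXn subst_x0x2E //.
apply: val_inj; apply: calEP => x n.
(* Elements of the span are operators, so the identity is tested on each vector [x]. This evaluation
   commutes with shifts and with [Subst02]. *)
pose E : {linear (int -> int -> V) -> (int -> int -> int -> W)} :=
  under (under (span_eval x)).
have EI (A : int -> int -> V) :
    E (iter l (s1 \+ s2) A) = iter l (s1 \+ s2) (E A).
  by elim: l {H} => //= l <-.
have ES (A : int -> int -> V) : trunc_snd A -> E (Subst02 A) = Subst02 (E A).
  move=> hA; apply: funext => m; apply: funext => n'.
  rewrite -[LHS]/(span_eval x (Subst02 A m n')) /Subst02 isum_linear.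
    by apply: eq_isum => k; rewrite linearZ.
  exact: Subst02_fin.
rewrite -[LHS]/(E (iter l (s1 \+ s2) (Subst02 (pair_prod (span_Y u) (span_Y v) w))) i j n).
rewrite -[RHS]/(E (iter l (s1 \+ s2) (fun m n => span_Y (span_Y u v m) w n)) i j n).
rewrite !EI ES //.
have := H u v w x; move=> /(_ _ _ _ _ _)/(congr1 (fun A => A i j n)); apply.
- by apply: span_quasi_pair; exact: spanP.
- by apply: span_quasi_pair; exact: spanP.
- by move=> m; apply: span_quasi_pair; [exact: spanP | apply: span_YE; exact: spanP].
- by move=> m; apply: span_quasi_pair; [apply: span_YE; exact: spanP | exact: spanP].
- apply: seq_cond_triple; have -> // : seq_fun [:: u : calE W; v : calE W; w : calE W] u =
    seq_fun (r := 3) [:: u : calE W; v : calE W; w : calE W] 0.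
  by apply: funext => -[[|[|[|]]] k].
Qed.

Lemma span_nonlocal_Ft_va : is_nonlocal_Ft_va span_act span_Y span_one.
Proof.
have qpP (a b : V) : quasi_pair a b by apply: span_quasi_pair; exact: spanP.
split.
- split.
  + apply: calEP => v n; apply: val_inj.
    rewrite -[LHS]/(YE (idE W) v n) YE_idl //; last exact: (qpP span_one).
    by rewrite /=; case: eqP.
  + move=> v n n0; apply: val_inj.
    rewrite -[LHS]/(YE v (idE W) n) YE_idr //; [|exact: (qpP v span_one)|exact: ltW].
    by case: eqP n0 => // ->; rewrite ltxx.
  + move=> v; apply: val_inj.
    by rewrite -[LHS]/(YE v (idE W) 0) YE_idr //; exact: (qpP v span_one).
  + exact: span_weak_assoc.
- split.
  + by move=> k v; apply: val_inj; exact: lact_const.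
  + by move=> f g v; apply: val_inj; exact: lactM.
  + by move=> f g v; apply: val_inj; exact: lactDl.
  + by move=> f u v; apply: val_inj; exact: lactDr.
- move=> f g u v n; apply: val_inj.
  rewrite -[LHS]/(YE (lact f u) (lact g v) n) YE_lact //; last first.
    exact: (qpP (span_act f u) (span_act g v)).
  rewrite -[RHS]/(Fx_span_val (\isum_t
    span_act (taylor f t) (span_act g (span_Y u v (n - t))))).
  rewrite (@raddf_isum _ _ (@Fx_span_val F W K)) //.
  have [s hs] : fin_supp (fun t => lact (taylor f t) (lact g (YE u v (n - t)))).
    apply: (@taylor_conv_fin F W f (fun m => lact g (YE u v m))).
    by have [N B0] := YE_trunc u v; exists N => k kN; rewrite B0 // lact0.
  by exists s => t ts; apply: val_inj; exact: hs.
Qed.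

Lemma span_module_weak_assoc (u v : V) (w : W) : exists2 p, C p &
  exists l : nat, weak_assoc ('X^l * p) span_Y span_YW u v w.
Proof.
have [p Cp hp] := span_pair_cond (spanP u) (spanP v); exists p => //.
have [l E] := Subst_weak_assoc charF w (C_neq0 Cp) hp; exists l => i j.
rewrite !pmul_comp subst_x0x2E; last exact: pair_prod_truncr.
exact: (congr1 (fun A => A i j) E).
Qed.

Lemma span_quasi_module : is_quasi_module span_Y span_one span_YW.
Proof.
split=> // u v w; have [p /C_neq0 p0 [l h]] := span_module_weak_assoc u v w.
by exists ('X^l * p) => //; rewrite mulf_neq0 // expf_neq0 // polyX_eq0.
Qed.

(** At x1 = x0 + x2 the factor (x1 - x2)^k is x0^k, a shift of one exponent, which can be undone on
    any series. Only (x0 + x2)^l is left. *)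
Lemma span_module :
    (forall p, C p -> exists k : nat, p = ('X - 'Y) ^+ k) ->
  is_module span_Y span_one span_YW.
Proof.
move=> CE; split=> // u v w; have [p Cp [l h]] := span_module_weak_assoc u v w.
have [k pE] := CE p Cp; exists l => i j.
have := h (i + k%:Z) j; rewrite !pmul_comp pE mulrC.
have XY : ('X - 'Y) ^+ k \Po ('X + 'Y) = 'X^k :> {poly {poly F}}.
  by rewrite rmorphXn /= comp_polyB comp_polyX comp_polyC addrK.
by rewrite !pactM // -![pact (s1 \+ s2) s2 (('X - 'Y) ^+ k) _]pact_compD // XY
  !pactXn !iter_shift addrK.
Qed.

End Span.

Theorem theorem4p3 (F : fieldType) (charF : [pchar F] =i pred0)
    (W : lmodType F) (U : set (calE W)) :
  (compatible U ->
    forall K : set (calE W), is_smallest_closed (@compatible F W) U K ->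
    [/\ YE_closed (Fx_span K), compatible (Fx_span K), Fx_submodule (Fx_span K) &
      exists (one : Fx_spanType K)
             (act : laurent F -> Fx_spanType K -> Fx_spanType K)
             (Y : {linear Fx_spanType K -> calE (Fx_spanType K)})
             (YW : {linear Fx_spanType K -> calE W}),
        [/\ Fx_span_val one = idE W,
            forall f (a : Fx_spanType K), Fx_span_val (act f a) = lact f a,
            forall (a b : Fx_spanType K) (n : int),
              Fx_span_val (Y a b (- n - 1)) = nprod a b n,
            forall a : Fx_spanType K, YW a = a &
            [/\ is_nonlocal_Ft_va act Y one,
                is_module Y one YW &
                type_zero act YW]]])
  /\
  (quasi_compatible U ->
    forall K : set (calE W), is_smallest_closed (@quasi_compatible F W) U K ->
    [/\ YE_closed (Fx_span K), quasi_compatible (Fx_span K),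
        Fx_submodule (Fx_span K) &
      exists (one : Fx_spanType K)
             (act : laurent F -> Fx_spanType K -> Fx_spanType K)
             (Y : {linear Fx_spanType K -> calE (Fx_spanType K)})
             (YW : {linear Fx_spanType K -> calE W}),
        [/\ Fx_span_val one = idE W,
            forall f (a : Fx_spanType K), Fx_span_val (act f a) = lact f a,
            forall (a b : Fx_spanType K) (n : int),
              Fx_span_val (Y a b (- n - 1)) = nprod a b n,
            forall a : Fx_spanType K, YW a = a &
            [/\ is_nonlocal_Ft_va act Y one,
                is_quasi_module Y one YW &
                type_zero act YW]]]).
Proof.
have XY0 k : ('X - 'Y) ^+ k != 0 :> {poly {poly F}}.
  by rewrite expf_neq0 // polyXsubC_eq0.
split=> _ K [[Ksub KC KYE _ K1] _].
  (* In the compatible case the admissible polynomials are the powers of x - y; the zeroth power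
     supplies 1. *)
  pose C (p : {poly {poly F}}) := exists k : nat, p = ('X - 'Y) ^+ k.
  have C0 p : C p -> p != 0 by move=> [k ->].
  have C1 : C 1 by exists 0%N.
  have CM p q : C p -> C q -> C (p * q).
    by move=> [k ->] [l ->]; exists (k + l)%N; rewrite exprD.
  have KC' r (a : 'I_r -> calE W) : (forall i, K (a i)) -> exists2 p, C p & seq_cond p a.
    by move=> /KC[k hk]; exists (('X - 'Y) ^+ k) => //; exists k.
  split.
  - by move=> a b n La Lb; exact: (span_YE charF C0 C1 CM KC' KYE).
  - move=> r a La; have [_ [k ->] hk] := span_cond C1 CM KC' La.
    by exists k.
  - exact: Fx_span_submod.
  exists (span_one K1), (@span_act _ _ K), (span_Y charF C0 C1 CM KC' KYE), (@span_YW _ _ K).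
  split=> //; split.
  - exact: span_nonlocal_Ft_va.
  - exact: span_module.
  - by [].
(* In the quasi compatible case all nonzero polynomials are admissible; they are closed under
   products because the polynomials form a domain. *)
pose C (p : {poly {poly F}}) : Prop := p != 0.
have C1 : C 1 by exact: oner_neq0.
have CM p q : C p -> C q -> C (p * q) by exact: mulf_neq0.
split.
- by move=> a b n La Lb; exact: (span_YE charF (fun p => id) C1 CM KC KYE).
- by move=> r a La; exact: (span_cond C1 CM KC La).
- exact: Fx_span_submod.
exists (span_one K1), (@span_act _ _ K), (span_Y charF (fun p => id) C1 CM KC KYE), (@span_YW _ _ K).
split=> //; split.
- exact: span_nonlocal_Ft_va.
- exact: span_quasi_module.
- by [].
Qed.
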